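(* Let $F$ be a finite Orlicz function. Suppose that $F$ is doubling near infinity and that the mapping $t\mapsto F(t)t^{-2}$ is essentially increasing on $[1,\infty)$. Then any subsymmetric basic sequence in $L_F$ is equivalent to the unit vector system of $\ell_2$ or to the unit vector system of $\ell_G$ for some $G\in C_F$.
   Context: An Orlicz function is a convex non-decreasing function $F\colon[0,\infty)\to[0,\infty]$, not identically zero, with $F(0)=0$ and $F(c)<\infty$ for some $c>0$; it is finite if it never takes the value $\infty$. $L_F$ denotes the Orlicz space over $[0,1)$ with Lebesgue measure: measurable (real or complex) $f$ with $\|f\|=\inf\{t>0:\int_0^1F(|f|/t)\,dx\le 1\}<\infty$. For an Orlicz function $G$, $\ell_G$ is the Orlicz sequence space with norm $\|(a_n)\|=\inf\{t>0:\sum_nG(|a_n|/t)\le1\}$. $F$ is doubling near infinity if it is finite and $\sup_{t\ge1}F(2t)/F(t)<\infty$. A nonnegative function $h$ is essentially increasing on $[1,\infty)$ if there is a constant $C$ with $h(s)\le Ch(t)$ for $1\le s\le t$. For finite $F$ and $s>0$ with $F(s)>0$ set $F_s(t)=F(st)/F(s)$, $t\ge0$. For $b\ge0$ let $C_{F,b}$ be the closure in $(\mathcal C([0,1/2]),\|\cdot\|_\infty)$ of the convex hull of $\{F_s: s>b\}$ (restricted to $[0,1/2]$), and $C_F=\bigcap_{b\ge0}C_{F,b}$. Each $G\in C_{F}$ is extended to an Orlicz function on $[0,\infty)$ by requiring it to be linear (affine) on $[1/2,\infty)$ with $G(1)=1$; so $\ell_G$ makes sense (if $G$ vanishes near zero,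 $\ell_G=\ell_\infty$). A basic sequence is a Schauder basis of its closed linear span; it is unconditional if every rearrangement is a basic sequence, spreading if it is equivalent to each of its subsequences, subsymmetric if unconditional and spreading. Two sequences are equivalent if there is an isomorphism between their closed linear spans mapping one to the other termwise. *)

(* Defs.v *)
From HB Require Import structures.
From mathcomp Require Import all_boot all_order all_algebra.
From mathcomp Require Import complex.
From mathcomp Require Import all_classical all_reals all_analysis.

Set Implicit Arguments.
Unset Strict Implicit.
Unset Printing Implicit Defensive.

Import Order.TTheory GRing.Theory Num.Theory.
Import numFieldNormedType.Exports.

Local Open Scope classical_set_scope.
Local Open Scope ring_scope.

Section OrliczFunctions.
Variable R : realType.

(* An Orlicz function lives on [0, +oo[; it is represented by a function on R
   whose values at negative arguments are irrelevant.  Nonnegativity follows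
   from monotonicity and F 0 = 0.  A finite Orlicz function is a real-valued F
   such that EFin \o F is an Orlicz function. *)
Definition orlicz (F : R -> \bar R) : Prop :=
  [/\ forall x y l : R, 0 <= x -> 0 <= y -> 0 <= l <= 1 ->
        (F (l * x + (1 - l) * y)%R <= l%:E * F x + (1 - l)%:E * F y)%E,
      forall x y : R, 0 <= x -> x <= y -> (F x <= F y)%E,
      F 0 = 0%E,
      exists2 x : R, 0 <= x & F x <> 0%E
    & exists2 c : R, 0 < c & (F c < +oo)%E].

(* sup_{t >= 1} F(2t) / F(t) < oo, the quotient being meaningful: the clause
   0 < F t guards against the convention x / 0 = 0. *)
Definition doubling_near_infinity (F : R -> R) : Prop :=
  exists C : R, forall t : R, 1 <= t -> 0 < F t /\ F (2 * t) / F t <= C.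

Definition essentially_increasing (h : R -> R) : Prop :=
  exists C : R, forall s t : R, 1 <= s -> s <= t -> h s <= C * h t.

Definition dilate (F : R -> R) (s : R) : R -> R^o := fun t => F (s * t) / F s.

Definition convex_hull (A : set (R -> R^o)) : set (R -> R^o) :=
  smallest (@convex_set R (R -> R^o)) A.

Let I : set R := `[0, 2^-1].

(* Elements of C([0, 1/2]) are represented by functions on R of which only the
   restriction to [0, 1/2] matters: the topology of {uniform` I -> R}
   is that of uniform convergence on [0, 1/2] and ignores all other values. *)
Definition CFb (F : R -> R) (b : R) : set (R -> R) :=
  [set g : R -> R | {within I, continuous g} /\
           closure (convex_hull [set dilate F s | s in
                                  [set s | b < s /\ 0 < F s]]
                    : set {uniform` I -> R}) g].

Definition CF (F : R -> R) : set (R -> R) :=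
  \bigcap_(b in [set b | 0 <= b]) CFb F b.

(* On [1/2, +oo[, the affine function through (1/2, g (1/2)) and (1, 1). *)
Definition affine_extension (g : R -> R) (t : R) : R :=
  if t <= 2^-1 then g t else g 2^-1 + (1 - g 2^-1) * (2 * t - 1).

End OrliczFunctions.

Variant scalars := RealScalars | ComplexScalars.

Definition scalar_field (R : realType) (k : scalars) : numFieldType :=
  match k with RealScalars => R | ComplexScalars => R[i] end.

Definition modulus (R : realType) (k : scalars) : scalar_field R k -> R :=
  match k with
  | RealScalars => fun z : R => `|z|
  | ComplexScalars => fun z : R[i] => ComplexField.Normc.normc z
  end.
Arguments modulus {R k} z.

Definition scalar_measurable (R : realType) (k : scalars) (D : set R) :
    (R -> scalar_field R k) -> Prop :=
  match k with
  | RealScalars => fun f : R -> R => measurable_fun D f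
  | ComplexScalars => fun f : R -> R[i] =>
      measurable_fun D (fun x => complex.Re (f x)) /\
      measurable_fun D (fun x => complex.Im (f x))
  end.

(* The data of a normed space presented without forming a quotient: its vectors
   are represented by the elements of [carrier], a subset of an ambient vector
   space, and u and v represent the same vector when [vnorm] (u - v) = 0.  For
   Orlicz spaces of functions this is equality almost everywhere. *)
Record prenormed_space (R : realType) (K : numFieldType) := PrenormedSpace {
  ambient :> lmodType K;
  carrier : set ambient;
  vnorm : ambient -> \bar R
}.
Arguments carrier {R K} _.
Arguments vnorm {R K _} _.

Section BasicSequences.
Variables (R : realType) (K : numFieldType).
Implicit Types X Y : prenormed_space R K.

Definition lincomb X (x : nat -> X) (a : nat -> K) (n : nat) : X :=
  \sum_(i < n) a i *: x i.

Definition closed_span X (x : nat -> X) : set X :=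
  [set v | carrier X v /\
    forall e : R, 0 < e -> exists n a, (vnorm (v - lincomb x a n) < e%:E)%E].

Definition expansion X (x : nat -> X) (v : X) (a : nat -> K) : Prop :=
  vnorm (v - lincomb x a n) @[n --> \oo] --> (0 : \bar R)%E.

Definition basic X (x : nat -> X) : Prop :=
  (forall n, carrier X (x n)) /\
  forall v, closed_span x v -> exists! a, expansion x v a.

(* T induces an isomorphism between the closed linear spans of x and y once
   vectors at distance 0 are identified; compatibility of T with this
   identification follows from the last clause. *)
Definition span_isomorphism X Y (x : nat -> X) (y : nat -> Y) (T : X -> Y) :
    Prop :=
  [/\ forall u, closed_span x u -> closed_span y (T u),
      forall (a : K) u v, closed_span x u -> closed_span x v ->
        vnorm (T (a *: u + v) - (a *: T u + T v)) = 0%E,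
      forall w, closed_span y w ->
        exists2 u, closed_span x u & vnorm (T u - w) = 0%E
    & exists C : R, forall u, closed_span x u ->
        (vnorm (T u) <= C%:E * vnorm u)%E /\
        (vnorm u <= C%:E * vnorm (T u))%E].

Definition equivalent X Y (x : nat -> X) (y : nat -> Y) : Prop :=
  exists2 T : X -> Y, span_isomorphism x y T &
    forall n, vnorm (T (x n) - y n) = 0%E.

Definition unconditional X (x : nat -> X) : Prop :=
  forall s : nat -> nat, bijective s -> basic (x \o s).

Definition spreading X (x : nat -> X) : Prop :=
  forall k : nat -> nat, {homo k : i j / (i < j)%N} -> equivalent x (x \o k).

Definition subsymmetric_basic X (x : nat -> X) : Prop :=
  [/\ basic x, unconditional x & spreading x].

End BasicSequences.

Section OrliczSpaces.
Variables (R : realType) (k : scalars).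
Let K : numFieldType := scalar_field R k.

Definition luxemburg (rho : R -> \bar R) : \bar R :=
  ereal_inf [set t%:E | t in [set t : R | 0 < t /\ (rho t <= 1)%E]].

Definition LF_norm (F : R -> \bar R) (f : R -> K) : \bar R :=
  luxemburg (fun t =>
    \int[lebesgue_measure]_(x in `[0%R, 1%R[) F (modulus (f x) / t)%R)%E.

(* Functions on R of which only the restriction to [0, 1[ matters. *)
Definition LF (F : R -> \bar R) : prenormed_space R K :=
  @PrenormedSpace R K (R -> K^o)
    [set f | @scalar_measurable R k `[0, 1[ f /\ (LF_norm F f < +oo)%E]
    (LF_norm F).

Definition lG_norm (G : R -> \bar R) (a : nat -> K) : \bar R :=
  luxemburg (fun t => \sum_(0 <= n <oo) G (modulus (a n) / t)%R)%E.

Definition lG (G : R -> \bar R) : prenormed_space R K :=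
  @PrenormedSpace R K (nat -> K^o) [set a | (lG_norm G a < +oo)%E] (lG_norm G).

Definition l2_norm (a : nat -> K) : \bar R :=
  'N[counting]_2%:E [(fun n => (modulus (a n))%:E)]%E.

Definition l2 : prenormed_space R K :=
  @PrenormedSpace R K (nat -> K^o) [set a | (l2_norm a < +oo)%E] l2_norm.

Definition unit_vector (n : nat) : nat -> K^o := fun m => (m == n)%:R.

End OrliczSpaces.

(* Main.v *)
Require Import Defs.
From mathcomp Require Import all_boot all_order all_algebra.
From mathcomp Require Import complex.
From mathcomp Require Import all_classical all_reals all_analysis.
From mathcomp Require Import measurable_realfun.
From mathcomp Require Import ring lra.

(** The norm of L_F is compared with the norm of L_2 on the unit interval. Since
    F(t) / t^2 is essentially increasing, L_F is continuously contained in L_2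
    ([L2_le_LF]), and a subsymmetric sequence x falls into one of two cases.

    Suppose first that the integrals of |x_n|^2 stay above some delta > 0 on a
    tail. By the parallelogram law, signs can be chosen so that the L_2 norm of
    a combination of a tail is at least a multiple of the l_2 norm of its
    coefficients ([L2_signs]); as L_2 is dominated by L_F and x is unconditional
    and spreading, x satisfies a lower 2-estimate. An upper one holds because L_F
    has type 2: a random combination is estimated by a Khintchine inequality for
    F, where doubling makes F grow at most exponentially while random sums have
    subgaussian exponential moments ([khintchine_orlicz]), and the resulting
    square function by the 2-convexity of F ([two_convexity]). So x is equivalent
    to the unit vectors of l_2 ([equivalent_l2]).

    Otherwise some |x_n|^2 have arbitrarily small integrals arbitrarily far out.
    The Kadec-Pelczynski method ([disjointification]) extracts a subsequence that
    is, up to a summable error, a sequence of disjointly supported functions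
    y_j, where |y_j| > j on the support of y_j. For disjoint functions modulars
    add up, so the norm of a combination is determined by the functions sending b
    to the modular of b y_j. Rounding |y_j| to an integer changes b by a factor
    of at most 2 and turns these functions into finite combinations of the
    functions F(b v), v > j integer, that is, after normalisation, into convex
    combinations of the dilates F_v ([average_hull], [wsum_le_modular],
    [modular_le_wsum]). Convexity makes them 2-Lipschitz on [0, 1/2], hence a
    subsequence converges there, uniformly and geometrically fast, to some G
    ([uniform_subsequence]), which belongs to C_F because v tends to infinity with
    j ([CF_uniform_limit]). The errors being summable, the y_j are equivalent to
    the unit vectors of l_G ([wsum_sum_le1], [affine_sum_le1]); so is the
    subsequence of x by perturbation, and x itself because it is spreading
    ([equivalent_lG]).

    Two general facts about bases support this. Partial sums of expansions are
    uniformly bounded ([basis_constant], by a Baire category argument), and so are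
    the changes of signs in an unconditional basic sequence
    ([sign_unconditional], by a gliding hump). In the other direction, two-sided
    estimates on finite combinations are enough for an equivalence with unit
    vectors ([equivalent_unit_vector]), thanks to the completeness of L_F
    ([LF_banach]). *)

Set Implicit Arguments.
Unset Strict Implicit.
Unset Printing Implicit Defensive.

Import Order.TTheory GRing.Theory Num.Theory.
Import numFieldNormedType.Exports.

Local Open Scope classical_set_scope.
Local Open Scope ring_scope.

(** * Real and complex scalars *)

Section Scalars.
Variables (R : realType) (k : scalars).
Local Notation K := (scalar_field R k).

Definition reK : K -> R :=
  match k return scalar_field R k -> R with
  | RealScalars => fun z : R => z
  | ComplexScalars => fun z : R[i] => complex.Re z
  end.

Definition imK : K -> R :=
  match k return scalar_field R k -> R with
  | RealScalars => fun z : R => 0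
  | ComplexScalars => fun z : R[i] => complex.Im z
  end.

Definition ofR : R -> K :=
  match k return R -> scalar_field R k with
  | RealScalars => fun r => r
  | ComplexScalars => fun r => (r%:C)%C
  end.

Lemma reKD z w : reK (z + w) = reK z + reK w.
Proof. by rewrite /reK; case: k z w => // -[a b] [c d]. Qed.

Lemma imKD z w : imK (z + w) = imK z + imK w.
Proof. by rewrite /imK; case: k z w => [a b|[a b] [c d]] //=; rewrite addr0. Qed.

Lemma reKN z : reK (- z) = - reK z.
Proof. by rewrite /reK; case: k z => // -[a b]. Qed.

Lemma imKN z : imK (- z) = - imK z.
Proof. by rewrite /imK; case: k z => [a|[a b]] //=; rewrite oppr0. Qed.

Lemma reK0 : reK 0 = 0.
Proof. by rewrite /reK; case: k. Qed.

Lemma imK0 : imK 0 = 0.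
Proof. by rewrite /imK; case: k. Qed.

Lemma modulusE z : modulus z = Num.sqrt (reK z ^+ 2 + imK z ^+ 2).
Proof.
rewrite /modulus /reK /imK; case: k z => [a|[a b]] //=.
by rewrite expr0n addr0 sqrtr_sqr.
Qed.

Lemma modulus_ge0 (z : K) : 0 <= modulus z.
Proof. by rewrite modulusE sqrtr_ge0. Qed.

Lemma sqr_modulus (z : K) : modulus z ^+ 2 = reK z ^+ 2 + imK z ^+ 2.
Proof. by rewrite modulusE sqr_sqrtr// addr_ge0// sqr_ge0. Qed.

Lemma modulus0 : modulus (0 : K) = 0.
Proof. by rewrite modulusE reK0 imK0 expr0n addr0 sqrtr0. Qed.

Lemma modulusM (z w : K) : modulus (z * w) = modulus z * modulus w.
Proof.
rewrite /modulus; case: k z w => [a b|a b] /=; first by rewrite normrM.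
exact: ComplexField.Normc.normcM.
Qed.

Lemma modulus1 : modulus (1 : K) = 1.
Proof.
rewrite /modulus; case: k => /=; first by rewrite normr1.
exact: ComplexField.Normc.normc1.
Qed.

Lemma modulusN (z : K) : modulus (- z) = modulus z.
Proof. by rewrite !modulusE reKN imKN !sqrrN. Qed.

Lemma ler_modulusD (z w : K) : modulus (z + w) <= modulus z + modulus w.
Proof.
rewrite /modulus; case: k z w => [a b|a b] /=; first exact: ler_normD.
exact: le_normcD.
Qed.

Lemma modulus_eq0 (z : K) : modulus z = 0 -> z = 0.
Proof.
rewrite /modulus; case: k z => [a|a] /=; first by move/normr0P/eqP.
exact: ComplexField.Normc.eq0_normc.
Qed.

Lemma ofR_modulus r : modulus (ofR r) = `|r|.
Proof.
rewrite modulusE /ofR /reK /imK; case: k => //=; by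
  rewrite expr0n addr0 sqrtr_sqr.
Qed.

Lemma reK_sum (I : Type) (s : seq I) (P : pred I) (z : I -> K) :
  reK (\sum_(i <- s | P i) z i) = \sum_(i <- s | P i) reK (z i).
Proof. by elim/big_rec2: _ => [|i u v _ <-]; rewrite ?reK0 ?reKD. Qed.

Lemma imK_sum (I : Type) (s : seq I) (P : pred I) (z : I -> K) :
  imK (\sum_(i <- s | P i) z i) = \sum_(i <- s | P i) imK (z i).
Proof. by elim/big_rec2: _ => [|i u v _ <-]; rewrite ?imK0 ?imKD. Qed.

Lemma norm_reK z : `|reK z| <= modulus z.
Proof.
by rewrite modulusE -sqrtr_sqr ler_wsqrtr// lerDl sqr_ge0.
Qed.

Lemma norm_imK z : `|imK z| <= modulus z.
Proof.
by rewrite modulusE -sqrtr_sqr ler_wsqrtr// lerDr sqr_ge0.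
Qed.

Lemma modulus_le_re_im z : modulus z <= `|reK z| + `|imK z|.
Proof.
rewrite -(ler_pXn2r (_ : 0 < 2)%N) ?nnegrE ?modulus_ge0 ?addr_ge0//.
rewrite sqr_modulus sqrrD !real_normK ?num_real//.
by rewrite addrAC lerDl mulrn_wge0// mulr_ge0.
Qed.

Definition mkK : R -> R -> K :=
  match k return R -> R -> scalar_field R k with
  | RealScalars => fun a _ => a
  | ComplexScalars => fun a b => (a +i* b)%C
  end.

Lemma reK_mkK a b : reK (mkK a b) = a.
Proof. by rewrite /reK /mkK; case: k. Qed.

Lemma imK_mkK a b : k = ComplexScalars -> imK (mkK a b) = b.
Proof. by rewrite /imK /mkK; case: k. Qed.

Lemma reKM z w : reK (z * w) = reK z * reK w - imK z * imK w.
Proof.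
by rewrite /reK /imK; case: k z w => [a b|[a b] [c d]] //=; rewrite mulr0 subr0.
Qed.

Lemma imKM z w : imK (z * w) = reK z * imK w + imK z * reK w.
Proof.
by rewrite /reK /imK; case: k z w => [a b|[a b] [c d]] //=; rewrite mulr0 mul0r addr0.
Qed.

Lemma imK_real z : k = RealScalars -> imK z = 0.
Proof. by rewrite /imK => ek; move: z; rewrite ek. Qed.

Lemma scalar_measurableE (D : set R) (f : R -> K) :
  scalar_measurable D f <->
  measurable_fun D (fun x => reK (f x)) /\ measurable_fun D (fun x => imK (f x)).
Proof.
rewrite /scalar_measurable /reK /imK; case: k f => f //=.
by split => [|[]].
Qed.

Lemma geometric_real_cvg (z : nat -> R) (C : R) :
  (forall j, `|z j| <= C * 2^-1 ^+ j) ->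
  exists b, forall J, `|b - \sum_(j < J) z j| <= 2 * C * 2^-1 ^+ J.
Proof.
move=> zC.
have C0 : 0 <= C by have := zC 0; rewrite expr0 mulr1; exact/le_trans.
have tail J J' : (J <= J')%N ->
   `|\sum_(j < J') z j - \sum_(j < J) z j| <= 2 * C * 2^-1 ^+ J - 2 * C * 2^-1 ^+ J'.
  move=> /subnKC <-; elim: (J' - J)%N => [|n IH]; first by rewrite addn0 !subrr normr0.
  rewrite addnS big_ord_recr/= addrAC.
  apply: (le_trans (ler_normD _ _)); apply: (le_trans (lerD IH (zC _))).
  by rewrite exprS; lra.
have p2 J : 0 <= 2 * C * 2^-1 ^+ J :> R by rewrite !mulr_ge0// exprn_ge0// invr_ge0.
have cp : cvgn (fun n => 2 * C * 2^-1 ^+ n : R).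
  apply: is_cvgMr; apply/cvg_ex; exists 0.
  by apply: cvg_expr; rewrite ger0_norm ?invr_ge0//; lra.
have cz : cvgn (fun n => \sum_(j < n) z j).
  suff : cauchy_ex ((fun n => \sum_(j < n) z j) @ \oo).
    by move/cauchy_exP => ?; exact: cauchy_cvg.
  move=> /= e e0.
  have : 2 * C * 2^-1 ^+ n @[n --> \oo] --> (0 : R).
    rewrite -[X in _ --> X](mulr0 (2 * C)); apply: cvgMr.
    by apply: cvg_expr; rewrite ger0_norm ?invr_ge0//; lra.
  move/cvgrPdist_lt => /(_ _ e0)[N _ HN].
  exists (\sum_(j < N) z j); exists N => // n /= Nn.
  rewrite /ball/= distrC; apply: (le_lt_trans (tail _ _ Nn)).
  apply: (@le_lt_trans _ _ (2 * C * 2^-1 ^+ N)); first by rewrite gerBl.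
  by have := HN _ (leqnn N); rewrite sub0r normrN ger0_norm.
exists (limn (fun n => \sum_(j < n) z j)) => J.
have : `|\sum_(j < n) z j - \sum_(j < J) z j| @[n --> \oo] -->
  `|limn (fun n => \sum_(j < n) z j) - \sum_(j < J) z j|.
  by apply: cvg_norm; apply: cvgB => //; exact: cvg_cst.
move=> cl; apply: (ler_cvg_to cl (cvg_cst _)); exists J => // n /= Jn.
by apply: (le_trans (tail _ _ Jn)); rewrite gerBl.
Qed.

(** Completeness of the scalars along geometrically dominated series, with the
    rate of convergence that the coefficients of a limit expansion require. *)
Lemma geometric_scalar_cvg (z : nat -> K) (C : R) :
  (forall j, modulus (z j) <= C * 2^-1 ^+ j) ->
  exists b, forall J, modulus (b - \sum_(j < J) z j) <= 4 * C * 2^-1 ^+ J.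
Proof.
move=> zC.
have [a Ha] : exists b, forall J, `|b - \sum_(j < J) reK (z j)| <= 2 * C * 2^-1 ^+ J.
  apply: (geometric_real_cvg (z := fun j => reK (z j))) => j.
  exact: le_trans (norm_reK _) (zC j).
have [b Hb] : exists b, forall J, `|b - \sum_(j < J) imK (z j)| <= 2 * C * 2^-1 ^+ J.
  apply: (geometric_real_cvg (z := fun j => imK (z j))) => j.
  exact: le_trans (norm_imK _) (zC j).
have C0 : 0 <= C by have := zC 0; rewrite expr0 mulr1; exact/le_trans/modulus_ge0.
(* Over the reals [mkK] discards [b]: all imaginary parts vanish. *)
pose w := mkK a b; exists w => J.
apply: (le_trans (modulus_le_re_im _)).
rewrite reKD reKN reK_sum imKD imKN imK_sum reK_mkK.
have := Ha J; have : `|imK w - \sum_(j < J) imK (z j)| <= 2 * C * 2^-1 ^+ J.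
  case ek : k => [|]; last by rewrite imK_mkK//; exact: Hb.
  rewrite imK_real// big1 ?subr0 ?normr0 -?mulrA ?mulr_ge0// => i _.
  by rewrite imK_real.
lra.
Qed.

End Scalars.

(** * Banach spaces presented by a seminorm *)

Lemma half_pow_small (R : realType) (c e : R) : 0 < e ->
  exists J, forall n, (J <= n)%N -> c * 2^-1 ^+ n < e.
Proof.
move=> e0.
have : c * 2^-1 ^+ n @[n --> \oo] --> (0 : R).
  rewrite -[X in _ --> X](mulr0 c); apply: cvgMr.
  by apply: cvg_expr; rewrite ger0_norm ?invr_ge0//; lra.
move/cvgrPdist_lt => /(_ _ e0)[J _ HJ]; exists J => n Jn.
have := HJ _ Jn; rewrite sub0r normrN; exact/le_lt_trans/ler_norm.
Qed.

Lemma exists_nat_ge (R : realType) (M : R) : exists n : nat, M <= n%:R.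
Proof.
exists (Num.bound `|M|); apply: ltW.
exact: le_lt_trans (ler_norm M) (archi_boundP (normr_ge0 _)).
Qed.

(** The algebraic and metric properties used of a presented space. Everything is
    asserted on the carrier only: outside it the seminorm may be infinite. *)
Record banach (R : realType) (k : scalars)
    (X : prenormed_space R (scalar_field R k)) : Prop := Banach {
  carrier0 : carrier X 0;
  carrierZD : forall a u v, carrier X u -> carrier X v -> carrier X (a *: u + v);
  vnorm_ge0 : forall u : X, (0 <= vnorm u)%E;
  vnorm_fin : forall u : X, carrier X u -> vnorm u \is a fin_num;
  vnormZ : forall a (u : X), carrier X u ->
    vnorm (a *: u) = ((modulus a)%:E * vnorm u)%E;
  vnormD : forall u v : X, carrier X u -> carrier X v ->
    (vnorm (u + v) <= vnorm u + vnorm v)%E;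
  vnorm_complete : forall u : nat -> X, (forall n, carrier X (u n)) ->
    (forall e : R, 0 < e -> exists N, forall m n, (N <= m)%N -> (N <= n)%N ->
       (vnorm (u m - u n) < e%:E)%E) ->
    exists2 v, carrier X v & forall e : R, 0 < e ->
      exists N, forall n, (N <= n)%N -> (vnorm (v - u n) < e%:E)%E }.

(** The real-valued seminorm, faithful on the carrier; it makes linear
    arithmetic available. *)
Definition nrm (R : realType) (K : numFieldType) (X : prenormed_space R K)
  (u : X) : R := fine (vnorm u).

Section BanachTheory.
Variables (R : realType) (k : scalars).
Local Notation K := (scalar_field R k).
Variables (X : prenormed_space R K) (bX : banach X).

Lemma carrierZ a u : carrier X u -> carrier X (a *: u).
Proof. by move=> cu; rewrite -[_ *: _]addr0; apply: carrierZD => //; exact: carrier0. Qed.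

Lemma carrierD u v : carrier X u -> carrier X v -> carrier X (u + v).
Proof. by move=> cu cv; rewrite -[u]scale1r; apply: carrierZD. Qed.

Lemma carrierN u : carrier X u -> carrier X (- u).
Proof. by move=> cu; rewrite -scaleN1r; apply: carrierZ. Qed.

Lemma carrierB u v : carrier X u -> carrier X v -> carrier X (u - v).
Proof. by move=> cu cv; apply: carrierD => //; apply: carrierN. Qed.

Lemma carrier_sum (I : Type) (s : seq I) (P : pred I) (u : I -> X) :
  (forall i, carrier X (u i)) -> carrier X (\sum_(i <- s | P i) u i).
Proof.
move=> cu; elim/big_ind: _ => //; [exact: carrier0|exact: carrierD].
Qed.

Lemma carrier_lincomb x a n : (forall n, carrier X (x n)) ->
  carrier X (lincomb x a n).
Proof. by move=> cx; apply: carrier_sum => i; apply: carrierZ. Qed.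

Hint Resolve carrier0 carrierZ carrierD carrierN carrierB carrier_sum
  carrier_lincomb : carr.

Lemma vnormE (u : X) : carrier X u -> vnorm u = (nrm u)%:E.
Proof. by move=> cu; rewrite /nrm fineK//; apply: vnorm_fin. Qed.

Lemma nrm_ge0 (u : X) : 0 <= nrm u.
Proof. by rewrite /nrm fine_ge0//; exact: vnorm_ge0. Qed.

Lemma nrmZ a (u : X) : carrier X u -> nrm (a *: u) = modulus a * nrm u.
Proof.
by move=> cu; rewrite {1}/nrm vnormZ// (vnormE cu) -EFinM.
Qed.

Lemma nrm0 : nrm (0 : X) = 0.
Proof. by rewrite -(scale0r 0) nrmZ ?modulus0 ?mul0r//; auto with carr. Qed.

Lemma nrmN (u : X) : carrier X u -> nrm (- u) = nrm u.
Proof. by move=> cu; rewrite -scaleN1r nrmZ// modulusN modulus1 mul1r. Qed.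

Lemma nrmD (u v : X) : carrier X u -> carrier X v -> nrm (u + v) <= nrm u + nrm v.
Proof.
move=> cu cv; have := vnormD bX cu cv.
by rewrite !vnormE//; auto with carr.
Qed.

Lemma nrmB (u v : X) : carrier X u -> carrier X v -> nrm (u - v) <= nrm u + nrm v.
Proof. by move=> cu cv; rewrite -(nrmN cv); apply: nrmD => //; auto with carr. Qed.

Lemma nrm_distC (u v : X) : carrier X u -> carrier X v -> nrm (u - v) = nrm (v - u).
Proof. by move=> cu cv; rewrite -nrmN ?opprB//; auto with carr. Qed.

Lemma nrm_triangle (v u w : X) : carrier X u -> carrier X v -> carrier X w ->
  nrm (u - w) <= nrm (u - v) + nrm (v - w).
Proof.
move=> cu cv cw; apply: (le_trans _ (nrmD _ _)); auto with carr.
by rewrite addrA subrK.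
Qed.

Lemma nrm_le_dist (v u : X) : carrier X u -> carrier X v ->
  nrm u <= nrm (u - v) + nrm v.
Proof.
move=> cu cv; apply: (le_trans _ (nrmD _ _)); auto with carr.
by rewrite subrK.
Qed.

Lemma nrm_sum (I : Type) (s : seq I) (P : pred I) (u : I -> X) :
  (forall i, carrier X (u i)) ->
  nrm (\sum_(i <- s | P i) u i) <= \sum_(i <- s | P i) nrm (u i).
Proof.
move=> cu; elim: s => [|i s IH]; first by rewrite !big_nil nrm0.
rewrite !big_cons; case: ifP => // _.
by apply: (le_trans (nrmD _ _)); rewrite ?lerD2l//; auto with carr.
Qed.

Lemma nrm_complete (u : nat -> X) : (forall n, carrier X (u n)) ->
  (forall e : R, 0 < e -> exists N, forall m n, (N <= m)%N -> (N <= n)%N ->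
     nrm (u m - u n) < e) ->
  exists2 v, carrier X v & forall e : R, 0 < e ->
    exists N, forall n, (N <= n)%N -> nrm (v - u n) < e.
Proof.
move=> cu cauchy; have [|v cv Hv] := vnorm_complete bX cu.
  move=> e /cauchy[N HN]; exists N => m n Nm Nn.
  by rewrite vnormE ?lte_fin ?HN//; auto with carr.
exists v => // e /Hv[N HN]; exists N => n /HN.
by rewrite vnormE ?lte_fin//; auto with carr.
Qed.

Lemma lincombZD x (c : K) (a b : nat -> K) n :
  lincomb x (fun i => c * a i + b i) n =
    c *: lincomb x a n + lincomb x b n :> X.
Proof.
rewrite /lincomb scaler_sumr -big_split/=; apply: eq_bigr => i _.
by rewrite scalerDl scalerA.
Qed.

Lemma lincombB x (a b : nat -> K) n :
  lincomb x (fun i => a i - b i) n = lincomb x a n - lincomb x b n :> X.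
Proof.
rewrite /lincomb -sumrB; apply: eq_bigr => i _; by rewrite scalerBl.
Qed.

Lemma lincombS x (a : nat -> K) n :
  lincomb x a n.+1 = lincomb x a n + a n *: x n :> X.
Proof. by rewrite /lincomb big_ord_recr. Qed.

Lemma lincomb0 x (a : nat -> K) : lincomb x a 0 = 0 :> X.
Proof. by rewrite /lincomb big_ord0. Qed.

Lemma eq_lincomb x (a b : nat -> K) n :
  (forall i, (i < n)%N -> a i = b i) -> lincomb x a n = lincomb x b n :> X.
Proof. by move=> ab; apply: eq_bigr => i _; rewrite ab. Qed.

(** Coefficients that vanish from [n] on allow the length of a combination to be
    adjusted. *)
Lemma lincomb_widen x (a b : nat -> K) n N : (n <= N)%N ->
  (forall i, (i < n)%N -> b i = a i) -> (forall i, (n <= i)%N -> b i = 0) ->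
  lincomb x b N = lincomb x a n :> X.
Proof.
move=> /subnKC <- ba b0; elim: (N - n)%N => [|m IH].
  by rewrite addn0; exact: eq_lincomb.
by rewrite addnS lincombS IH b0 ?scale0r ?addr0// leq_addr.
Qed.

Lemma expansionP x v a : (forall n, carrier X (x n)) -> carrier X v ->
  expansion x v a <-> (forall e : R, 0 < e -> exists N, forall n, (N <= n)%N ->
     nrm (v - lincomb x a n) < e).
Proof.
move=> cx cv; rewrite /expansion.
have -> : (fun n => vnorm (v - lincomb x a n)) =
          (fun n => (nrm (v - lincomb x a n))%:E).
  by apply/funext => n; rewrite vnormE//; auto with carr.
split.
- move/fine_cvgP => [_] /cvgrPdist_lt H e /H[N _ HN]; exists N => n Nn.
  by have := HN _ Nn; rewrite /= sub0r normrN ger0_norm// nrm_ge0.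
- move=> H; apply/fine_cvgP; split; first exact: nearW.
  apply/cvgrPdist_lt => e /H[N HN]; exists N => // n Nn.
  by rewrite /= sub0r normrN ger0_norm ?nrm_ge0// HN.
Qed.

Lemma expansion_finite x a n v : carrier X v -> (forall n, carrier X (x n)) ->
  (forall i, (n <= i)%N -> a i = 0) -> nrm (v - lincomb x a n) = 0 ->
  expansion x v a.
Proof.
move=> cv cx a0 v0; apply/expansionP => // e e0; exists n => m nm.
by rewrite (lincomb_widen x nm (fun _ _ => erefl) a0) v0.
Qed.

Lemma expansion_span x v a : (forall n, carrier X (x n)) ->
  carrier X v -> expansion x v a -> closed_span x v.
Proof.
move=> cx cv /expansionP H; split => // e /(H cx cv)[N HN].
exists N, a; rewrite vnormE ?lte_fin; first exact: HN.
auto with carr.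
Qed.

Lemma expansionZD x u v a b c : (forall n, carrier X (x n)) ->
  carrier X u -> carrier X v -> expansion x u a -> expansion x v b ->
  expansion x (c *: u + v) (fun i => c * a i + b i).
Proof.
move=> cx cu cv /expansionP Hu /expansionP Hv.
apply/expansionP => //; first by auto with carr.
move=> e e0.
have m0 : 0 < modulus c + 1 by rewrite ltr_wpDl ?modulus_ge0.
have [|N HN] := Hu cx cu (e / 2 / (modulus c + 1)).
  by rewrite !divr_gt0.
have [|M HM] := Hv cx cv (e / 2); first by rewrite divr_gt0.
exists (maxn N M) => n; rewrite geq_max => /andP[Nn Mn].
rewrite lincombZD opprD addrACA -scalerBr.
apply: (le_lt_trans (nrmD _ _)); auto with carr.
rewrite nrmZ; last by auto with carr.
have := HN _ Nn; rewrite ltr_pdivlMr// => h1; have := HM _ Mn => h2.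
have := nrm_ge0 (u - lincomb x a n); have := modulus_ge0 c; nra.
Qed.

Lemma expansion_nrm x v a : (forall n, carrier X (x n)) -> carrier X v ->
  expansion x v a -> exists M, forall n, nrm (lincomb x a n) <= M.
Proof.
move=> cx cv /expansionP H; have [|N HN] := H cx cv 1; first by [].
exists (\sum_(i < N) nrm (lincomb x a i) + (nrm v + 1)) => n.
have [Nn|nN] := leqP N n.
  apply: ler_wpDl; first by apply: sumr_ge0 => i _; exact: nrm_ge0.
  apply: (le_trans (@nrm_le_dist v _ _ _)); auto with carr.
  rewrite addrC lerD2l ltW// nrm_distC ?HN//; auto with carr.
rewrite (bigD1 (Ordinal nN))//= -!addrA lerDl; apply: addr_ge0.
  by apply: sumr_ge0 => i _; exact: nrm_ge0.
by apply: addr_ge0 => //; exact: nrm_ge0.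
Qed.

Lemma expansion_nrm_le x v a (c : R) (N : nat) : (forall n, carrier X (x n)) ->
  carrier X v -> expansion x v a ->
  (forall n, (N <= n)%N -> nrm (lincomb x a n) <= c) -> nrm v <= c.
Proof.
move=> cx cv /expansionP H Hc; apply/ler_addgt0Pr => e e0.
have [|M HM] := H cx cv e; first by [].
apply: (le_trans (@nrm_le_dist (lincomb x a (maxn N M)) _ _ _)); auto with carr.
by rewrite addrC lerD// ?Hc ?leq_maxl// ltW// HM// leq_maxr.
Qed.

Lemma lincomb_delta x n m :
  lincomb x (fun i => (i == n)%:R : K) m = (if (n < m)%N then x n else 0) :> X.
Proof.
rewrite /lincomb; case: ifPn => nm.
  rewrite (bigD1 (Ordinal nm))//= eqxx scale1r big1 ?addr0// => i ni.
  by rewrite (_ : _ == _ = false) ?scale0r//; apply/negbTE.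
rewrite big1// => i _; rewrite (_ : _ == _ = false) ?scale0r//.
by apply/negbTE; rewrite neq_ltn (leq_trans (ltn_ord i)) 1?leqNgt.
Qed.

Lemma expansion_delta x n : (forall n, carrier X (x n)) ->
  expansion x (x n) (fun i => (i == n)%:R : K).
Proof.
move=> cx; apply/expansionP => // e e0; exists n.+1 => m nm.
by rewrite lincomb_delta nm subrr nrm0.
Qed.

Lemma basic_gt0 x n : basic x -> 0 < nrm (x n : X).
Proof.
move=> [cx bx]; rewrite lt_neqAle nrm_ge0 andbT; apply/eqP => /esym xn0.
have e1 : expansion x 0 (fun i => (i == n)%:R : K).
  apply: (expansion_finite (n := n.+1)); auto with carr.
    by move=> i ni; rewrite gtn_eqF.
  by rewrite lincomb_delta ltnSn sub0r nrmN.
have e2 : expansion x 0 (fun=> 0 : K).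
  by apply: (expansion_finite (n := 0%N)); auto with carr;
    rewrite lincomb0 subrr nrm0.
have [|a [_ Ha]] := bx 0; first by apply: expansion_span e2; auto with carr.
have := Ha _ e1; rewrite (Ha _ e2) => /(congr1 (fun f => f n)).
by rewrite eqxx => /eqP; rewrite eq_sym oner_eq0.
Qed.

Lemma basic_expansion x v : basic x -> closed_span x v ->
  exists a, expansion (X := X) x v a.
Proof. by move=> [_ bx] /bx[a [Ha _]]; exists a. Qed.

Lemma basic_unique x v a b : basic x -> carrier X v ->
  expansion x v a -> expansion x v b -> a = b.
Proof.
move=> [cx bx] cv Ha Hb; have [|c [_ Hc]] := bx v; first exact: expansion_span Ha.
by rewrite -(Hc _ Ha) -(Hc _ Hb).
Qed.

Lemma basic_spanZD x (c : K) u v : basic x -> closed_span x u -> closed_span x v ->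
  closed_span x (c *: u + v : X).
Proof.
move=> bx su sv; have [a Ha] := basic_expansion bx su.
have [b Hb] := basic_expansion bx sv.
have [cx _] := bx; have [cu _] := su; have [cv _] := sv.
by apply: expansion_span (expansionZD c _ _ _ Ha Hb); auto with carr.
Qed.

Lemma span_lim x v : (forall n, carrier X (x n)) -> carrier X v ->
  (forall e : R, 0 < e -> exists2 u, closed_span x u & nrm (v - u) < e) ->
  closed_span x v.
Proof.
move=> cx cv H; split=> // e e0.
have [|u [cu Hu] vu] := H (e / 2); first by rewrite divr_gt0.
have [|n [a Ha]] := Hu (e / 2); first by rewrite divr_gt0.
exists n, a; move: Ha; rewrite !vnormE ?lte_fin; auto with carr => Ha.
apply: (le_lt_trans (@nrm_triangle u _ _ _ _ _)); auto with carr.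
lra.
Qed.

Lemma lincomb_span x a n : (forall n, carrier X (x n)) ->
  closed_span x (lincomb x a n : X).
Proof.
move=> cx; split; first by auto with carr.
by move=> e e0; exists n, a; rewrite subrr vnormE ?nrm0 ?lte_fin//; auto with carr.
Qed.

Lemma lincomb_expansion x a n : (forall n, carrier X (x n)) ->
  expansion x (lincomb x a n : X) (fun i => if (i < n)%N then a i else 0).
Proof.
move=> cx; apply: (expansion_finite (n := n)); auto with carr.
  by move=> i; rewrite leqNgt => /negbTE ->.
rewrite (@eq_lincomb _ _ a) ?subrr ?nrm0// => i ->//.
Qed.

(** A term of an expansion is the difference of two consecutive partial sums. *)
Lemma coef_le (x : nat -> X) (a : nat -> K) (i : nat) (c : R) : (forall n, carrier X (x n)) ->
  (forall n, nrm (lincomb x a n) <= c) -> modulus (a i) * nrm (x i) <= 2 * c.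
Proof.
move=> cx Hc; rewrite -nrmZ//.
have -> : a i *: x i = lincomb x a i.+1 - lincomb x a i.
  by rewrite lincombS addrC addKr.
apply: (le_trans (nrmB _ _)); auto with carr.
by rewrite mulr2n mulrDl mul1r lerD.
Qed.

End BanachTheory.
#[export] Hint Resolve carrier0 carrierZ carrierD carrierN carrierB carrier_sum
  carrier_lincomb : carr.

(** * The basis constant *)

Section BasisConstant.
Variables (R : realType) (k : scalars).
Local Notation K := (scalar_field R k).
Variables (X : prenormed_space R K) (bX : banach X).

Definition bounded_sums (x : nat -> X) (M : R) (v : X) : Prop :=
  exists2 a : nat -> K, expansion x v a & forall n, nrm (lincomb x a n) <= M.

(** Baire category for the closed span, which is the union over M of the sets of
    vectors whose partial sums are bounded by M: one of these sets is dense in some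
    ball. If none were, each ball would contain a smaller one missing
    [bounded_sums x M], and balls shrinking for M = 0, 1, 2, ... would meet in a
    vector of the span whose partial sums are unbounded. *)
Lemma bounded_sums_dense x : basic x ->
  exists M r v0, [/\ 0 < r, 0 <= M, closed_span x v0 &
    forall v, closed_span x v -> nrm (v - v0) < r -> forall e : R, 0 < e ->
    exists u : X, [/\ carrier X u, bounded_sums x M u & nrm (v - u) < e]].
Proof.
move=> bx; have [cx _] := bx; apply: contrapT => H.
(* A refinement of the ball of centre [Mp.2.1] and radius [Mp.2.2]; halving
   the radius leaves room for the closed ball inside the open one. *)
have step : forall (Mp : nat * (X * R)), exists q : X * R,
    closed_span x Mp.2.1 -> 0 < Mp.2.2 ->
    [/\ closed_span x q.1, 0 < q.2, q.2 <= Mp.2.2 / 2,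
      nrm (q.1 - Mp.2.1) < Mp.2.2 / 2 &
      forall u, carrier X u -> bounded_sums x Mp.1%:R u -> q.2 < nrm (q.1 - u)].
  move=> [M [v0 r]] /=.
  apply: contrapT => Hq; apply: H; exists M%:R, (r / 2), v0.
  have [sv0 r0] : closed_span x v0 /\ 0 < r.
    by split; apply: contrapT => h; apply: Hq; exists (v0, r).
  split=> //; first by rewrite divr_gt0.
  move=> v sv vv0 e e0; apply: contrapT => Hu; apply: Hq.
  exists (v, Num.min r e / 2) => _ _ /=; split => //.
  - by rewrite divr_gt0// lt_min r0.
  - by rewrite ler_pM2r ?invr_gt0// ge_min lexx.
  - move=> u cu bu; have [vu|vu] := ltP (nrm (v - u)) e.
      by exfalso; apply: Hu; exists u.
    apply: lt_le_trans vu.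
    have : Num.min r e <= e by rewrite ge_min lexx orbT.
    have : 0 < Num.min r e by rewrite lt_min r0.
    lra.
have [f Hf] := choice step.
pose g := fix g n : X * R := if n is m.+1 then f (m, g m) else (0, 1).
have Hg n : closed_span x (g n).1 /\ 0 < (g n).2.
  elim: n => [|n [sn rn]] /=.
    by split => //; rewrite -(lincomb0 x (fun=> 0)); apply: lincomb_span.
  by have [] := Hf (n, g n) sn rn.
have Hstep n : [/\ (g n.+1).2 <= (g n).2 / 2, nrm ((g n.+1).1 - (g n).1) < (g n).2 / 2 &
    forall u, carrier X u -> bounded_sums x n%:R u -> (g n.+1).2 < nrm ((g n.+1).1 - u)].
  by have [sn rn] := Hg n; have [] := Hf (n, g n) sn rn.
have cg n : carrier X (g n).1 by have [[]] := Hg n.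
have gle m n : (m <= n)%N -> nrm ((g n).1 - (g m).1) <= (g m).2 - (g n).2.
  move=> /subnKC <-; elim: (n - m)%N => [|j IH].
    by rewrite addn0 !subrr nrm0.
  have [h1 h2 _] := Hstep (m + j)%N; rewrite addnS.
  apply: (le_trans (@nrm_triangle _ _ _ bX (g (m + j)%N).1 _ _ _ _ _)) => //.
  lra.
have g2 n : (g n).2 <= 1 * 2^-1 ^+ n.
  elim: n => [|n IH]; first by rewrite expr0 mulr1.
  have [h _ _] := Hstep n; apply: (le_trans h); rewrite exprS; lra.
have gpos n : 0 < (g n).2 by have [] := Hg n.
have [|w cw Hw] := nrm_complete bX cg.
  move=> e e0; have [J HJ] := half_pow_small 1 (divr_gt0 e0 (ltr0Sn _ 1)).
  exists J => m n Jm Jn.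
  apply: (le_lt_trans (@nrm_triangle _ _ _ bX (g J).1 _ _ _ _ _)) => //.
  rewrite (@nrm_distC _ _ _ bX _ (g n).1)//.
  have := gle _ _ Jm; have := gle _ _ Jn; have := HJ _ (leqnn J).
  have := g2 J; have := gpos m; have := gpos n; lra.
have wle m : nrm (w - (g m).1) <= (g m).2.
  apply/ler_addgt0Pr => e /Hw[N HN].
  apply: (le_trans (@nrm_triangle _ _ _ bX (g (maxn N m)).1 _ _ _ _ _)) => //.
  have := HN _ (leq_maxl N m); have := gle _ _ (leq_maxr N m).
  have := gpos (maxn N m); lra.
have sw : closed_span x w.
  apply: (span_lim bX) => // e /Hw[N HN]; exists (g N).1; last exact: HN.
  by have [] := Hg N.
have [a Ha] := basic_expansion bx sw.
have [M HM] := expansion_nrm bX cx cw Ha.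
have [n Mn] := exists_nat_ge M.
have [_ _ /(_ w cw)] := Hstep n.
have h : bounded_sums x n%:R w by exists a => // m; exact: le_trans Mn.
move=> /(_ h); rewrite (@nrm_distC _ _ _ bX)// ltNge.
by rewrite wle.
Qed.

(** The ball of [bounded_sums_dense] is moved to the origin by differences of
    approximations, which doubles the bound M, and is then rescaled. *)
Lemma bounded_sums_approx x : basic x -> exists2 C, 0 <= C &
  forall (rho : R) v, 0 < rho -> closed_span x v -> nrm v < rho ->
  forall e : R, 0 < e -> exists u : X,
    [/\ carrier X u, bounded_sums x (C * rho) u & nrm (v - u) < e].
Proof.
move=> bx; have [cx _] := bx.
have [M [r [v0 [r0 M0 sv0 H]]]] := bounded_sums_dense bx.
have [cv0 _] := sv0.
exists (2 * M / r); first by rewrite divr_ge0 ?mulr_ge0// ltW.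
move=> rho v rho0 sv vrho e e0; have [cv _] := sv.
pose c : R := r / rho; have c0 : 0 < c by rewrite divr_gt0.
have mc : modulus (ofR k c) = c by rewrite ofR_modulus gtr0_norm.
have mc' : modulus (ofR k c^-1) = c^-1 by rewrite ofR_modulus gtr0_norm// invr_gt0.
have e1 : 0 < e * c / 2 by rewrite divr_gt0// mulr_gt0.
have [||u1 [cu1 [a1 Ha1 B1] h1]] := H (ofR k c *: v + v0) _ _ _ e1.
- exact: basic_spanZD.
- by rewrite addrK nrmZ// mc (lt_le_trans (y := c * rho)) ?ltr_pM2l// /c divfK ?gt_eqF.
have [||u2 [cu2 [a2 Ha2 B2] h2]] := H v0 _ _ _ e1 => //.
  by rewrite subrr nrm0.
have cc : ofR k c^-1 * ofR k c = 1.
  rewrite /ofR; case: (k) => /=; first by rewrite mulVf ?gt_eqF.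
  by rewrite -rmorphM mulVf ?gt_eqF.
exists (ofR k c^-1 *: (u1 - u2)); split.
- by auto with carr.
- exists (fun i => ofR k c^-1 * (a1 i - a2 i) + 0).
    have h := expansionZD bX (-1) cx cu2 cu1 Ha2 Ha1.
    rewrite -[X in expansion _ X _]addr0.
    have -> : u1 - u2 = -1 *: u2 + u1 by rewrite scaleN1r addrC.
    have -> : (fun i => ofR k c^-1 * (a1 i - a2 i) + 0) =
              (fun i => ofR k c^-1 * (-1 * a2 i + a1 i) + (fun=> 0) i).
      by apply/funext => i; rewrite mulN1r (addrC (- _)).
    apply: (expansionZD bX) => //; auto with carr.
    by apply: (expansion_finite bX (n := 0%N)); auto with carr;
      rewrite lincomb0 subrr nrm0.
  move=> n; rewrite lincombZD lincombB.
  rewrite [X in _ + X](_ : _ = 0) ?addr0; last first.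
    by rewrite /lincomb big1// => i _; rewrite scale0r.
  rewrite nrmZ ?mc'; auto with carr.
  rewrite [X in _ <= X](_ : _ = c^-1 * (2 * M)); last first.
    by rewrite /c invf_div; field; rewrite gt_eqF.
  rewrite ler_pM2l ?invr_gt0//.
  apply: (le_trans (nrmB bX _ _)); auto with carr.
  by rewrite mulr2n mulrDl mul1r lerD.
- have -> : v - ofR k c^-1 *: (u1 - u2) =
     ofR k c^-1 *: ((ofR k c *: v + v0 - u1) - (v0 - u2)).
    rewrite -[in LHS](scale1r v) -cc -scalerA -scalerBr; congr (_ *: _).
    rewrite !opprB -!addrA; congr (_ + _).
    by rewrite [RHS]addrC -!addrA addNr addr0 addrC.
  rewrite (nrmZ bX) ?mc'; last by auto 6 with carr.
  rewrite ltr_pdivrMl//; apply: (le_lt_trans (nrmB bX _ _)); auto with carr.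
  lra.
Qed.

(** A geometrically fast series of vectors is expanded by summing its expansions
    coefficient by coefficient. *)
Lemma geometric_expansion x (v : X) (u : nat -> X) (a : nat -> nat -> K) (C rho : R) :
  basic x -> carrier X v -> 0 <= C -> 0 < rho ->
  (forall j, carrier X (u j)) ->
  (forall j, expansion x (u j) (a j)) ->
  (forall j n, nrm (lincomb x (a j) n) <= C * 2^-1 ^+ j) ->
  (forall J, nrm (v - \sum_(j < J) u j) <= rho * 2^-1 ^+ J) ->
  exists2 b, expansion x v b & forall n, nrm (lincomb x b n) <= 2 * C.
Proof.
move=> bx cv C0 rho0 cu Hu Ha Hv; have [cx _] := bx.
have h0 J : 0 <= 2^-1 ^+ J :> R by rewrite exprn_ge0// invr_ge0.
have : forall i, exists b : K, forall J,
    modulus (b - \sum_(j < J) a j i) * nrm (x i) <= 8 * C * 2^-1 ^+ J.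
  move=> i; have xi0 := basic_gt0 bX i bx.
  have [|b Hb] := geometric_scalar_cvg (z := fun j => a j i) (C := 2 * C / nrm (x i)).
    move=> j; rewrite mulrAC ler_pdivlMr//.
    apply: (le_trans (coef_le bX i cx (Ha j))); by rewrite mulrA.
  by exists b => J; rewrite -ler_pdivlMr//; apply: (le_trans (Hb J));
    rewrite le_eqVlt; apply/orP; left; apply/eqP; field; rewrite gt_eqF.
move=> /choice[b Hb].
have sumE n J : \sum_(j < J) lincomb x (a j) n =
    lincomb x (fun i => \sum_(j < J) a j i) n :> X.
  by rewrite /lincomb exchange_big/=; apply: eq_bigr => i _; rewrite scaler_suml.
have cs n J : carrier X (\sum_(j < J) lincomb x (a j) n).
  by rewrite sumE; auto with carr.
(* This bound is not uniform in [n]. It only serves to let [J] tend to infinity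
   for fixed [n], after which the telescoping bound [tail] yields [dist], which
   is uniform. *)
have dist0 n J : nrm (lincomb x b n - \sum_(j < J) lincomb x (a j) n) <=
    n%:R * (8 * C) * 2^-1 ^+ J.
  rewrite sumE -lincombB /lincomb.
  apply: (le_trans (nrm_sum bX _ _ _)); first by move=> i; auto with carr.
  rewrite -mulrA -[n in n%:R]card_ord mulr_natl -sumr_const.
  by apply: ler_sum => i _; rewrite nrmZ.
have tail n J m : nrm (\sum_(j < J + m) lincomb x (a j) n -
    \sum_(j < J) lincomb x (a j) n) <= 2 * C * 2^-1 ^+ J - 2 * C * 2^-1 ^+ (J + m).
  elim: m => [|m IH]; first by rewrite addn0 !subrr nrm0.
  rewrite addnS big_ord_recr/= addrAC.
  apply: (le_trans (nrmD bX _ _)); auto with carr.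
  have := Ha (J + m)%N n; rewrite exprS; lra.
have dist n J : nrm (lincomb x b n - \sum_(j < J) lincomb x (a j) n) <=
    2 * C * 2^-1 ^+ J.
  apply/ler_addgt0Pr => e e0.
  have [N HN] := half_pow_small (n%:R * (8 * C)) e0.
  apply: (le_trans (@nrm_triangle _ _ _ bX (\sum_(j < J + N) lincomb x (a j) n) _ _ _ _ _)); auto with carr.
  have := tail n J N; have := dist0 n (J + N)%N.
  have := HN _ (leq_addl J N).
  have := mulr_ge0 (mulr_ge0 (ler0n R 2) C0) (h0 (J + N)%N); lra.
exists b; last first.
  move=> n; have := dist n 0%N; by rewrite big_ord0 subr0 expr0 mulr1.
apply/(expansionP bX) => // e e0.
have e3 : 0 < e / 3 by rewrite divr_gt0.
have [J1 HJ1] := half_pow_small rho e3.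
have [J2 HJ2] := half_pow_small (2 * C) e3.
pose J := maxn J1 J2.
have eU : expansion x (\sum_(j < J) u j) (fun i => \sum_(j < J) a j i).
  elim: J => [|J IH].
    rewrite big_ord0; apply: (expansion_finite bX (n := 0%N)); auto with carr.
      by move=> i _; rewrite big_ord0.
    by rewrite lincomb0 subrr nrm0.
  rewrite big_ord_recr/= -[X in X + _]scale1r.
  have -> : (fun i => \sum_(j < J.+1) a j i) =
            (fun i => 1 * (\sum_(j < J) a j i) + a J i).
    by apply/funext => i; rewrite big_ord_recr/= mul1r.
  by apply: (expansionZD bX) => //; auto with carr.
have cU : carrier X (\sum_(j < J) u j) by auto with carr.
have [N HN] := (expansionP bX _ cx cU).1 eU _ e3.
exists N => n Nn.
apply: (le_lt_trans (@nrm_triangle _ _ _ bX (\sum_(j < J) u j) _ _ _ _ _)); auto with carr.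
have h : nrm (\sum_(j < J) u j - lincomb x b n) <=
    nrm (\sum_(j < J) u j - \sum_(j < J) lincomb x (a j) n) +
    nrm (\sum_(j < J) lincomb x (a j) n - lincomb x b n).
  by apply: nrm_triangle; auto with carr.
have := HN _ Nn; have := Hv J; have := dist n J.
rewrite -sumE (@nrm_distC _ _ _ bX (lincomb x b n)); auto with carr.
have := HJ1 _ (leq_maxl J1 J2); have := HJ2 _ (leq_maxr J1 J2).
rewrite -/J; lra.
Qed.

(** Successive approximation, as in the proof of the open mapping theorem: [v] is
    a geometrically fast sum of vectors with controlled partial sums. The expansion
    obtained by summation is the given one, since expansions are unique. *)
Theorem basis_constant (x : nat -> X) : basic x -> exists2 C, 0 <= C &
  forall v (a : nat -> K), closed_span x v -> expansion x v a ->
  forall n, nrm (lincomb x a n) <= C * nrm v.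
Proof.
move=> bx; have [cx _] := bx.
have [C C0 HC] := bounded_sums_approx bx.
exists (2 * C); first by rewrite mulr_ge0.
move=> v a sv Ha n; have [cv _] := sv.
suff main rho : nrm v < rho -> nrm (lincomb x a n) <= 2 * (C * rho).
  apply/ler_addgt0Pr => e e0.
  have C1 : 0 < 2 * C + 1 by rewrite ltr_wpDl// mulr_ge0.
  have := main (nrm v + e / (2 * C + 1)).
  rewrite ltrDl divr_gt0// => /(_ isT) h; apply: (le_trans h).
  rewrite !mulrA mulrDr lerD2l mulrCA ger_pMr//.
  by rewrite ler_pdivrMr// mul1r lerDl.
move=> vrho; have rho0 : 0 < rho by apply: le_lt_trans vrho; exact: nrm_ge0.
have : forall (jv : nat * X), exists ua : X * (nat -> K),
    closed_span x jv.2 -> nrm jv.2 < rho * 2^-1 ^+ jv.1 ->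
    [/\ carrier X ua.1, expansion x ua.1 ua.2,
      forall n, nrm (lincomb x ua.2 n) <= C * rho * 2^-1 ^+ jv.1 &
      nrm (jv.2 - ua.1) < rho * 2^-1 ^+ jv.1.+1].
  move=> [j w] /=.
  have [sw|] := pselect (closed_span x w); last by move=> h; exists (0, fun=> 0).
  have [hw|] := boolP (nrm w < rho * 2^-1 ^+ j); last by exists (0, fun=> 0).
  have rp i : 0 < rho * 2^-1 ^+ i by rewrite mulr_gt0// exprn_gt0// invr_gt0.
  have [u [cu [b Hb Bb] wu]] := HC _ w (rp j) sw hw _ (rp j.+1).
  by exists (u, b) => _ _; split => //= m; rewrite -mulrA.
move=> /choice[f Hf].
(* The successive residuals. *)
pose g := fix g n : X := if n is m.+1 then g m - (f (m, g m)).1 else v.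
have Hg j : closed_span x (g j) /\ nrm (g j) < rho * 2^-1 ^+ j.
  elim: j => [|j [sj hj]] /=; first by rewrite expr0 mulr1.
  have [cu eu _ hu] := Hf (j, g j) sj hj; split=> //.
  rewrite addrC -scaleN1r; apply: (basic_spanZD bX) => //.
  exact: (expansion_span bX cx cu eu).
have Hs j := Hf (j, g j) (Hg j).1 (Hg j).2.
have gE J : g J = v - \sum_(j < J) (f (j : nat, g j)).1.
  elim: J => [|J IH] /=; first by rewrite big_ord0 subr0.
  by rewrite big_ord_recr/= {1}IH opprD addrA.
have [||||||b Hb Bb] := @geometric_expansion x v (fun j => (f (j, g j)).1)
  (fun j => (f (j, g j)).2) (C * rho) rho bx cv.
- by rewrite mulr_ge0// ltW.
- by [].
- by move=> j; have [] := Hs j.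
- by move=> j; have [] := Hs j.
- by move=> j m; have [_ _ /(_ m)] := Hs j.
- by move=> J; rewrite -gE; have [_ /ltW] := Hg J.
by rewrite (basic_unique bX bx cv Ha Hb).
Qed.

Lemma basis_constant_finite (x : nat -> X) : basic x -> exists2 C, 0 <= C &
  forall (a : nat -> K) n N, (n <= N)%N ->
    nrm (lincomb x a n : X) <= C * nrm (lincomb x a N : X).
Proof.
move=> bx; have [cx _] := bx; have [C C0 HC] := basis_constant bx.
exists C => // a n N nN.
have := HC _ _ (lincomb_span bX a N cx) (lincomb_expansion bX a N cx) n.
by rewrite (@eq_lincomb _ _ _ x _ a)// => i /leq_trans -> //.
Qed.

End BasisConstant.

(** * Unconditional basic sequences *)

(** Strictly growing lists, each enumerating an initial segment of the integers,
    are the initial segments of a permutation of the integers. *)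
Lemma prefix_permutation (L : nat -> seq nat) :
  (forall j, perm_eq (L j) (iota 0 (size (L j)))) ->
  (forall j, exists2 t, t != [::] & L j.+1 = L j ++ t) ->
  exists2 s : nat -> nat, bijective s &
    forall j, L j = [seq s n | n <- iota 0 (size (L j))].
Proof.
move=> permL stepL.
have prefL i j : (i <= j)%N -> exists t, L j = L i ++ t.
  move=> /subnKC <-; elim: (j - i)%N => [|n [t IH]].
    by exists [::]; rewrite addn0 cats0.
  have [t' _ e] := stepL (i + n)%N; exists (t ++ t').
  by rewrite addnS e IH catA.
have sizeL j : (j <= size (L j))%N.
  elim: j => // j IH; have [[|a t] // _ ->] := stepL j.
  by rewrite size_cat/= addnS ltnS (leq_trans IH) ?leq_addr.
have nthL i j n : (n < size (L i))%N -> (n < size (L j))%N ->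
    nth 0%N (L i) n = nth 0%N (L j) n.
  wlog ij : i j / (i <= j)%N.
    move=> H ni nj; have [ij|/ltnW ji] := leqP i j; first exact: H.
    by apply/esym; exact: H.
  by have [t ->] := prefL _ _ ij; move=> ni _; rewrite nth_cat ni.
have uniqL j : uniq (L j) by rewrite (perm_uniq (permL j)) iota_uniq.
have memL j n : (n \in L j) = (n < size (L j))%N.
  by rewrite (perm_mem (permL j)) mem_iota add0n.
pose s n := nth 0%N (L n.+1) n.
pose t n := index n (L n.+1).
have sE j n : (n < size (L j))%N -> s n = nth 0%N (L j) n.
  by move=> h; apply: nthL => //; exact: sizeL.
exists s; last first.
  move=> j; apply: (@eq_from_nth _ 0%N); rewrite ?size_map ?size_iota// => n nj.
  by rewrite (nth_map 0%N) ?size_iota// nth_iota// add0n (sE j).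
exists t => n.
- have sn : s n \in L n.+1 by apply: mem_nth; exact: sizeL.
  pose j := maxn n.+1 (s n).+1.
  have h2 : s n \in L (s n).+1 by rewrite memL.
  have [u eu] := prefL (s n).+1 j (leq_maxr _ _).
  have nj : (n < size (L j))%N by rewrite (leq_trans _ (sizeL j))// leq_max leqnn.
  rewrite /t; have -> : index (s n) (L (s n).+1) = index (s n) (L j).
    by rewrite eu index_cat h2.
  by rewrite (sE j)// index_uniq.
- have nL : n \in L n.+1 by rewrite memL; exact: sizeL.
  by rewrite (sE n.+1) ?index_mem// nth_index.
Qed.

Section Unconditional.
Variables (R : realType) (k : scalars).
Local Notation K := (scalar_field R k).
Variables (X : prenormed_space R K) (bX : banach X).

Definition restrict (A : pred nat) (a : nat -> K) : nat -> K :=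
  fun i => if A i then a i else 0.

Lemma lincomb_seq (x : nat -> X) (a : nat -> K) n :
  lincomb x a n = \sum_(i <- iota 0 n) a i *: x i.
Proof. by rewrite /lincomb -(big_mkord xpredT (fun i => a i *: x i)) /index_iota subn0. Qed.

(** If coordinate projections were not uniformly bounded, there would be disjoint
    finite blocks of coefficients on which projections to sets A_j have norm larger
    than j. In the rearrangement that lists, within each block, A_j before its
    complement, these projections become initial partial sums, and the basis constant
    of the rearrangement bounds them. *)
Lemma unconditional_constant (x : nat -> X) : basic x -> unconditional x ->
  exists2 C, 0 <= C & forall (a : nat -> K) (A : pred nat) n,
    nrm (lincomb x (restrict A a) n) <= C * nrm (lincomb x a n).
Proof.
move=> bx ux; have [cx _] := bx.
have [C0 C00 HC0] := basis_constant_finite bX bx.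
apply: contrapT => Hno.
have tail : forall jN : nat * nat, exists MAa : nat * (pred nat * (nat -> K)),
    [/\ (jN.2 < MAa.1)%N, forall i, (i < jN.2)%N -> MAa.2.2 i = 0 &
      jN.1%:R * nrm (lincomb x MAa.2.2 MAa.1) <
      nrm (lincomb x (restrict MAa.2.1 MAa.2.2) MAa.1)].
  move=> [j N] /=; apply: contrapT => Hj; apply: Hno.
  (* The first [N] coefficients are estimated one by one, and the remaining ones
     by the factor [j] available in absence of a block. *)
  exists (N%:R * (2 * C0) + j%:R * (C0 + 1)).
    by rewrite addr_ge0 ?mulr_ge0// addr_ge0.
  move=> a A n.
  pose b i : K := if (i < n)%N then a i else 0.
  pose h i : K := if (i < N)%N then b i else 0.
  pose t i : K := if (i < N)%N then 0 else b i.
  pose M := maxn n N.+1.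
  have bM : lincomb x b M = lincomb x a n.
    apply: lincomb_widen; first exact: leq_maxl.
      by move=> i; rewrite /b => ->.
    by move=> i; rewrite /b ltnNge => ->.
  have bhM : lincomb x (restrict A b) M = lincomb x (restrict A a) n.
    apply: lincomb_widen; first exact: leq_maxl.
      by move=> i; rewrite /restrict /b => ->.
    by move=> i; rewrite /restrict /b ltnNge => ->; case: ifP.
  have -> : lincomb x (restrict A a) n =
      lincomb x (restrict A h) M + lincomb x (restrict A t) M.
    rewrite -bhM -[X in X + _]scale1r -lincombZD; apply: eq_lincomb => i _.
    rewrite /restrict /h /t; case: (A i); rewrite ?mulr0 ?addr0//.
    by case: ifP; rewrite ?mulr0 ?mul1r ?addr0 ?add0r.
  set v := lincomb x a n.
  have cv : carrier X v by rewrite /v; auto with carr.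
  have hb i : modulus (b i) * nrm (x i) <= 2 * C0 * nrm v.
    have vi m : nrm (lincomb x b m) <= C0 * nrm v.
      rewrite /v -bM; have [mM|Mm] := leqP m M; first exact: HC0.
      rewrite (@lincomb_widen _ _ _ x b b M m (ltnW Mm))//; first by exact: HC0.
      by move=> q Mq; rewrite /b ltnNge (leq_trans (leq_maxl n N.+1))//.
    by rewrite -mulrA; exact: (coef_le bX i cx vi).
  have hN : lincomb x (restrict A h) M = lincomb x (restrict A h) N.
    apply: lincomb_widen => //; first by rewrite (leq_trans (leqnSn N)) ?leq_maxr.
    by move=> i; rewrite /restrict /h ltnNge => ->; case: ifP.
  have h1 : nrm (lincomb x (restrict A h) M) <= N%:R * (2 * C0 * nrm v).
    rewrite hN; apply: (le_trans (nrm_sum bX _ _ _)); first by move=> i; auto with carr.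
    rewrite -[N in N%:R]card_ord mulr_natl -sumr_const.
    apply: ler_sum => i _; rewrite (nrmZ bX)//.
    rewrite /restrict /h; case: (A i); last first.
      by rewrite modulus0 mul0r !mulr_ge0// nrm_ge0.
    by rewrite ltn_ord; exact: hb.
  have tv : nrm (lincomb x t M) <= (C0 + 1) * nrm v.
    have -> : lincomb x t M = v - lincomb x b N.
      rewrite /v -bM.
      have -> : lincomb x b N = lincomb x h M.
        apply/esym/lincomb_widen; first by rewrite (leq_trans (leqnSn N)) ?leq_maxr.
          by move=> i; rewrite /h => ->.
        by move=> i; rewrite /h ltnNge => ->.
      rewrite -lincombB; apply: eq_lincomb => i _; rewrite /t /h.
      by case: ifP; rewrite ?subrr ?subr0.
    apply: (le_trans (nrmB bX _ _)); auto with carr.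
    rewrite addrC mulrDl mul1r lerD2r /v -bM; apply: HC0.
    by rewrite (leq_trans (leqnSn N)) ?leq_maxr.
  have h2 : nrm (lincomb x (restrict A t) M) <= j%:R * nrm (lincomb x t M).
    rewrite leNgt; apply/negP => hlt; apply: Hj; exists (M, (A, t)) => /=.
    split => //; first by rewrite leq_max leqnn orbT.
    by move=> i; rewrite /t => ->.
  apply: (le_trans (nrmD bX _ _)); auto with carr.
  have := ler_wpM2l (ler0n R j) tv; lra.
have [f Hf] := choice tail.
pose g := fix g j : seq nat := if j is i.+1 then
    let N := size (g i) in let M := (f (i, N)).1 in let A := (f (i, N)).2.1 in
    g i ++ ([seq q <- iota N (M - N) | A q] ++ [seq q <- iota N (M - N) | ~~ A q])
  else [::].
(* [g j] enumerates the first j blocks, rearranged. *)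
have sizeg j : size (g j.+1) = (f (j, size (g j))).1.
  have [lt _ _] := Hf (j, size (g j)) => /=.
  rewrite size_cat [X in (_ + X)%N](perm_size (permEl (perm_filterC _ _))).
  by rewrite size_iota subnKC// ltnW.
have permg j : perm_eq (g j) (iota 0 (size (g j))).
  elim: j => // j IH; have [lt _ _] := Hf (j, size (g j)).
  rewrite sizeg -(subnKC (ltnW lt)) iotaD add0n [X in perm_eq X]/=.
  exact: perm_cat IH (permEl (perm_filterC _ _)).
have stepg j : exists2 t, t != [::] & g j.+1 = g j ++ t.
  rewrite /=; eexists; last by reflexivity.
  have [lt _ _] := Hf (j, size (g j)).
  rewrite -size_eq0 (perm_size (permEl (perm_filterC _ _))) size_iota.
  by rewrite subn_eq0 -ltnNge.
have [s bs gs] := prefix_permutation permg stepg.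
have [C1 C10 HC1] := basis_constant_finite bX (ux s bs).
have [j jC] := exists_nat_ge C1.
have [lt a0 big] := Hf (j, size (g j)).
set N := size (g j) in lt a0 big; set M := (f (j, N)).1 in lt big.
set A := (f (j, N)).2.1 in big; set a := (f (j, N)).2.2 in a0 big.
rewrite /= in lt a0 big.
have sumE (r : seq nat) : r = [seq s n | n <- iota 0 (size r)] ->
    lincomb (x \o s) (a \o s) (size r) = \sum_(i <- r) a i *: x i.
  by move=> er; rewrite {2}er big_map lincomb_seq.
pose r := g j ++ [seq q <- iota N (M - N) | A q].
have rg : g j.+1 = r ++ [seq q <- iota N (M - N) | ~~ A q] by rewrite /= -catA.
have rs : r = [seq s n | n <- iota 0 (size r)].
  have := gs j.+1; rewrite rg size_cat iotaD map_cat => /(congr1 (take (size r))).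
  by rewrite take_size_cat// take_size_cat// size_map size_iota.
have nr : (size r <= size (g j.+1))%N by rewrite rg size_cat leq_addr.
have gj0 : \sum_(i <- g j) a i *: x i = 0.
  rewrite (perm_big _ (permg j))/= big_seq big1// => i.
  by rewrite mem_iota add0n => /a0 ->; rewrite scale0r.
(* The basis constant of the rearrangement compares the sum up to the end of
   [A] inside the [j]-th block with the sum up to the end of that block. *)
have := HC1 (a \o s) _ _ nr.
rewrite sumE// (sumE _ (gs j.+1)) (perm_big _ (permg j.+1))/= -lincomb_seq.
rewrite -[size _]/(size (g j.+1)) sizeg -/N -/M.
rewrite /r big_cat gj0/= add0r big_filter.
have -> : \sum_(i <- iota N (M - N) | A i) a i *: x i = lincomb x (restrict A a) M.
  rewrite lincomb_seq -(subnKC (ltnW lt)) iotaD add0n big_cat/= [X in X + _]big_seq.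
  rewrite [X in X + _]big1 ?add0r; last first.
    move=> i; rewrite mem_iota add0n => /a0 ai; rewrite /restrict ai.
    by case: ifP; rewrite scale0r.
  rewrite addKn (big_mkcond A)/=; apply: eq_bigr => i _; rewrite /restrict.
  by case: ifP; rewrite ?scale0r.
move=> h; have := lt_le_trans big h.
by rewrite ltNge => /negP; apply; rewrite ler_wpM2r// nrm_ge0.
Qed.

Lemma sign_unconditional (x : nat -> X) : basic x -> unconditional x ->
  exists2 C, 0 <= C & forall (a : nat -> K) (s : nat -> bool) n,
    nrm (lincomb x (fun i => (-1) ^+ s i * a i) n) <= C * nrm (lincomb x a n) /\
    nrm (lincomb x a n) <= C * nrm (lincomb x (fun i => (-1) ^+ s i * a i) n).
Proof.
move=> bx ux; have [cx _] := bx.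
have [C C0 HC] := unconditional_constant bx ux.
have main (a : nat -> K) (s : nat -> bool) n :
    nrm (lincomb x (fun i => (-1) ^+ s i * a i) n) <= 2 * C * nrm (lincomb x a n).
  have -> : lincomb x (fun i => (-1) ^+ s i * a i) n =
      lincomb x (restrict (fun i => ~~ s i) a) n - lincomb x (restrict s a) n.
    rewrite -lincombB; apply: eq_lincomb => i _; rewrite /restrict.
    by case: (s i); rewrite /= ?expr1 ?expr0 ?mulN1r ?mul1r ?sub0r ?subr0.
  apply: (le_trans (nrmB bX _ _)); auto with carr.
  have := HC a s n; have := HC a (fun i => ~~ s i) n; lra.
exists (2 * C); first by rewrite mulr_ge0.
move=> a s n; split; first exact: main.
rewrite [X in nrm X <= _](_ : _ = lincomb x (fun i => (-1) ^+ s i * ((-1) ^+ s i * a i)) n) ?main//.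
by apply: eq_lincomb => i _; rewrite mulrA -signr_addb addbb mul1r.
Qed.

End Unconditional.

(** * Spreading sequences *)

Section Spreading.
Variables (R : realType) (k : scalars).
Local Notation K := (scalar_field R k).

(** The map of an equivalence is linear up to null vectors only, so its value on a
    finite combination is identified by induction on the length. *)
Lemma equivalent_estimates (X Y : prenormed_space R K) (bX : banach X)
    (bY : banach Y) (x : nat -> X) (y : nat -> Y) :
  (forall n, carrier X (x n)) -> (forall n, carrier Y (y n)) ->
  equivalent x y -> exists2 C, 0 < C & forall a n,
    nrm (lincomb y a n) <= C * nrm (lincomb x a n) /\
    nrm (lincomb x a n) <= C * nrm (lincomb y a n).
Proof.
move=> cx cy [T [Tspan Tlin _ [C HC]] Txy].
have cT u : closed_span x u -> carrier Y (T u) by move/Tspan => [].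
have nT u : closed_span x u -> nrm (T u) <= (`|C| + 1) * nrm u /\
    nrm u <= (`|C| + 1) * nrm (T u).
  move=> su; have [] := HC u su; have [cu _] := su.
  rewrite (vnormE bX)// (vnormE bY); last exact: cT.
  rewrite -!EFinM !lee_fin => h1 h2.
  have := nrm_ge0 bX u; have := nrm_ge0 bY (T u); have := ler_norm C.
  by split; nra.
have Tcomb a n : nrm (T (lincomb x a n) - lincomb y a n) = 0.
  elim: n => [|n IH].
    rewrite !lincomb0 subr0; apply/eqP; rewrite eq_le nrm_ge0// andbT.
    have s0 : closed_span x (0 : X).
      by rewrite -(lincomb0 x (fun=> 0)); apply: lincomb_span.
    by have [+ _] := nT 0 s0; rewrite (nrm0 bX) mulr0.
  have sx : closed_span x (x n).
    by apply: (expansion_span bX) (expansion_delta bX n cx).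
  have sl := lincomb_span bX a n cx.
  have := Tlin (a n) _ _ sx sl; rewrite (addrC (a n *: x n)) -lincombS => e0.
  have ct1 : carrier Y (T (lincomb x a n.+1)) by apply/cT/lincomb_span.
  move: e0; rewrite (vnormE bY); last by auto with carr.
  move=> [e0]; apply/eqP; rewrite eq_le nrm_ge0// andbT.
  apply: (le_trans (@nrm_triangle _ _ _ bY (a n *: T (x n) + T (lincomb x a n)) _ _ _ _ _)); auto with carr.
  rewrite e0 add0r lincombS opprD (addrC (- _)) addrACA -scalerBr.
  apply: (le_trans (nrmD bY _ _)); auto with carr.
  rewrite IH addr0 (nrmZ bY); last by auto with carr.
  have := Txy n; rewrite (vnormE bY); last by auto with carr.
  by move=> [->]; rewrite mulr0.
exists (`|C| + 1); first by rewrite ltr_wpDl.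
move=> a n; have sl := lincomb_span bX a n cx.
have [h1 h2] := nT _ sl; have cl := cT _ sl.
have e : nrm (T (lincomb x a n)) = nrm (lincomb y a n).
  apply/eqP; rewrite eq_le; apply/andP; split.
    rewrite -[leRHS]add0r -(Tcomb a n); apply: (nrm_le_dist bY); auto with carr.
  rewrite -[leRHS]add0r -(Tcomb a n) (nrm_distC bY); auto with carr.
  by apply: (nrm_le_dist bY); auto with carr.
by rewrite -e.
Qed.

Lemma increasing_ge (s : nat -> nat) n : {homo s : i j / (i < j)%N} -> (n <= s n)%N.
Proof. by move=> hs; elim: n => // n IH; apply: leq_ltn_trans IH (hs _ _ (ltnSn n)). Qed.

Lemma increasing_sub (P : nat -> nat -> Prop) :
  (forall j N, exists2 n, (N <= n)%N & P j n) ->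
  exists2 s : nat -> nat, {homo s : i j / (i < j)%N} & forall j, P j (s j).
Proof.
move=> H; have : forall jN : nat * nat, exists n, (jN.2 <= n)%N /\ P jN.1 n.
  by move=> [j N]; have [n ? ?] := H j N; exists n.
move=> /choice[f Hf].
pose s := fix s j := if j is i.+1 then f (j, (s i).+1) else f (0%N, 0%N).
exists s.
  apply: homo_ltn => [? ? ?|j]; first exact: ltn_trans.
  by have [] := Hf (j.+1, (s j).+1).
case=> [|j]; first by have [] := Hf (0%N, 0%N).
by have [] := Hf (j.+1, (s j).+1).
Qed.

Variables (X : prenormed_space R K) (bX : banach X).

Lemma spreading_estimates (x : nat -> X) (s : nat -> nat) :
  (forall n, carrier X (x n)) -> spreading x -> {homo s : i j / (i < j)%N} ->
  exists2 C, 0 < C & forall a n,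
    nrm (lincomb (x \o s) a n) <= C * nrm (lincomb x a n) /\
    nrm (lincomb x a n) <= C * nrm (lincomb (x \o s) a n).
Proof.
move=> cx sx hs; apply: equivalent_estimates => //; first by move=> n; exact: cx.
exact: sx.
Qed.

Lemma spreading_single (x : nat -> X) (s : nat -> nat) :
  (forall n, carrier X (x n)) -> spreading x -> {homo s : i j / (i < j)%N} ->
  exists2 C, 0 < C & forall n, nrm (x (s n)) <= C * nrm (x n) /\
    nrm (x n) <= C * nrm (x (s n)).
Proof.
move=> cx sx hs; have [C C0 HC] := spreading_estimates cx sx hs.
exists C => // n; have := HC (fun i => (i == n)%:R) n.+1.
by rewrite !lincomb_delta ltnSn.
Qed.

(** Along a subsequence with norms growing (or decaying) too fast compared with
    those of x, the constants of the equivalence between x and the subsequence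
    would be exceeded by a single coordinate. *)
Lemma subsymmetric_bounded (x : nat -> X) : basic x -> spreading x ->
  exists m N B, [/\ 0 < m, 0 < B, forall n, nrm (x n) <= B &
    forall n, (N <= n)%N -> m <= nrm (x n)].
Proof.
move=> bx sx; have [cx _] := bx.
have xpos n : 0 < nrm (x n) by exact: basic_gt0.
have [B [M HB]] : exists B M, forall n, (M <= n)%N -> nrm (x n) <= B.
  apply: contrapT => H.
  have [s hs Hs] : exists2 s : nat -> nat, {homo s : i j / (i < j)%N} &
      forall j, j.+1%:R * nrm (x j) < nrm (x (s j)).
    apply: (increasing_sub (P := fun j n => j.+1%:R * nrm (x j) < nrm (x n))) => j N; apply: contrapT => Hj; apply: H.
    exists (j.+1%:R * nrm (x j)), N => n Nn; rewrite leNgt; apply/negP => h.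
    by apply: Hj; exists n.
  have [C C0 HC] := spreading_single cx sx hs.
  have [j Cj] := exists_nat_ge C.
  have [h _] := HC j; have := lt_le_trans (Hs j) h.
  rewrite ltr_pM2r// => h2; have := lt_le_trans h2 Cj.
  by rewrite ltr_nat ltnNge leqnSn.
have [m [N [m0 Hm]]] : exists m N, 0 < m /\ forall n, (N <= n)%N -> m <= nrm (x n).
  apply: contrapT => H.
  have [s hs Hs] : exists2 s : nat -> nat, {homo s : i j / (i < j)%N} &
      forall j, j.+1%:R * nrm (x (s j)) < nrm (x j).
    apply: (increasing_sub (P := fun j n => j.+1%:R * nrm (x n) < nrm (x j))) => j N; apply: contrapT => Hj; apply: H.
    exists (nrm (x j) / j.+1%:R), N; split; first by rewrite divr_gt0.
    move=> n Nn; rewrite ler_pdivrMr// mulrC leNgt; apply/negP => h.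
    by apply: Hj; exists n.
  have [C C0 HC] := spreading_single cx sx hs.
  have [j Cj] := exists_nat_ge C.
  have [_ h] := HC j; have := lt_le_trans (Hs j) h.
  rewrite ltr_pM2r// => h2; have := lt_le_trans h2 Cj.
  by rewrite ltr_nat ltnNge leqnSn.
exists m, N, (`|B| + 1 + \sum_(i < M) nrm (x i)); split => //.
  apply: ltr_wpDr; first by apply: sumr_ge0 => i _; exact: nrm_ge0.
  by rewrite ltr_wpDl.
move=> n; have [Mn|nM] := leqP M n.
  apply: (le_trans (HB _ Mn)); apply: ler_wpDr.
    by apply: sumr_ge0 => i _; exact: nrm_ge0.
  by rewrite (le_trans (ler_norm B))// lerDl.
rewrite (bigD1 (Ordinal nM))//= addrCA lerDl addr_ge0//.
by apply: sumr_ge0 => i _; exact: nrm_ge0.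
Qed.

End Spreading.

(** * Equivalence with the unit vectors of a sequence space *)

Section Criterion.
Variables (R : realType) (k : scalars).
Local Notation K := (scalar_field R k).
Variables (X : prenormed_space R K) (bX : banach X).

Definition head_part (n : nat) (a : nat -> K) : nat -> K :=
  fun i => if (i < n)%N then a i else 0.

(** The lattice properties common to the norms of l_G and l_2: they depend
    monotonically on the moduli of the entries and are determined by finite
    sections, so that estimates need only be proved for the latter. *)
Record solid_fatou (N : (nat -> K) -> \bar R) : Prop := SolidFatou {
  solid_ge0 : forall a, (0 <= N a)%E;
  solid_0 : N (fun=> 0) = 0%E;
  solid_le : forall a b, (forall i, modulus (a i) <= modulus (b i)) ->
    (N a <= N b)%E;
  solid_fatouP : forall a (M : R), 0 <= M -> (forall n, (N (head_part n a) <= M%:E)%E) ->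
    (N a <= M%:E)%E }.

Lemma lincomb_unit (N : (nat -> K) -> \bar R) (C : set (nat -> K^o)) (a : nat -> K) n :
  @lincomb R K (@PrenormedSpace R K (nat -> K^o) C N) (@unit_vector R k) a n = head_part n a.
Proof.
rewrite /lincomb; apply/funext => i; rewrite /head_part fct_sumE.
have e (j : 'I_n) : (a j *: (@unit_vector R k j : nat -> K^o)) i = a j * (i == j)%:R by [].
under eq_bigr do rewrite e.
case: ifPn => [ni|].
  rewrite (bigD1 (Ordinal ni))//= eqxx mulr1 big1 ?addr0// => j ji.
  by rewrite (_ : _ == _ = false) ?mulr0//; apply: contraNF ji => /eqP e'; apply/eqP/val_inj; rewrite /= e'.
rewrite -leqNgt => ni; rewrite big1// => j _.
by rewrite gtn_eqF ?mulr0// (leq_trans (ltn_ord j)).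
Qed.

(** The isomorphism maps a vector to its sequence of coefficients. The upper
    estimate makes it bounded and makes the sections of a coefficient sequence
    converge; the lower one makes it onto, as a sequence with convergent sections is
    summed in X by completeness. *)
Lemma equivalent_unit_vector (N : (nat -> K) -> \bar R) (x : nat -> X) (C : R) :
  solid_fatou N -> basic x -> 0 < C ->
  (forall a n, (N (head_part n a) <= (C * nrm (lincomb x a n))%:E)%E) ->
  (forall a n, ((nrm (lincomb x a n))%:E <= C%:E * N (head_part n a))%E) ->
  equivalent x (@unit_vector R k :
    nat -> @PrenormedSpace R K (nat -> K^o) [set a | (N a < +oo)%E] N).
Proof.
move=> [N0 N00 Nle NF] bx C0 upN loN; have [cx _] := bx.
set Y := PrenormedSpace _ _.
have : forall v : X, exists a : Y, closed_span x v -> expansion x v (a : nat -> K).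
  move=> v; have [sv|] := pselect (closed_span x v); last by exists (fun=> 0).
  by have [a Ha] := basic_expansion bx sv; exists a.
move=> /choice[T HT].
have tail_small v a : carrier X v -> expansion x v a -> forall e : R, 0 < e ->
    exists n, (N (fun i => (a i - head_part n a i)%R) <= e%:E)%E.
  move=> cv /(expansionP bX _ cx cv) Ha e e0.
  have [|n Hn] := Ha (e / C / 2); first by rewrite !divr_gt0.
  exists n; apply: NF; first exact: ltW.
  move=> m; have -> : head_part m (fun i => a i - head_part n a i) =
      head_part m (fun i => if (i < n)%N then 0 else a i).
    by apply/funext => i; rewrite /head_part; case: ifP => // _; case: ifP; rewrite ?subrr ?subr0.
  apply: (le_trans (upN _ _)); rewrite lee_fin mulrC -ler_pdivlMr//.
  have [mn|nm] := leqP m n.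
    rewrite /lincomb big1 ?(nrm0 bX) ?divr_ge0 ?ltW// => i _.
    by rewrite (leq_trans (ltn_ord i)) ?scale0r.
  have -> : lincomb x (fun i => if (i < n)%N then 0 else a i) m =
      lincomb x a m - lincomb x a n.
    have <- : lincomb x (head_part n a) m = lincomb x a n.
      apply: (lincomb_widen _ (ltnW nm)) => i; rewrite /head_part; first by move=> ->.
      by rewrite ltnNge => ->.
    rewrite -lincombB; apply: eq_lincomb => i _; rewrite /head_part.
    by case: ifP; rewrite ?subrr ?subr0.
  apply: (le_trans (@nrm_triangle _ _ _ bX v _ _ _ _ _)); auto with carr.
  have := Hn _ (leqnn n); have := Hn _ (ltnW nm).
  rewrite (@nrm_distC _ _ _ bX v (lincomb x a m)); auto with carr; lra.
have upper v a : carrier X v -> expansion x v a -> (N a <= (C * nrm v)%:E)%E.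
  move=> cv /(expansionP bX _ cx cv) Ha.
  apply: NF; first by rewrite mulr_ge0 ?nrm_ge0// ltW.
  move=> n; apply/lee_addgt0Pr => e e0.
  have [|M HM] := Ha (e / C); first by rewrite divr_gt0.
  pose m := maxn n M.
  apply: (@le_trans _ _ (N (head_part m a))).
    apply: Nle => i; rewrite /head_part; case: ifP => [ni|_]; last first.
      by rewrite modulus0; exact: modulus_ge0.
    by rewrite (leq_trans ni)// leq_maxl.
  apply: (le_trans (upN _ _)); rewrite -EFinD lee_fin.
  have := HM m (leq_maxr _ _); rewrite ltr_pdivlMr// => h.
  have : nrm (lincomb x a m) <= nrm (lincomb x a m - v) + nrm v.
    by apply: (nrm_le_dist bX); auto with carr.
  rewrite (@nrm_distC _ _ _ bX _ v); auto with carr; nra.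
have fin_cut n (a : nat -> K) : (N (head_part n a) < +oo)%E.
  by apply: (le_lt_trans (upN _ _)); rewrite ltry.
exists T; last first.
  move=> n; have sx : closed_span x (x n).
    by apply: (expansion_span bX) (expansion_delta bX n cx).
  rewrite (basic_unique bX bx (cx n) (HT _ sx) (expansion_delta bX n cx)).
  rewrite (_ : _ - _ = (fun=> 0)) ?N00//.
  by apply/funext => i; exact: subrr.
split.
- move=> u su; have [cu _] := su; split.
    by apply: (le_lt_trans (upper _ _ cu (HT _ su))); rewrite ltry.
  move=> e e0; have [|n Hn] := tail_small _ _ cu (HT _ su) (e / 2).
    by rewrite divr_gt0.
  exists n, (T u : nat -> K); rewrite lincomb_unit; apply: (le_lt_trans Hn).
  rewrite lte_fin; lra.
- move=> a u v su sv; have [cu _] := su; have [cv _] := sv.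
  have suv := basic_spanZD bX a bx su sv.
  have := expansionZD bX a cx cu cv (HT _ su) (HT _ sv).
  have [cuv _] := suv; move/(basic_unique bX bx cuv (HT _ suv)) => ->.
  rewrite (_ : _ - _ = (fun=> 0)) ?N00//.
  by apply/funext => i; exact: subrr.
- move=> w [cw Hw].
  (* By solidity the sections of [w] approximate it at least as well as any
     finitely supported sequence does. *)
  have tailw (e : R) : 0 < e -> exists n, forall m, (n <= m)%N ->
      (N (fun i => (w i - head_part m w i)%R) < e%:E)%E.
    move=> e0; have [n [a]] := Hw e e0; rewrite lincomb_unit => Ha.
    exists n => m nm; apply: le_lt_trans Ha; apply: Nle => i.
    rewrite /head_part; case: ifPn => [im|]; first by rewrite subrr modulus0 modulus_ge0.
    rewrite -leqNgt => mi; rewrite subr0 [X in _ <= modulus X](_ : _ = w i - head_part n a i)//.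
    by rewrite /head_part ltnNge (leq_trans nm mi)/= subr0.
  have [v cv Hv] : exists2 v, carrier X v & forall e : R, 0 < e ->
      exists M, forall n, (M <= n)%N -> nrm (v - lincomb x w n) < e.
    apply: (nrm_complete bX) => [n|e e0]; first by auto with carr.
    have [|n Hn] := tailw (e / 2 / C); first by rewrite !divr_gt0.
    exists n.
    suff main m m' : (n <= m)%N -> (m <= m')%N -> nrm (lincomb x w m - lincomb x w m') < e.
      move=> m m' nm nm'; have [|/ltnW] := leqP m m'; first exact: main.
      by rewrite (nrm_distC bX); auto with carr.
    move=> nm mm'; have -> : lincomb x w m - lincomb x w m' =
        lincomb x (fun i => head_part m w i - w i) m'.
      rewrite lincombB; congr (_ - _); apply/esym/lincomb_widen => //.
        by move=> i; rewrite /head_part => ->.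
      by move=> i; rewrite /head_part ltnNge => ->.
    rewrite -lte_fin; apply: (le_lt_trans (loN _ _)).
    apply: (@le_lt_trans _ _ (C%:E * N (fun i => (w i - head_part m w i)%R))%E).
      apply: lee_wpmul2l; first by rewrite lee_fin ltW.
      apply: Nle => i; rewrite {1}/head_part; case: ifP => _.
        by rewrite -modulusN opprB.
      by rewrite modulus0 modulus_ge0.
    apply: (@le_lt_trans _ _ (C%:E * (e / 2 / C)%:E)%E).
      by apply: lee_wpmul2l; [rewrite lee_fin ltW|exact/ltW/Hn].
    rewrite -EFinM lte_fin mulrC divfK ?gt_eqF//; lra.
  have ev : expansion x v w by apply/(expansionP bX).
  have sv := expansion_span bX cx cv ev.
  exists v => //; rewrite (basic_unique bX bx cv (HT _ sv) ev).
  rewrite (_ : _ - _ = (fun=> 0)) ?N00//.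
  by apply/funext => i; exact: subrr.
- exists C => u su; have [cu _] := su; have eu := HT _ su.
  rewrite (vnormE bX cu); split; first by rewrite -EFinM; exact: upper.
  have fT : N (T u : nat -> K) \is a fin_num.
    by rewrite ge0_fin_numE ?N0// (le_lt_trans (upper _ _ cu eu))// ltry.
  have -> : vnorm (T u) = (fine (N (T u : nat -> K)))%:E by rewrite fineK.
  rewrite -EFinM lee_fin.
  apply: (expansion_nrm_le (N := 0%N) bX cx cu eu) => n _.
  rewrite -lee_fin EFinM (fineK fT); apply: (le_trans (loN _ _)).
  apply: lee_wpmul2l; first by rewrite lee_fin ltW.
  apply: Nle => i; rewrite /head_part; case: ifP => // _.
  by rewrite modulus0 modulus_ge0.
Qed.

End Criterion.

(** * The norms of l_G and of l_2 *)

Section Luxemburg.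
Variables (R : realType).
Implicit Types rho : R -> \bar R.

Lemma luxemburg_le rho (r : R) : 0 < r -> (rho r <= 1)%E ->
  (luxemburg rho <= r%:E)%E.
Proof. by move=> r0 h; apply: ereal_inf_lbound; exists r. Qed.

Lemma luxemburg_lt rho (r : R) :
  (forall s t, 0 < s -> s <= t -> (rho t <= rho s)%E) ->
  (luxemburg rho < r%:E)%E -> 0 < r /\ (rho r <= 1)%E.
Proof.
move=> rho_le /ereal_inf_lt[_ [t [t0 ht] <-]]; rewrite lte_fin => tr.
by split; [exact: lt_trans tr|apply: le_trans (rho_le _ _ t0 (ltW tr)) ht].
Qed.

Lemma luxemburg_ge0 rho : (0 <= luxemburg rho)%E.
Proof. by apply: le_ereal_inf_tmp => _ [t [t0 _] <-]; rewrite lee_fin ltW. Qed.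

Lemma luxemburg_mono rho rho' :
  (forall t, 0 < t -> (rho t <= rho' t)%E) -> (luxemburg rho <= luxemburg rho')%E.
Proof.
move=> h; apply: le_ereal_inf => _ [t [t0 ht] <-]; exists t => //.
by split=> //; apply: le_trans (h _ t0) ht.
Qed.

Lemma luxemburg_eq0 rho : (forall t, 0 < t -> rho t = 0%E) -> luxemburg rho = 0%E.
Proof.
move=> h; apply/eqP; rewrite eq_le luxemburg_ge0 andbT.
apply/lee_addgt0Pr => e e0; rewrite add0e; apply: luxemburg_le => //.
by rewrite h// lee_fin.
Qed.

End Luxemburg.

Section SequenceNorms.
Variables (R : realType) (k : scalars).
Local Notation K := (scalar_field R k).

Lemma modulus_head n (a : nat -> K) i :
  modulus (head_part n a i) = if (i < n)%N then modulus (a i) else 0.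
Proof. by rewrite /head_part; case: ifP => // _; rewrite modulus0. Qed.

Variables (G : R -> R) (G0 : G 0 = 0)
  (Gmono : forall s t, 0 <= s -> s <= t -> G s <= G t).

Let Gge0 t : 0 <= t -> 0 <= G t.
Proof. by move=> t0; rewrite -G0; apply: Gmono. Qed.

Let modt (z : K) t : 0 < t -> 0 <= modulus z / t.
Proof. by move=> t0; rewrite divr_ge0 ?modulus_ge0// ltW. Qed.

Lemma lG_solid_fatou : solid_fatou (@lG_norm R k (EFin \o G)).
Proof.
have mono a (s t : R) : 0 < s -> s <= t ->
    (\sum_(0 <= n <oo) (EFin \o G) (modulus (a n : K) / t)%R <=
     \sum_(0 <= n <oo) (EFin \o G) (modulus (a n : K) / s)%R)%E.
  move=> s0 st; have t0 : 0 < t by exact: lt_le_trans st.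
  apply: lee_nneseries => n *; first by rewrite lee_fin Gge0// modt.
  rewrite /= lee_fin Gmono// ?modt// ler_wpM2l ?modulus_ge0//.
  by rewrite lef_pV2.
split.
- by move=> a; exact: luxemburg_ge0.
- apply: luxemburg_eq0 => t t0; rewrite eseries0// => i _ _.
  by rewrite modulus0 mul0r /= G0.
- move=> a b ab; apply: luxemburg_mono => t t0.
  apply: lee_nneseries => n *; first by rewrite lee_fin Gge0// modt.
  by rewrite /= lee_fin Gmono// ?modt// ler_wpM2r// invr_ge0 ltW.
- move=> a M M0 HM; apply/lee_addgt0Pr => e e0.
  rewrite -EFinD; apply: luxemburg_le; first by rewrite ltr_wpDl.
  apply: lime_le.
    by apply: is_cvg_nneseries => n *; rewrite lee_fin Gge0// modt// ltr_wpDl.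
  near=> n.
  have h : (lG_norm (EFin \o G) (head_part n a) < (M + e)%:E)%E.
    by apply: (le_lt_trans (HM n)); rewrite lte_fin ltrDl.
  have [Me0] := luxemburg_lt (mono (head_part n a)) h.
  apply: le_trans; apply: le_trans; last first.
    by apply: (nneseries_lim_ge n) => i *; rewrite lee_fin Gge0// modt.
  by rewrite !big_mkord; apply: lee_sum => i _; rewrite modulus_head ltn_ord.
Unshelve. all: by end_near.
Qed.

Lemma lG_norm_head_le (a : nat -> K) n (r : R) : 0 < r ->
  \sum_(i < n) G (modulus (a i) / r) <= 1 ->
  (lG_norm (EFin \o G) (head_part n a) <= r%:E)%E.
Proof.
move=> r0 h; apply: luxemburg_le => //; apply: lime_le.
  by apply: is_cvg_nneseries => i *; rewrite lee_fin Gge0// modt.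
exists n => // m /= nm.
rewrite (big_cat_nat _ nm)//= [X in (_ + X)%E](_ : _ = 0%E) ?adde0; last first.
  rewrite big_nat_cond big1// => i /andP[/andP[ni _] _].
  by rewrite modulus_head ltnNge ni/= mul0r G0.
rewrite big_mkord sumEFin lee_fin; apply: le_trans h.
by apply: ler_sum => i _; rewrite modulus_head ltn_ord.
Qed.

Lemma lG_norm_head_lt (a : nat -> K) n (r : R) :
  (lG_norm (EFin \o G) (head_part n a) < r%:E)%E ->
  0 < r /\ \sum_(i < n) G (modulus (a i) / r) <= 1.
Proof.
move=> h; have [|r0 {}h] := luxemburg_lt _ h.
  move=> s t s0 st; have t0 : 0 < t by exact: lt_le_trans st.
  apply: lee_nneseries => i *; first by rewrite lee_fin Gge0// modt.
  rewrite /= lee_fin Gmono// ?modt// ler_wpM2l ?modulus_ge0//.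
  by rewrite lef_pV2.
split=> //; rewrite -lee_fin; apply: le_trans h.
apply: le_trans; last first.
  by apply: (nneseries_lim_ge n) => i *; rewrite lee_fin Gge0// modt.
rewrite big_mkord sumEFin lee_fin; apply: ler_sum => i _.
by rewrite modulus_head ltn_ord.
Qed.

End SequenceNorms.

Section L2Norm.
Variables (R : realType) (k : scalars).
Local Notation K := (scalar_field R k).

Lemma l2_normE (a : nat -> K) : l2_norm a =
  ((\sum_(0 <= i <oo) (modulus (a i) ^+ 2)%:E) `^ 2^-1)%E.
Proof.
rewrite /l2_norm Lnorm_counting//; congr (_ `^ _)%E.
apply: eq_eseriesr => i _; rewrite abse_EFin poweR_EFin.
by rewrite (ger0_norm (modulus_ge0 _)) -[2%R]/(2%:R) powR_mulrn ?modulus_ge0.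
Qed.

Lemma poweR_half_le (y : \bar R) (M : R) : (0 <= y)%E -> 0 <= M ->
  ((y `^ 2^-1 <= M%:E) = (y <= (M ^+ 2)%:E))%E.
Proof.
move=> y0 M0; case: y y0 => [y| |]// y0.
  rewrite poweR_EFin !lee_fin powR12_sqrt//.
  by rewrite -[in RHS](sqr_sqrtr y0) ler_pXn2r// nnegrE sqrtr_ge0.
by rewrite poweRyr ?invr_eq0 ?pnatr_eq0.
Qed.

Lemma l2_norm_le (a : nat -> K) (M : R) : 0 <= M -> (l2_norm a <= M%:E)%E =
  (\sum_(0 <= i <oo) (modulus (a i) ^+ 2)%:E <= (M ^+ 2)%:E)%E.
Proof.
move=> M0; rewrite l2_normE poweR_half_le//.
by apply: nneseries_ge0 => i *; rewrite lee_fin sqr_ge0.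
Qed.

Lemma l2_norm_head (a : nat -> K) n :
  l2_norm (head_part n a) = (Num.sqrt (\sum_(i < n) modulus (a i) ^+ 2))%:E.
Proof.
rewrite l2_normE (_ : (\sum_(0 <= i <oo) _)%E = (\sum_(i < n) modulus (a i) ^+ 2)%:E).
  by rewrite poweR_EFin powR12_sqrt// sumr_ge0// => i _; exact: sqr_ge0.
apply/eqP; rewrite eq_le; apply/andP; split.
  apply: lime_le; first by apply: is_cvg_nneseries => i *; rewrite lee_fin sqr_ge0.
  exists n => // m /= nm; rewrite (big_cat_nat _ nm)//=.
  rewrite [X in (_ + X)%E](_ : _ = 0%E) ?adde0; last first.
    rewrite big_nat_cond big1// => i /andP[/andP[ni _] _].
    by rewrite modulus_head ltnNge ni/= expr0n.
  rewrite big_mkord sumEFin lee_fin.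
  by apply: ler_sum => i _; rewrite modulus_head ltn_ord.
apply: le_trans; last first.
  by apply: (nneseries_lim_ge n) => i *; rewrite lee_fin sqr_ge0.
rewrite big_mkord sumEFin lee_fin; apply: ler_sum => i _.
by rewrite modulus_head ltn_ord.
Qed.

Lemma l2_solid_fatou : solid_fatou (@l2_norm R k).
Proof.
split.
- by move=> a; rewrite l2_normE; exact: poweR_ge0.
- rewrite l2_normE eseries0; first by rewrite -[0%E]/(0%:E) poweR_EFin powR0// invr_eq0 pnatr_eq0.
  by move=> i _ _; rewrite modulus0 expr0n.
- move=> a b ab; rewrite !l2_normE; apply: gt0_ler_poweR => //.
  + by rewrite in_itv/= leey andbT nneseries_ge0// => i *; rewrite lee_fin sqr_ge0.
  + by rewrite in_itv/= leey andbT nneseries_ge0// => i *; rewrite lee_fin sqr_ge0.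
  + apply: lee_nneseries => i *; first by rewrite lee_fin sqr_ge0.
    by rewrite lee_fin ler_pXn2r// nnegrE modulus_ge0.
- move=> a M M0 HM; rewrite l2_norm_le//; apply: lime_le.
    by apply: is_cvg_nneseries => i *; rewrite lee_fin sqr_ge0.
  near=> n; have := HM n; rewrite l2_norm_head lee_fin => h.
  rewrite big_mkord sumEFin lee_fin.
  by rewrite -(ler_sqrt _ (sqr_ge0 M)) sqrtr_sqr ger0_norm.
Unshelve. all: by end_near.
Qed.

End L2Norm.

(** * Orlicz functions and the norm of L_F *)

Section OrliczBasics.
Variables (R : realType) (F : R -> R) (oF : orlicz (EFin \o F)).

Lemma orlicz0 : F 0 = 0.
Proof. by have [_ _ [] ] := oF. Qed.

Lemma orlicz_mono s t : 0 <= s -> s <= t -> F s <= F t.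
Proof. by have [_ H _ _ _] := oF; move=> s0 st; have := H s t s0 st. Qed.

Lemma orlicz_ge0 t : 0 <= t -> 0 <= F t.
Proof. by move=> t0; rewrite -orlicz0; apply: orlicz_mono. Qed.

Lemma orlicz_convex s t l : 0 <= s -> 0 <= t -> 0 <= l <= 1 ->
  F (l * s + (1 - l) * t) <= l * F s + (1 - l) * F t.
Proof.
by have [H _ _ _ _] := oF; move=> s0 t0 l01; have := H s t l s0 t0 l01.
Qed.

Lemma orlicz_scale l t : 0 <= l <= 1 -> 0 <= t -> F (l * t) <= l * F t.
Proof.
move=> l01 t0; have := @orlicz_convex t 0 l t0 (lexx _) l01.
by rewrite orlicz0 !mulr0 !addr0.
Qed.

(** The chord from 0 to t lies above F at 1. *)
Lemma orlicz_ge_linear t : 1 <= t -> t * F 1 <= F t.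
Proof.
move=> t1; have t0 : 0 < t by exact: lt_le_trans t1.
have := @orlicz_scale t^-1 t; rewrite mulVf ?gt_eqF// invr_ge0 invf_le1// t1 ltW//.
by move=> /(_ isT isT); rewrite ler_pdivlMl.
Qed.

Lemma orlicz_linear_bound m r : 0 < F 1 -> 0 < r -> 0 <= m ->
  m <= r + r / F 1 * F (m / r).
Proof.
move=> F1 r0 m0; have t0 : 0 <= m / r by rewrite divr_ge0// ltW.
suff h : m / r <= 1 + F (m / r) / F 1.
  have -> : r + r / F 1 * F (m / r) = (1 + F (m / r) / F 1) * r by ring.
  by rewrite -ler_pdivrMr.
have F0 := orlicz_ge0 t0.
have [t1|/ltW t1] := leP (m / r) 1.
  by apply: (le_trans t1); rewrite lerDl mulr_ge0 ?invr_ge0// ltW.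
by apply: ler_wpDl => //; rewrite ler_pdivlMr// orlicz_ge_linear.
Qed.

(** [F] is monotone on nonnegative arguments only; precomposing it with truncation
    at 0 makes it monotone on R without changing [F (w x)]. *)
Lemma measurable_orlicz d (T : measurableType d) (D : set T) (w : T -> R) :
  measurable D -> (forall x, 0 <= w x) ->
  measurable_fun D w -> measurable_fun D (fun x => F (w x)).
Proof.
move=> mD w0 mw.
have -> : (fun x => F (w x)) = (fun t => F (Num.max 0 t)) \o w.
  by apply/funext => x /=; rewrite max_r.
apply: measurableT_comp => //; apply: nondecreasing_measurable => // s t st.
by apply: orlicz_mono; [rewrite le_max lexx|rewrite ge_max !le_max lexx st orbT].
Qed.

End OrliczBasics.

Section EMeasurable.
Variables (d : measure_display) (T : measurableType d) (R : realType) (D : set T).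

Lemma emeasurableZ (c : R) (h : T -> R) : measurable_fun D h ->
  measurable_fun D (fun x => (c%:E * (h x)%:E)%E).
Proof.
move=> mh; have -> : (fun x => (c%:E * (h x)%:E)%E) = EFin \o (fun x => c * h x) by [].
by apply/measurable_EFinP; apply: measurable_funM => //; exact: measurable_cst.
Qed.

End EMeasurable.

Section Modulus.
Variables (R : realType) (k : scalars).
Local Notation K := (scalar_field R k).

Lemma measurable_modulus (D : set R) (f : R -> K) : measurable D ->
  scalar_measurable D f -> measurable_fun D (fun x => modulus (f x)).
Proof.
move=> mD /scalar_measurableE[mr mi].
have -> : (fun x => modulus (f x)) =
    Num.sqrt \o (fun x => reK (f x) ^+ 2 + imK (f x) ^+ 2).
  by apply/funext => x; rewrite modulusE.
apply: measurableT_comp; first by apply: nondecreasing_measurable => // s t; exact: ler_wsqrtr.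
by apply: measurable_funD; apply: measurable_funX.
Qed.

Lemma scalar_measurableZD (D : set R) (a : K) (f g : R -> K) : measurable D ->
  scalar_measurable D f -> scalar_measurable D g ->
  scalar_measurable D (fun x => a * f x + g x).
Proof.
move=> mD /scalar_measurableE[mrf mif] /scalar_measurableE[mrg mig].
apply/scalar_measurableE; split.
  rewrite (_ : (fun x => _) = fun x => reK a * reK (f x) - imK a * imK (f x) + reK (g x)); last first.
    by apply/funext => x; rewrite reKD reKM.
  apply: measurable_funD => //; apply: measurable_funB;
    by apply: measurable_funM => //; exact: measurable_cst.
rewrite (_ : (fun x => _) = fun x => reK a * imK (f x) + imK a * reK (f x) + imK (g x)); last first.
  by apply/funext => x; rewrite imKD imKM.
apply: measurable_funD => //; apply: measurable_funD;
  by apply: measurable_funM => //; exact: measurable_cst.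
Qed.

End Modulus.

Notation unitI R := ([set` (`[(0%R : R), (1%R : R)[)] : set R).

Section LFSpace.
Variables (R : realType) (k : scalars).
Local Notation K := (scalar_field R k).
Variables (F : R -> R) (oF : orlicz (EFin \o F)) (F1 : 0 < F 1).
Local Notation D := (unitI R).
Local Notation mu := (@lebesgue_measure R).

Lemma measurable_unitI : measurable D.
Proof. exact: measurable_itv. Qed.
Hint Resolve measurable_unitI : core.

Lemma measure_unitI : mu D = 1%E.
Proof. by rewrite lebesgue_measure_itv/= lte_fin ltr01 sube0. Qed.

Lemma integral_cst_unitI (r : R) : (\int[mu]_(x in D) r%:E = r%:E)%E.
Proof.
by rewrite integral_cst// -[RHS]mule1; congr (_ * _)%E; exact: measure_unitI.
Qed.

Definition modular (w : R -> R) : \bar R := (\int[mu]_(x in D) (F (w x))%:E)%E.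

Lemma measurable_modular_integrand (w : R -> R) :
  (forall x, 0 <= w x) -> measurable_fun D w ->
  measurable_fun D (fun x => (F (w x))%:E).
Proof. by move=> w0 mw; apply/measurable_EFinP; apply: measurable_orlicz. Qed.

Lemma modular_le (w w' : R -> R) :
  (forall x, 0 <= w x) -> (forall x, D x -> w x <= w' x) -> (forall x, 0 <= w' x) ->
  measurable_fun D w -> measurable_fun D w' -> (modular w <= modular w')%E.
Proof.
move=> w0 ww' w'0 mw mw'; apply: ge0_le_integral => //.
- by move=> x _; rewrite lee_fin orlicz_ge0.
- exact: measurable_modular_integrand.
- exact: measurable_modular_integrand.
- by move=> x Dx; rewrite lee_fin orlicz_mono// ww'.
Qed.

Lemma modular_scale (w : R -> R) (l : R) : 0 <= l <= 1 ->
  (forall x, 0 <= w x) -> measurable_fun D w ->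
  (modular (fun x => (l * w x)%R) <= l%:E * modular w)%E.
Proof.
move=> /andP[l0 l1] w0 mw.
rewrite /modular -ge0_integralZl//; last 2 first.
- exact: measurable_modular_integrand.
- by move=> x _; rewrite lee_fin orlicz_ge0.
apply: ge0_le_integral => //.
- by move=> x _; rewrite lee_fin orlicz_ge0// mulr_ge0.
- apply: measurable_modular_integrand; first by move=> x; rewrite mulr_ge0.
  by apply: measurable_funM => //; exact: measurable_cst.
- by apply: emeasurableZ; exact: measurable_orlicz.
- by move=> x _; rewrite -EFinM lee_fin orlicz_scale// l0.
Qed.

Lemma LF_normE (f : R -> K) : LF_norm (EFin \o F) f =
  luxemburg (fun t => modular (fun x => modulus (f x) / t)).
Proof. by []. Qed.

Lemma measurable_div (w : R -> R) (t : R) : measurable_fun D w ->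
  measurable_fun D (fun x => w x / t).
Proof. by move=> mw; apply: measurable_funM => //; exact: measurable_cst. Qed.

Lemma LF_norm_le (f : R -> K) (r : R) : 0 < r ->
  (modular (fun x => modulus (f x) / r)%R <= 1)%E -> (LF_norm (EFin \o F) f <= r%:E)%E.
Proof. by move=> r0 h; rewrite LF_normE; exact: luxemburg_le. Qed.

Lemma LF_norm_lt (f : R -> K) (r : R) : scalar_measurable D f ->
  (LF_norm (EFin \o F) f < r%:E)%E ->
  0 < r /\ (modular (fun x => modulus (f x) / r)%R <= 1)%E.
Proof.
move=> mf; rewrite LF_normE; apply: luxemburg_lt => s t s0 st.
have t0 : 0 < t by exact: lt_le_trans st.
have mm := measurable_modulus measurable_unitI mf.
apply: modular_le; try (exact: measurable_div).
- by move=> x; rewrite divr_ge0 ?modulus_ge0// ltW.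
- by move=> x _; rewrite ler_wpM2l ?modulus_ge0// lef_pV2.
- by move=> x; rewrite divr_ge0 ?modulus_ge0// ltW.
Qed.

Lemma LF_norm_mono (f g : R -> K) : scalar_measurable D f -> scalar_measurable D g ->
  (forall x, D x -> modulus (f x) <= modulus (g x)) ->
  (LF_norm (EFin \o F) f <= LF_norm (EFin \o F) g)%E.
Proof.
move=> mf mg fg; apply: luxemburg_mono => t t0.
have mmf := measurable_modulus measurable_unitI mf.
have mmg := measurable_modulus measurable_unitI mg.
apply: modular_le; try (exact: measurable_div).
- by move=> x; rewrite divr_ge0 ?modulus_ge0// ltW.
- by move=> x Dx; rewrite ler_wpM2r ?invr_ge0 ?(ltW t0)// fg.
- by move=> x; rewrite divr_ge0 ?modulus_ge0// ltW.
Qed.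

Lemma LF_norm0 : LF_norm (EFin \o F) (fun=> 0 : K) = 0%E.
Proof.
apply: luxemburg_eq0 => t t0; rewrite integral0_eq// => x _.
by rewrite modulus0 mul0r /= orlicz0.
Qed.

Lemma LF_normZ_le (f : R -> K) (a : K) : scalar_measurable D f ->
  (LF_norm (EFin \o F) f < +oo)%E ->
  (LF_norm (EFin \o F) (fun x => (a * f x)%R) <= (modulus a)%:E * LF_norm (EFin \o F) f)%E.
Proof.
move=> mf; have n0 : (0 <= LF_norm (EFin \o F) f)%E by exact: luxemburg_ge0.
move=> fin; have := ge0_fin_numE n0; rewrite fin => /fineK <-.
set N := fine _; have N0 : 0 <= N by rewrite fine_ge0.
have eN : LF_norm (EFin \o F) f = N%:E by rewrite fineK// ge0_fin_numE.
have [a0|a0] := eqVneq (modulus a) 0.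
  rewrite a0 mul0e (modulus_eq0 a0) [X in LF_norm _ X](_ : _ = fun=> 0) ?LF_norm0//.
  by apply/funext => x; rewrite mul0r.
have {}a0 : 0 < modulus a by rewrite lt_neqAle eq_sym a0 modulus_ge0.
rewrite -EFinM; apply/lee_addgt0Pr => e e0; rewrite -EFinD.
have [|r0 h] := @LF_norm_lt f (N + e / modulus a) mf.
  by rewrite eN lte_fin ltrDl divr_gt0.
have -> : modulus a * N + e = modulus a * (N + e / modulus a).
  by rewrite mulrDr mulrCA divff ?gt_eqF// mulr1.
apply: LF_norm_le; first by rewrite mulr_gt0.
rewrite (_ : (fun x => _) = (fun x => modulus (f x) / (N + e / modulus a)))//.
by apply/funext => x; rewrite modulusM -mulf_div divff ?gt_eqF// mul1r.
Qed.

(** (f + g) / (r + s) is a convex combination of f / r and g / s. *)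
Lemma modularD_le1 (f g : R -> K) (r s : R) : scalar_measurable D f -> scalar_measurable D g ->
  0 < r -> 0 < s ->
  (modular (fun x => modulus (f x) / r)%R <= 1)%E ->
  (modular (fun x => modulus (g x) / s)%R <= 1)%E ->
  (modular (fun x => modulus (f x + g x) / (r + s))%R <= 1)%E.
Proof.
move=> mf mg r0 s0 hf hg.
have rs0 : 0 < r + s by rewrite addr_gt0.
have mmf := measurable_modulus measurable_unitI mf.
have mmg := measurable_modulus measurable_unitI mg.
have mfg : scalar_measurable D (fun x => f x + g x).
  have := scalar_measurableZD 1 measurable_unitI mf mg.
  by rewrite (_ : (fun x => 1 * f x + g x) = (fun x => f x + g x))//; apply/funext => x; rewrite mul1r.
have mmfg := measurable_modulus measurable_unitI mfg.
have [l [l0 l1 l2]] : exists l, [/\ l = r / (r + s), 1 - l = s / (r + s) & 0 <= l <= 1].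
  have e : 1 - r / (r + s) = s / (r + s) by field; rewrite gt_eqF.
  exists (r / (r + s)); split => //.
  apply/andP; split; last rewrite -subr_ge0 e.
    by rewrite divr_ge0 ?(ltW r0) ?(ltW rs0).
  by rewrite divr_ge0 ?(ltW s0) ?(ltW rs0).
have [l3 l4] : 0 <= l /\ 0 <= 1 - l by rewrite subr_ge0; apply/andP.
apply: (@le_trans _ _ (l%:E * modular (fun x => modulus (f x) / r)%R +
    (1 - l)%:E * modular (fun x => modulus (g x) / s)%R)%E); last first.
  apply: (@le_trans _ _ (l%:E * 1 + (1 - l)%:E * 1)%E).
    apply: leeD.
      by apply: lee_wpmul2l; [rewrite lee_fin|exact: hf].
    by apply: lee_wpmul2l; [rewrite lee_fin|exact: hg].
  by rewrite !mule1 -EFinD addrC subrK.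
have pf x : 0 <= modulus (f x) / r by rewrite divr_ge0 ?modulus_ge0// ltW.
have pg x : 0 <= modulus (g x) / s by rewrite divr_ge0 ?modulus_ge0// ltW.
have Mf := measurable_orlicz oF measurable_unitI pf (measurable_div r mmf).
have Mg := measurable_orlicz oF measurable_unitI pg (measurable_div s mmg).
have MEf : measurable_fun D (fun x => (F (modulus (f x) / r))%:E) by exact/measurable_EFinP.
have MEg : measurable_fun D (fun x => (F (modulus (g x) / s))%:E) by exact/measurable_EFinP.
have E0f x : (0 <= (F (modulus (f x) / r))%:E)%E by rewrite lee_fin orlicz_ge0.
have E0g x : (0 <= (F (modulus (g x) / s))%:E)%E by rewrite lee_fin orlicz_ge0.
rewrite /modular -!ge0_integralZl//.
rewrite -ge0_integralD//; first last.
- exact: emeasurableZ.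
- by move=> x _; rewrite -EFinM lee_fin mulr_ge0// orlicz_ge0.
- exact: emeasurableZ.
- by move=> x _; rewrite -EFinM lee_fin mulr_ge0// orlicz_ge0.
apply: ge0_le_integral => //.
- by move=> x _; rewrite lee_fin orlicz_ge0// divr_ge0 ?modulus_ge0// ltW.
- apply: measurable_modular_integrand; last exact: measurable_div.
  by move=> x; rewrite divr_ge0 ?modulus_ge0// ltW.
- by apply: emeasurable_funD; exact: emeasurableZ.
- move=> x _; rewrite -!EFinM -EFinD lee_fin.
  apply: (le_trans _ (orlicz_convex oF (pf x) (pg x) l2)).
  apply: orlicz_mono => //; first by rewrite divr_ge0 ?modulus_ge0// ltW.
  have -> : l * (modulus (f x) / r) + (1 - l) * (modulus (g x) / s) =
      (modulus (f x) + modulus (g x)) / (r + s).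
    by rewrite l1 l0; field; rewrite !gt_eqF.
  by rewrite ler_wpM2r ?invr_ge0 ?ler_modulusD// ltW.
Qed.

Lemma LF_normD (f g : R -> K) : scalar_measurable D f -> scalar_measurable D g ->
  (LF_norm (EFin \o F) f < +oo)%E -> (LF_norm (EFin \o F) g < +oo)%E ->
  (LF_norm (EFin \o F) (fun x => (f x + g x)%R) <=
   LF_norm (EFin \o F) f + LF_norm (EFin \o F) g)%E.
Proof.
move=> mf mg ff fg.
have fin h : (LF_norm (EFin \o F) h < +oo)%E ->
    LF_norm (EFin \o F) h = (fine (LF_norm (EFin \o F) (h : R -> K)))%:E.
  by move=> hf; rewrite fineK// ge0_fin_numE//; exact: luxemburg_ge0.
rewrite (fin _ ff) (fin _ fg) -EFinD; apply/lee_addgt0Pr => e e0; rewrite -EFinD.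
have := @LF_norm_lt f (fine (LF_norm (EFin \o F) f) + e / 2) mf.
rewrite {1}(fin _ ff) lte_fin ltrDl divr_gt0// => /(_ isT)[r0 hf].
have := @LF_norm_lt g (fine (LF_norm (EFin \o F) g) + e / 2) mg.
rewrite {1}(fin _ fg) lte_fin ltrDl divr_gt0// => /(_ isT)[s0 hg].
move: (fine (LF_norm (EFin \o F) f)) (fine (LF_norm (EFin \o F) g)) r0 s0 hf hg.
move=> N M r0 s0 hf hg.
have -> : N + M + e = (N + e / 2) + (M + e / 2) by rewrite addrACA -splitr.
by apply: LF_norm_le; [rewrite addr_gt0|exact: modularD_le1].
Qed.

(** By convexity F is at least linear beyond 1. The embedding into L_1 provides
    almost everywhere convergence, which an Orlicz norm alone does not show. *)
Lemma L1_le_LF (f : R -> K) (r : R) : scalar_measurable D f ->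
  (LF_norm (EFin \o F) f < r%:E)%E ->
  (\int[mu]_(x in D) (modulus (f x))%:E <= (r * (1 + (F 1)^-1))%:E)%E.
Proof.
move=> mf nf; have [r0 h] := LF_norm_lt mf nf.
have mm := measurable_modulus measurable_unitI mf.
have pf x : 0 <= modulus (f x) / r by rewrite divr_ge0 ?modulus_ge0// ltW.
have Mf := measurable_orlicz oF measurable_unitI pf (measurable_div r mm).
apply: (@le_trans _ _ (\int[mu]_(x in D)
    (r%:E + (r / F 1)%:E * (F (modulus (f x) / r))%:E))%E).
  apply: ge0_le_integral => //.
  - by move=> x _; rewrite lee_fin modulus_ge0.
  - exact/measurable_EFinP.
  - by apply: emeasurable_funD; [exact: measurable_cst|exact: emeasurableZ].
  - move=> x _; rewrite -EFinM -EFinD lee_fin.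
    by apply: orlicz_linear_bound => //; exact: modulus_ge0.
have MEf : measurable_fun D (fun x => (F (modulus (f x) / r))%:E) by exact/measurable_EFinP.
have E0f x : (0 <= (F (modulus (f x) / r))%:E)%E by rewrite lee_fin orlicz_ge0.
have E3 : (0 <= (r / F 1)%:E)%E by rewrite lee_fin divr_ge0 ?(ltW r0) ?(ltW F1).
have E4 : (0 <= r%:E)%E by rewrite lee_fin ltW.
rewrite ge0_integralD//; first last.
- exact: emeasurableZ.
- by move=> x _; rewrite mule_ge0.
rewrite integral_cst_unitI ge0_integralZl//.
rewrite mulrDr mulr1 EFinD leeD2l// -[leRHS]mule1.
exact: lee_wpmul2l.
Qed.

End LFSpace.
#[export] Hint Resolve measurable_unitI : core.

(** * Completeness of L_F *)

Section LFBanach.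
Variables (R : realType) (k : scalars).
Local Notation K := (scalar_field R k).
Variables (F : R -> R) (oF : orlicz (EFin \o F)) (F1 : 0 < F 1).
Local Notation D := (unitI R).
Local Notation mu := (@lebesgue_measure R).
Local Notation X := (LF k (EFin \o F)).

#[local] Instance ae_filter_mu : Filter (nbhs (almost_everywhere mu)).
Proof.
exact: (ae_filter_ringOfSetsType (mu : {measure set (measurableTypeR R) -> \bar R})).
Qed.

Lemma LF_carrier0 : carrier X 0.
Proof.
split; last first.
  by rewrite (_ : 0 = (fun=> 0 : K)) ?LF_norm0// ltry.
apply/scalar_measurableE; split.
  by rewrite (_ : (fun x => _) = fun=> 0); [exact: measurable_cst|apply/funext => x; exact: reK0].
by rewrite (_ : (fun x => _) = fun=> 0); [exact: measurable_cst|apply/funext => x; exact: imK0].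
Qed.

Lemma LF_carrierZD (a : K) (u v : X) : carrier X u -> carrier X v -> carrier X (a *: u + v).
Proof.
move=> [mu_ fu] [mv fv].
have h0 : scalar_measurable D (fun=> 0 : K) by have [] := LF_carrier0.
have mau : scalar_measurable D (fun x => a * (u : R -> K) x).
  have := scalar_measurableZD a (@measurable_unitI R) mu_ h0.
  by rewrite (_ : (fun x => _ + 0) = (fun x => a * (u : R -> K) x))//; apply/funext => x; rewrite addr0.
split; first exact: (scalar_measurableZD a (@measurable_unitI R) mu_ mv).
have fau : (LF_norm (EFin \o F) (fun x => (a * (u : R -> K) x)%R) < +oo)%E.
  apply: (le_lt_trans (LF_normZ_le oF a mu_ fu)).
  rewrite -(@fineK _ (LF_norm _ u)) -?EFinM ?ltry//.
  by rewrite ge0_fin_numE//; exact: luxemburg_ge0.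
apply: (le_lt_trans (LF_normD oF mau mv fau fv)).
by apply: lte_add_pinfty.
Qed.

Lemma LF_fin (u : X) : carrier X u -> vnorm u \is a fin_num.
Proof. by move=> [_ fu]; rewrite ge0_fin_numE//; exact: luxemburg_ge0. Qed.

Lemma LF_Z (a : K) (u : X) : carrier X u -> vnorm (a *: u) = ((modulus a)%:E * vnorm u)%E.
Proof.
move=> cu; have [mu_ fu] := cu.
have le1 := LF_normZ_le oF a mu_ fu.
apply/eqP; rewrite eq_le le1/=.
have [a0|a0] := eqVneq a 0.
  by rewrite a0 modulus0 mul0e; exact: luxemburg_ge0.
have cau : carrier X (a *: u).
  by rewrite -[_ *: _]addr0; apply: LF_carrierZD => //; exact: LF_carrier0.
have [mau fau] := cau.
have := LF_normZ_le oF a^-1 mau fau.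
rewrite (_ : (fun x => _) = (u : R -> K)); last first.
  by apply/funext => x; rewrite [X in _ * X = _](_ : _ = a * (u : R -> K) x)// mulrA mulVf// mul1r.
have am : modulus a * modulus a^-1 = 1 by rewrite -modulusM divff// modulus1.
have -> : LF_norm (EFin \o F) (u : R -> K) = vnorm u by [].
have -> : LF_norm (EFin \o F) (a *: u : R -> K) = vnorm (a *: u) by [].
move=> /(lee_wpmul2l (_ : 0 <= (modulus a)%:E)%E); rewrite lee_fin modulus_ge0 => /(_ isT).
by rewrite muleA -EFinM am mul1e.
Qed.

Lemma LF_D (u v : X) : carrier X u -> carrier X v ->
  (vnorm (u + v) <= vnorm u + vnorm v)%E.
Proof. by move=> [mu_ fu] [mv fv]; exact: LF_normD. Qed.

Lemma limn_einf_ge (u : nat -> \bar R) (a : \bar R) (N : nat) :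
  (forall n, (N <= n)%N -> (a <= u n)%E) -> (a <= limn_einf u)%E.
Proof.
move=> H; rewrite limn_einf_lim; apply: (@le_trans _ _ (einfs u N)).
  by apply: le_ereal_inf_tmp => _ [n /= Nn <-]; exact: H.
have -> : limn (einfs u) = ereal_sup (range (einfs u)).
  by apply/cvg_lim => //; exact: cvg_einfs_sup.
by apply: ereal_sup_ubound; exists N.
Qed.

Lemma limn_einf_le (u : nat -> \bar R) (a : \bar R) :
  (forall n, (u n <= a)%E) -> (limn_einf u <= a)%E.
Proof.
move=> H; rewrite limn_einf_lim.
have -> : limn (einfs u) = ereal_sup (range (einfs u)).
  by apply/cvg_lim => //; exact: cvg_einfs_sup.
apply: ge_ereal_sup => _ [n _ <-].
by apply: (le_trans _ (H n)); apply: ereal_inf_lbound; exists n => /=.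
Qed.

Lemma summable_increments_cvg (z : nat -> R) (d : nat -> R) :
  (forall j, `|z j.+1 - z j| <= d j) ->
  (\sum_(0 <= j <oo) (d j)%:E < +oo)%E -> cvgn z.
Proof.
move=> zd dfin; have d0 j : 0 <= d j by exact: le_trans (zd j).
have ct : cvgn (series (telescope z)).
  apply: normed_cvg; apply: (@series_le_cvg _ _ d).
  - by move=> n; exact: normr_ge0.
  - by [].
  - by move=> n; exact: zd.
  apply: nondecreasing_is_cvgn.
    apply/nondecreasing_seqP => n; rewrite /series/= big_nat_recr//= lerDl.
    exact: d0.
  exists (fine (\sum_(0 <= j <oo) (d j)%:E)%E) => _ [n _ <-].
  have S0 : (0 <= \sum_(0 <= j <oo) (d j)%:E)%E.
    by apply: nneseries_ge0 => i *; rewrite lee_fin.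
  rewrite -lee_fin fineK ?ge0_fin_numE// /series/= -sumEFin.
  by apply: nneseries_lim_ge => i *; rewrite lee_fin.
have -> : z = (fun n => z 0%N + series (telescope z) n).
  by apply/funext => n; exact: eq_sum_telescope.
by apply: is_cvgD => //; exact: is_cvg_cst.
Qed.

(** The increments of a fast Cauchy sequence are summable in L_1, hence almost
    everywhere. Taking limits superior of the real and imaginary parts defines the
    limit at every point, measurably. *)
Lemma LF_limit (u : nat -> X) : (forall n, carrier X (u n)) ->
  (forall j, (vnorm (u j.+1 - u j)%R < (2^-1 ^+ j)%:E)%E) ->
  exists f : X, scalar_measurable D f /\
    {ae mu, forall x, D x ->
      modulus (f x - (u j : R -> K) x) @[j --> \oo] --> (0 : R)}.
Proof.
move=> cu Hu.
have mu_ n : scalar_measurable D (u n) by have [] := cu n.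
have cd j : carrier X (u j.+1 - u j).
  rewrite addrC -scaleN1r; exact: LF_carrierZD.
have md j : scalar_measurable D (u j.+1 - u j) by have [] := cd j.
pose d j x := modulus ((u j.+1 : R -> K) x - (u j : R -> K) x).
have mmd j : measurable_fun D (d j).
  exact: (measurable_modulus (@measurable_unitI R) (md j)).
have Md j : measurable_fun D (fun x => (d j x)%:E) by exact/measurable_EFinP.
have int_d j : (\int[mu]_(x in D) (d j x)%:E <= (2^-1 ^+ j * (1 + (F 1)^-1))%:E)%E.
  exact: (L1_le_LF oF F1 (md j) (Hu j)).
have C0 : 0 <= 1 + (F 1)^-1 by rewrite addr_ge0// invr_ge0 ltW.
have int_sum : (\int[mu]_(x in D) (\sum_(0 <= j <oo) (d j x)%:E) < +oo)%E.
  rewrite integral_nneseries//; last by move=> n x _; rewrite lee_fin modulus_ge0.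
  apply: (@le_lt_trans _ _ (2 * (1 + (F 1)^-1))%:E); last by rewrite ltry.
  apply: lime_le.
    apply: is_cvg_nneseries => n *; apply: integral_ge0 => x _.
    by rewrite lee_fin modulus_ge0.
  apply: nearW => n; apply: (@le_trans _ _
     (\sum_(0 <= j < n) (2^-1 ^+ j * (1 + (F 1)^-1))%:E)%E).
    by apply: lee_sum => j _; exact: int_d.
  rewrite sumEFin lee_fin -mulr_suml ler_wpM2r//.
  suff -> : \sum_(0 <= j < n) 2^-1 ^+ j = 2 - 2 * 2^-1 ^+ n :> R.
    by rewrite gerBl mulr_ge0// exprn_ge0// invr_ge0.
  elim: n => [|n IH]; first by rewrite big_nil expr0 mulr1 subrr.
  by rewrite big_nat_recr//= IH exprS; field.
have msum : measurable_fun D (fun x => \sum_(0 <= j <oo) (d j x)%:E)%E.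
  by apply: ge0_emeasurable_sum => // j x *; rewrite lee_fin modulus_ge0.
have fin_ae : {ae mu, forall x, D x -> (\sum_(0 <= j <oo) (d j x)%:E)%E \is a fin_num}.
  apply: integrable_ae => //; apply/integrableP; split => //.
  under eq_integral => x _.
    rewrite gee0_abs; last by apply: nneseries_ge0 => j *; rewrite lee_fin modulus_ge0.
    over.
  exact: int_sum.
pose re x := fine (limn_esup (fun j => (reK ((u j : R -> K) x))%:E)).
pose im x := fine (limn_esup (fun j => (imK ((u j : R -> K) x))%:E)).
have mre : measurable_fun D re.
  apply: measurableT_comp; first exact: fine_measurable.
  apply: measurable_fun_limn_esup => j; apply/measurable_EFinP.
  by have /scalar_measurableE[] := mu_ j.
have mim : measurable_fun D im.
  apply: measurableT_comp; first exact: fine_measurable.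
  apply: measurable_fun_limn_esup => j; apply/measurable_EFinP.
  by have /scalar_measurableE[] := mu_ j.
have imE x : imK (mkK k (re x) (im x)) = im x.
  case ek : k; last by rewrite imK_mkK.
  rewrite imK_real// /im (_ : (fun j => _) = fun=> 0%:E).
    by rewrite (cvg_limn_einf_sup (cvg_cst (0%:E : \bar R))).2.
  by apply/funext => j; rewrite imK_real.
exists (fun x => mkK k (re x) (im x)); split.
  apply/scalar_measurableE; split.
    by rewrite (_ : (fun x => _) = re)//; apply/funext => x; rewrite reK_mkK.
  by rewrite (_ : (fun x => _) = im)//; apply/funext => x; rewrite imE.
apply: filterS fin_ae => x Hx Dx; have {}Hx := Hx Dx.
have dfin : (\sum_(0 <= j <oo) (d j x)%:E < +oo)%E.
  by rewrite -ge0_fin_numE//; apply: nneseries_ge0 => *; rewrite lee_fin modulus_ge0.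
have cr : cvgn (fun j => reK ((u j : R -> K) x)).
  apply: (summable_increments_cvg (d := fun j => d j x)) => // j.
  by rewrite -reKN -reKD; exact: norm_reK.
have ci : cvgn (fun j => imK ((u j : R -> K) x)).
  apply: (summable_increments_cvg (d := fun j => d j x)) => // j.
  by rewrite -imKN -imKD; exact: norm_imK.
have reE : re x = limn (fun j => reK ((u j : R -> K) x)).
  have h : (reK ((u j : R -> K) x))%:E @[j --> \oo] -->
      (limn (fun j => reK ((u j : R -> K) x)))%:E.
    by apply: cvg_EFin; [exact: nearW|exact: cr].
  by rewrite /re (cvg_limn_einf_sup h).2.
have imE' : im x = limn (fun j => imK ((u j : R -> K) x)).
  have h : (imK ((u j : R -> K) x))%:E @[j --> \oo] -->
      (limn (fun j => imK ((u j : R -> K) x)))%:E.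
    by apply: cvg_EFin; [exact: nearW|exact: ci].
  by rewrite /im (cvg_limn_einf_sup h).2.
have cb : `|re x - reK ((u j : R -> K) x)| + `|im x - imK ((u j : R -> K) x)|
    @[j --> \oo] --> (0 : R).
  rewrite -[X in _ --> X](addr0 0); apply: cvgD.
    rewrite -[X in _ --> X](@normr0 _ R); apply: cvg_norm.
    rewrite -[X in _ --> X](subrr (re x)); apply: cvgB; first exact: cvg_cst.
    by rewrite reE.
  rewrite -[X in _ --> X](@normr0 _ R); apply: cvg_norm.
  rewrite -[X in _ --> X](subrr (im x)); apply: cvgB; first exact: cvg_cst.
  by rewrite imE'.
apply: (squeeze_cvgr _ (cvg_cst (0 : R)) cb).
apply: nearW => j; rewrite modulus_ge0/=.
apply: (le_trans (modulus_le_re_im _)).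
by rewrite reKD reKN imKD imKN reK_mkK imE.
Qed.

(** Fatou for the modulars of the differences. The factor 2 replaces continuity of
    F: where f - u_i does not vanish, |f - u_i| / 2 is eventually below |u_n - u_i|,
    so that monotonicity of F suffices. *)
Lemma LF_limit_norm (u : nat -> X) (f : X) : (forall n, carrier X (u n)) ->
  (forall i j, (i <= j)%N -> (vnorm (u j - u i)%R < (2^-1 ^+ i)%:E)%E) ->
  scalar_measurable D f ->
  {ae mu, forall x, D x ->
    modulus ((f : R -> K) x - (u j : R -> K) x) @[j --> \oo] --> (0 : R)} ->
  forall i, carrier X (f - u i) /\ (vnorm (f - u i)%R <= (2 * 2^-1 ^+ i)%:E)%E.
Proof.
move=> cu Hu mf Hf i.
have mu_ n : scalar_measurable D (u n) by have [] := cu n.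
have mdiff (g : X) n : scalar_measurable D g -> scalar_measurable D (g - u n).
  move=> mg; have := scalar_measurableZD (-1) (@measurable_unitI R) (mu_ n) mg.
  rewrite (_ : (fun x => _) = g - u n)//; apply/funext => x.
  by rewrite mulN1r addrC.
have md := mdiff f i mf.
have e0 : 0 < 2^-1 ^+ i :> R by rewrite exprn_gt0// invr_gt0.
suff nle : (vnorm (f - u i)%R <= (2 * 2^-1 ^+ i)%:E)%E.
  by split=> //; split => //; apply: (le_lt_trans nle); rewrite ltry.
apply: LF_norm_le => //.
pose e : R := 2^-1 ^+ i.
pose g n x := (F (modulus ((u (i + n)%N : R -> K) x - (u i : R -> K) x) / e))%:E.
have mg n : measurable_fun D (g n).
  apply: measurable_modular_integrand => //.
    by move=> x; rewrite divr_ge0 ?modulus_ge0// ltW.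
  apply: measurable_div; apply: (measurable_modulus (@measurable_unitI R)).
  exact: mdiff.
have g0 n x : (0 <= g n x)%E.
  by rewrite lee_fin orlicz_ge0// divr_ge0 ?modulus_ge0// ltW.
have gi n : (\int[mu]_(x in D) g n x <= 1)%E.
  by have [_] := LF_norm_lt oF (mdiff _ _ (mu_ _)) (Hu i (i + n)%N (leq_addr _ _)).
apply: (@le_trans _ _ (limn_einf (fun n => \int[mu]_(x in D) g n x))%E); last exact: limn_einf_le.
apply: le_trans (fatou mu (@measurable_unitI R) mg (fun n x _ => g0 n x)).
apply: ae_ge0_le_integral => //.
- by move=> x _; rewrite lee_fin orlicz_ge0// divr_ge0 ?modulus_ge0// ltW.
- apply: measurable_modular_integrand => //.
    by move=> x; rewrite divr_ge0 ?modulus_ge0// ltW.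
  apply: measurable_div; exact: (measurable_modulus (@measurable_unitI R)).
- by move=> x _; apply: (limn_einf_ge (N := 0%N)).
- rewrite (_ : (fun x => _) = (fun x => - limn_esup (fun n => - g n x))%E); last first.
    apply/funext => y; rewrite -limn_einfN; congr limn_einf.
    by apply/funext => n; exact/esym/oppeK.
  apply: (measurableT_comp (f := -%E)); first exact: oppe_measurable.
  apply: measurable_fun_limn_esup => n.
  by apply: (measurableT_comp (f := -%E)); [exact: oppe_measurable|exact: mg].
apply: filterS Hf => x Hx Dx; have {}Hx := Hx Dx.
set c := modulus ((f - u i : R -> K) x).
have [c0|c0] := eqVneq c 0.
  rewrite c0 mul0r orlicz0//; exact: (limn_einf_ge (N := 0%N)).
have {}c0 : 0 < c by rewrite lt_neqAle eq_sym c0 modulus_ge0.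
have c2 : 0 < c / 2 by rewrite divr_gt0.
have [N _ HN] := (cvgrPdist_lt _ _).1 Hx _ c2.
apply: (limn_einf_ge (N := N)) => n Nn.
rewrite lee_fin; apply: orlicz_mono => //.
  by rewrite divr_ge0 ?ltW.
have := HN (i + n)%N (leq_trans Nn (leq_addl _ _)).
rewrite /= sub0r normrN ger0_norm ?modulus_ge0// => h.
rewrite invfM mulrA ler_wpM2r ?invr_ge0 ?(ltW e0)//.
have : c <= modulus ((f : R -> K) x - (u (i + n)%N : R -> K) x) +
    modulus ((u (i + n)%N : R -> K) x - (u i : R -> K) x).
  apply: (le_trans _ (ler_modulusD _ _)).
  by rewrite addrA subrK.
lra.
Qed.

Lemma LF_complete (u : nat -> X) : (forall n, carrier X (u n)) ->
  (forall e : R, 0 < e -> exists N, forall m n, (N <= m)%N -> (N <= n)%N ->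
     (vnorm (u m - u n) < e%:E)%E) ->
  exists2 v, carrier X v & forall e : R, 0 < e ->
    exists N, forall n, (N <= n)%N -> (vnorm (v - u n) < e%:E)%E.
Proof.
move=> cu cauchy.
have cB (v w : X) : carrier X v -> carrier X w -> carrier X (v - w).
  by move=> cv cw; rewrite addrC -scaleN1r; exact: LF_carrierZD.
have [s hs Hs] : exists2 s : nat -> nat, {homo s : i j / (i < j)%N} &
    forall i n, (s i <= n)%N -> (vnorm (u n - u (s i))%R < (2^-1 ^+ i)%:E)%E.
  apply: (increasing_sub (P := fun i m => forall n, (m <= n)%N ->
     (vnorm (u n - u m)%R < (2^-1 ^+ i)%:E)%E)) => i N.
  have [|M HM] := cauchy (2^-1 ^+ i); first by rewrite exprn_gt0// invr_gt0.
  exists (maxn N M); first exact: leq_maxl.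
  move=> n Mn; apply: HM; last exact: leq_maxr.
  by rewrite (leq_trans _ Mn)// leq_maxr.
have hs' i j : (i <= j)%N -> (s i <= s j)%N.
  by rewrite leq_eqVlt => /predU1P[->//|/hs /ltnW].
have Hs' i j : (i <= j)%N -> (vnorm (u (s j) - u (s i))%R < (2^-1 ^+ i)%:E)%E.
  by move=> ij; apply: Hs; exact: hs'.
have [f [mf Hf]] := LF_limit (fun n => cu (s n)) (fun j => Hs' j j.+1 (leqnSn j)).
have main := LF_limit_norm (fun n => cu (s n)) Hs' mf Hf.
exists f.
  have [c0 _] := main 0%N; rewrite -(subrK (u (s 0%N)) f) -[_ - _]scale1r.
  exact: LF_carrierZD.
move=> e e0; have [J HJ] := half_pow_small 3 e0.
exists (s J) => n Jn.
have [cf nf] := main J.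
have -> : f - u n = (f - u (s J)) + (u (s J) - u n) by rewrite addrA subrK.
apply: (le_lt_trans (LF_D cf (cB _ _ (cu _) (cu _)))).
have : (vnorm (u (s J) - u n)%R < (2^-1 ^+ J)%:E)%E.
  rewrite -opprB -scaleN1r LF_Z; last exact: cB.
  by rewrite modulusN modulus1 mul1e; exact: Hs.
move=> h; apply: (le_lt_trans (leeD nf (ltW h))).
rewrite -EFinD lte_fin; have := HJ J (leqnn J); lra.
Qed.

Theorem LF_banach : banach X.
Proof.
split.
- exact: LF_carrier0.
- exact: LF_carrierZD.
- by move=> u; exact: luxemburg_ge0.
- exact: LF_fin.
- exact: LF_Z.
- exact: LF_D.
- exact: LF_complete.
Qed.

End LFBanach.

(** * Growth of F and random signs *)

Section Growth.
Variables (R : realType) (F : R -> R) (oF : orlicz (EFin \o F)).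

Lemma doubling_growth : doubling_near_infinity F ->
  exists2 D, 1 <= D & forall s j, 1 <= s -> F (2 ^+ j * s) <= D ^+ j * F s.
Proof.
move=> [C HC]; exists (Num.max 1 C); first by rewrite le_max lexx.
move=> s j s1; elim: j => [|j IH]; first by rewrite !expr0 !mul1r.
have p1 : 1 <= 2 ^+ j * s.
  by apply: mulr_ege1 => //; apply: exprn_ege1; rewrite ler1n.
have [pos] := HC _ p1; rewrite ler_pdivrMr// => h.
rewrite exprS -mulrA (le_trans h)// exprS -mulrA.
apply: ler_pM => //; [|exact: ltW|by rewrite le_max lexx orbT].
have := (HC 1 (lexx _)).1; rewrite /= => F1.
have [_ h1] := HC 1 (lexx _).
apply: le_trans h1; rewrite divr_ge0 ?(ltW F1)//; apply: (orlicz_ge0 oF) => //.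
Qed.

(** Doubling gives polynomial growth. Exponential growth is weaker, but it is what
    combines with the exponential moments of random sums. *)
Lemma exponential_growth : doubling_near_infinity F ->
  exists2 A, 0 < A & forall s l, 1 <= s -> 0 <= l -> F (l * s) <= A * expR l * F s.
Proof.
move=> dF; have [D D1 HD] := doubling_growth dF.
have [d0 Dd0] := exists_nat_ge D; pose d := d0.+1.
have Dd : D <= 2 ^+ d.
  apply: (le_trans Dd0); rewrite -natrX ler_nat.
  by rewrite (leq_trans (ltnW (ltn_expl d0 (ltnSn 1))))// leq_exp2l.
(* With D <= 2^d and l <= 2^j <= 2 l, doubling j times costs at most (2 l)^d,
   and l^d <= d^d exp l. *)
pose A : R := (2 * d%:R) ^+ d.
have A1 : 1 <= A.
  by apply: exprn_ege1; rewrite -natrM ler1n.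
exists A; first exact: lt_le_trans A1.
move=> s l s1 l0; have s0 : 0 <= s by exact: le_trans s1.
have Fs0 : 0 <= F s by exact: (orlicz_ge0 oF).
have [l1|/ltW l1] := leP l 1.
  apply: (@le_trans _ _ (F s)).
    by apply: orlicz_mono => //; rewrite ?mulr_ge0// ler_piMl.
  rewrite ler_peMl// -[1]mulr1 ler_pM//.
  by rewrite -expR0 ler_expR.
have [j lj jl] : exists2 j, l <= 2 ^+ j & 2 ^+ j <= 2 * l.
  have ex : exists j, l <= 2 ^+ j.
    have [j hj] := exists_nat_ge l; exists j; apply: (le_trans hj).
    by rewrite -natrX ler_nat ltnW// ltn_expl.
  case: (ex_minnP ex) => j lj jmin; exists j => //.
  case: j lj jmin => [|j] lj jmin; first by rewrite expr0; lra.
  rewrite exprS ler_pM2l//; apply/ltW; rewrite ltNge; apply/negP => h.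
  by have := jmin _ h; rewrite ltnn.
apply: (@le_trans _ _ (F (2 ^+ j * s))).
  by apply: orlicz_mono => //; rewrite ?mulr_ge0// ler_wpM2r.
apply: (le_trans (HD _ _ s1)); rewrite ler_wpM2r//.
have D0 : 0 <= D by exact: le_trans D1.
apply: (@le_trans _ _ ((2 ^+ d) ^+ j)).
  by rewrite lerXn2r ?nnegrE ?exprn_ge0.
rewrite exprAC; apply: (@le_trans _ _ ((2 * l) ^+ d)).
  by rewrite lerXn2r ?nnegrE ?exprn_ge0// mulr_ge0.
have -> : expR l = expR (l / d%:R) ^+ d.
  by rewrite -expRM_natr divfK ?gt_eqF.
rewrite -exprMn lerXn2r ?nnegrE ?mulr_ge0 ?expR_ge0//.
rewrite -mulrA ler_pM2l//.
apply: (@le_trans _ _ (d%:R * (1 + l / d%:R))).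
  by rewrite mulrDr mulrCA divff ?gt_eqF// !mulr1 lerDr ltW.
by rewrite ler_pM2l// expR_ge1Dx.
Qed.

(** A form of Jensen's inequality for F as a function of t^2. With h = t / 2, the
    terms with u_i < h contribute at most h^2 = t^2 / 4 to the quadratic mean, so
    that most of it comes from the other terms, where F(u_i) dominates
    u_i^2 F(h) / h^2 up to a constant. The summand F(1) accounts for h <= 1. *)
Lemma two_convexity : 0 < F 1 ->
  essentially_increasing (fun t => F t * t ^- 2) ->
  exists2 C, 0 < C & forall n (l u : 'I_n -> R) t,
    (forall i, 0 <= l i) -> (forall i, 0 <= u i) -> 0 <= t ->
    \sum_i l i <= 1 -> t ^+ 2 <= \sum_i l i * u i ^+ 2 ->
    F (t / 2) <= F 1 + C * \sum_i l i * F (u i).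
Proof.
move=> F1 [C HC].
have C1 : 1 <= C.
  have := HC 1 1 (lexx _) (lexx _); rewrite expr1n invr1 mulr1.
  by rewrite ler_pMl.
have C0 : 0 < C by exact: lt_le_trans C1.
exists C => // n l u t l0 u0 t0 l1 tl.
have S0 : 0 <= \sum_i l i * F (u i).
  by apply: sumr_ge0 => i _; rewrite mulr_ge0// (orlicz_ge0 oF).
have [t2|/ltW t2] := leP (t / 2) 1.
  apply: ler_wpDr; first by rewrite mulr_ge0// ltW.
  by apply: orlicz_mono => //; rewrite divr_ge0.
apply: ler_wpDl; first exact: ltW.
set h := t / 2 in t2 *.
have h0 : 0 < h by exact: lt_le_trans t2.
have key : h ^+ 2 * F h <= C * \sum_i l i * F (u i) * h ^+ 2.
  apply: (@le_trans _ _ (F h * \sum_(i | h <= u i) l i * u i ^+ 2)).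
    rewrite mulrC ler_wpM2l ?(orlicz_ge0 oF) ?(ltW h0)//.
    have : \sum_(i | ~~ (h <= u i)) l i * u i ^+ 2 <= h ^+ 2.
      apply: (@le_trans _ _ (\sum_(i | ~~ (h <= u i)) l i * h ^+ 2)).
        apply: ler_sum => i; rewrite -ltNge => /ltW ui; rewrite ler_wpM2l//.
        by rewrite lerXn2r ?nnegrE ?u0// ltW.
      rewrite -mulr_suml ler_piMl ?sqr_ge0// (le_trans _ l1)//.
      by rewrite [leRHS](bigID (fun i => ~~ (h <= u i)))/= lerDl sumr_ge0.
    move: tl; rewrite (bigID (fun i => h <= u i))/=.
    have -> : t ^+ 2 = 4 * h ^+ 2 by rewrite /h; field.
    have := sqr_ge0 h; lra.
  rewrite mulr_sumr [leRHS]mulr_sumr [leRHS](bigID (fun i => h <= u i))/=.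
  apply: ler_wpDr.
    by apply: sumr_ge0 => i _; rewrite !mulr_ge0 ?sqr_ge0 ?(orlicz_ge0 oF)// ltW.
  apply: ler_sum => i hu.
  have ui0 : 0 < u i by exact: lt_le_trans hu.
  have := HC _ _ t2 hu.
  rewrite ler_pdivrMr ?exprn_gt0// => hh.
  have {}hh : F h * u i ^+ 2 <= C * F (u i) * h ^+ 2.
    have := ler_wpM2r (sqr_ge0 (u i)) hh.
    rewrite [X in _ <= X](_ : _ = C * F (u i) * h ^+ 2)//; field.
    by rewrite gt_eqF.
  have := ler_wpM2l (l0 i) hh; rewrite /= => hhh.
  rewrite [leLHS](_ : _ = l i * (F h * u i ^+ 2)); last by ring.
  by apply: (le_trans hhh); rewrite le_eqVlt; apply/orP; left; apply/eqP; ring.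
by move: key; rewrite -mulr_suml mulrA (mulrC (h ^+ 2)) ler_pM2r ?exprn_gt0.
Qed.

Lemma square_bound : 0 < F 1 ->
  essentially_increasing (fun t => F t * t ^- 2) ->
  exists2 C, 0 < C & forall m r, 0 < r -> 0 <= m ->
    m ^+ 2 <= r ^+ 2 * (1 + C * F (m / r)).
Proof.
move=> F1 [C HC].
have C1 : 1 <= C.
  have := HC 1 1 (lexx _) (lexx _); rewrite expr1n invr1 mulr1.
  by rewrite ler_pMl.
have C0 : 0 < C by exact: lt_le_trans C1.
exists (C / F 1); first by rewrite divr_gt0.
move=> m r r0 m0; have t0 : 0 <= m / r by rewrite divr_ge0// ltW.
have {1}-> : m = r * (m / r) by rewrite mulrC divfK ?gt_eqF.
rewrite exprMn ler_pM2l ?exprn_gt0//.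
have F0 := orlicz_ge0 oF t0.
have [t1|/ltW t1] := leP (m / r) 1.
  apply: ler_wpDr; first by rewrite mulr_ge0// divr_ge0// ltW.
  by rewrite expr_le1.
have tp : 0 < m / r by exact: lt_le_trans t1.
apply: ler_wpDl => //.
have := HC 1 _ (lexx _) t1; rewrite expr1n invr1 mulr1.
rewrite mulrA ler_pdivlMr ?exprn_gt0// => h.
by rewrite mulrAC ler_pdivlMr// mulrC.
Qed.

End Growth.

Section Rademacher.
Variable R : realType.

(** The sharp exponent is x^2 / 2. With 2 x^2 instead, the bound
    exp x <= 1 / (1 - x) is enough for |x| <= 1/2, and |x| <= 2 x^2 beyond. *)
Lemma cosh_le (x : R) : expR x + expR (- x) <= 2 * expR (2 * x ^+ 2).
Proof.
have [h|h] := leP `|x| 2^-1; last first.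
  have xx : `|x| <= 2 * x ^+ 2.
    by rewrite -real_normK ?num_real//; have := normr_ge0 x; nra.
  have h1 : expR x <= expR (2 * x ^+ 2) by rewrite ler_expR (le_trans (ler_norm _)).
  have h2 : expR (- x) <= expR (2 * x ^+ 2).
    by rewrite ler_expR (le_trans _ xx)// -normrN ler_norm.
  lra.
have [hx1 hx2] : - 2^-1 <= x /\ x <= 2^-1 by apply/andP; rewrite -ler_norml.
have a0 : 0 < 1 - x by lra.
have b0 : 0 < 1 + x by lra.
have h1 : expR x <= (1 - x)^-1.
  rewrite -[leLHS]invrK -expRN lef_pV2 ?posrE ?expR_gt0//; exact: expR_ge1Dx.
have h2 : expR (- x) <= (1 + x)^-1.
  by rewrite expRN lef_pV2 ?posrE ?expR_gt0//; exact: expR_ge1Dx.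
apply: (le_trans (lerD h1 h2)).
have h3 : 1 + 2 * x ^+ 2 <= expR (2 * x ^+ 2) by exact: expR_ge1Dx.
apply: (@le_trans _ _ (2 * (1 + 2 * x ^+ 2))); last by rewrite ler_pM2l.
have -> : (1 - x)^-1 + (1 + x)^-1 = 2 / ((1 - x) * (1 + x)).
  by field; rewrite !gt_eqF.
rewrite ler_pdivrMr ?mulr_gt0//.
have : x ^+ 2 <= 4^-1 by nra.
by have := sqr_ge0 x; nra.
Qed.

(** Independence of the signs: the sum over all sign patterns of a product is the
    product of the sums over each sign. *)
Lemma sum_signs_exp n (c : 'I_n -> R) :
  \sum_(g : {ffun 'I_n -> bool}) expR (\sum_i (-1) ^+ g i * c i) <=
  2 ^+ n * expR (2 * \sum_i c i ^+ 2).
Proof.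
have -> : \sum_(g : {ffun 'I_n -> bool}) expR (\sum_i (-1) ^+ g i * c i) =
    \prod_i (expR (c i) + expR (- c i)).
  transitivity (\sum_(g : {ffun 'I_n -> bool}) \prod_i expR ((-1) ^+ g i * c i)).
    by apply: eq_bigr => g _; rewrite expR_sum.
  rewrite -(bigA_distr_bigA (fun (i : 'I_n) (b : bool) => expR ((-1) ^+ b * c i))).
  apply: eq_bigr => i _; rewrite big_bool/= expr1 expr0 mulN1r mul1r.
  by rewrite addrC.
rewrite mulr_sumr expR_sum -[X in 2 ^+ X]card_ord -prodr_const -big_split/=.
by apply: ler_prod => i _; rewrite addr_ge0 ?expR_ge0//= cosh_le.
Qed.

(** A random sum S satisfies F(|S|) <= A exp(|S| / s) F(s), and the exponential of
    |S| / s is at most the sum of those of S / s and - S / s. *)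
Lemma khintchine_orlicz (F : R -> R) : orlicz (EFin \o F) ->
  doubling_near_infinity F ->
  exists2 A, 0 < A & forall n (c : 'I_n -> R) s,
    1 <= s -> \sum_i c i ^+ 2 <= s ^+ 2 ->
    \sum_(g : {ffun 'I_n -> bool}) F `|\sum_i (-1) ^+ g i * c i| <= 2 ^+ n * (A * F s).
Proof.
move=> oF dF; have [A A0 HA] := exponential_growth oF dF.
exists (A * (2 * expR 2)); first by rewrite !mulr_gt0// expR_gt0.
move=> n c s s1 cs; have s0 : 0 < s by exact: lt_le_trans s1.
have Fs0 : 0 <= F s by rewrite (orlicz_ge0 oF)// ltW.
have sumc (e : R) : `|e| = 1 ->
   \sum_(g : {ffun 'I_n -> bool}) expR (\sum_i (-1) ^+ g i * (e * c i / s)) <=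
   2 ^+ n * expR 2.
  move=> e1; apply: (le_trans (sum_signs_exp _)).
  rewrite ler_pM2l ?exprn_gt0// ler_expR ger_pMr//.
  have -> : \sum_i (e * c i / s) ^+ 2 = (\sum_i c i ^+ 2) / s ^+ 2.
    rewrite mulr_suml; apply: eq_bigr => i _.
    by rewrite !exprMn -(real_normK (num_real e)) e1 expr1n mul1r exprVn.
  by rewrite ler_pdivrMr ?exprn_gt0// mul1r.
have pt (g : {ffun 'I_n -> bool}) : F `|\sum_i (-1) ^+ g i * c i| <=
   A * F s * (expR (\sum_i (-1) ^+ g i * (1 * c i / s)) +
              expR (\sum_i (-1) ^+ g i * (-1 * c i / s))).
  have -> : \sum_i (-1) ^+ g i * (1 * c i / s) = (\sum_i (-1) ^+ g i * c i) / s.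
    by rewrite mulr_suml; apply: eq_bigr => i _; rewrite mul1r mulrA.
  have -> : \sum_i (-1) ^+ g i * (-1 * c i / s) = - ((\sum_i (-1) ^+ g i * c i) / s).
    rewrite mulr_suml -sumrN; apply: eq_bigr => i _.
    by rewrite mulN1r mulNr mulrN mulrA.
  set S := \sum_i _.
  have -> : `|S| = (`|S| / s) * s by rewrite divfK// gt_eqF.
  apply: (le_trans (HA _ _ s1 _)); first by rewrite divr_ge0// ltW.
  rewrite mulrAC ler_wpM2l ?mulr_ge0 ?(ltW A0)//.
  have -> : `|S| / s = `|S / s| by rewrite normrM normfV (gtr0_norm s0).
  have [S0|S0] := leP 0 (S / s); first by rewrite ger0_norm// lerDl expR_ge0.
  by rewrite ltr0_norm// lerDr expR_ge0.
apply: (le_trans (ler_sum _ (fun g _ => pt g))).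
rewrite -mulr_sumr big_split/=.
have h1 := sumc 1 (normr1 _); have h2 := sumc (-1) (normrN1 _).
rewrite [leRHS](_ : _ = A * F s * (2 ^+ n * expR 2 + 2 ^+ n * expR 2)); last by ring.
by rewrite ler_wpM2l ?mulr_ge0 ?(ltW A0)// lerD.
Qed.

End Rademacher.

(** * The Hilbertian case *)

Section TypeTwo.
Variables (R : realType) (k : scalars).
Local Notation K := (scalar_field R k).
Variables (F : R -> R) (oF : orlicz (EFin \o F)).
Variables (dF : doubling_near_infinity F)
  (iF : essentially_increasing (fun t => F t * t ^- 2)).
Local Notation D := (unitI R).
Local Notation mu := (@lebesgue_measure R).
Local Notation X := (LF k (EFin \o F)).

Lemma doubling_F1 : 0 < F 1.
Proof. by have [C HC] := dF; have [] := HC 1 (lexx _). Qed.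

Let F1 := doubling_F1.
Let bX : banach X := LF_banach k oF F1.

Lemma reK_signM (b : bool) (z : K) : reK ((-1) ^+ b * z) = (-1) ^+ b * reK z.
Proof. by case: b; rewrite ?expr1 ?expr0 ?mulN1r ?mul1r// reKN. Qed.

Lemma imK_signM (b : bool) (z : K) : imK ((-1) ^+ b * z) = (-1) ^+ b * imK z.
Proof. by case: b; rewrite ?expr1 ?expr0 ?mulN1r ?mul1r// imKN. Qed.

(** The modular form of type 2, at a point. One factor 2 in the denominator
    separates real and imaginary parts by convexity, the other one comes from
    [two_convexity], which is applied to the square function t of the terms. As the
    Khintchine inequality requires a level of at least 1, it is used at the level
    max 1 (t / 2). *)
Lemma type2_pointwise : exists2 Q, 0 < Q &
  forall n (a z : 'I_n -> K) r, 0 < r -> \sum_i modulus (a i) ^+ 2 <= 1 ->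
    \sum_(g : {ffun 'I_n -> bool})
      F (modulus (\sum_i (-1) ^+ g i * (a i * z i)) / (4 * r)) <=
    2 ^+ n * (Q + Q * \sum_i modulus (a i) ^+ 2 * F (modulus (z i) / r)).
Proof.
have [A A0 HA] := khintchine_orlicz oF dF.
have [C C0 HC] := two_convexity oF F1 iF.
exists (A * (2 * F 1 + C)).
  by rewrite mulr_gt0// addr_gt0// mulr_gt0.
move=> n a z r r0 a1.
pose u i := modulus (z i) / r; pose l i := modulus (a i) ^+ 2.
have u0 i : 0 <= u i by rewrite divr_ge0 ?modulus_ge0// ltW.
have l0 i : 0 <= l i by rewrite sqr_ge0.
have tau0 : 0 <= \sum_i l i * u i ^+ 2.
  by apply: sumr_ge0 => i _; rewrite mulr_ge0// sqr_ge0.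
pose t := Num.sqrt (\sum_i l i * u i ^+ 2).
have t0 : 0 <= t by exact: sqrtr_ge0.
have t2 : t ^+ 2 = \sum_i l i * u i ^+ 2 by rewrite sqr_sqrtr.
have conv : F (t / 2) <= F 1 + C * \sum_i l i * F (u i).
  by apply: HC => //; rewrite t2.
pose s := Num.max 1 (t / 2).
have s1 : 1 <= s by rewrite le_max lexx.
have Fs : F s <= F 1 + F (t / 2).
  rewrite /s; have [_|_] := leP (t / 2) 1.
    by rewrite lerDl (orlicz_ge0 oF)// divr_ge0.
  by rewrite lerDr ltW.
have ts : (t / 2) ^+ 2 <= s ^+ 2.
  rewrite lerXn2r ?nnegrE ?divr_ge0//; last by rewrite le_max lexx orbT.
  exact: le_trans s1.
have bound (p : K -> R) : (forall w, `|p w| <= modulus w) ->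
    \sum_i (p (a i * z i) / (2 * r)) ^+ 2 <= s ^+ 2.
  move=> pm; apply: le_trans ts; rewrite expr_div_n t2 mulr_suml.
  apply: ler_sum => i _.
  have -> : l i * u i ^+ 2 / 2 ^+ 2 = (modulus (a i * z i) / (2 * r)) ^+ 2.
    by rewrite modulusM /l /u; field; rewrite gt_eqF.
  rewrite !expr_div_n ler_wpM2r ?invr_ge0 ?sqr_ge0//.
  rewrite -real_normK ?num_real// lerXn2r ?nnegrE ?modulus_ge0//.
have r2 : 0 < 2 * r by rewrite mulr_gt0.
have pt (g : {ffun 'I_n -> bool}) :
    F (modulus (\sum_i (-1) ^+ g i * (a i * z i)) / (4 * r)) <=
    2^-1 * F `|\sum_i (-1) ^+ g i * (reK (a i * z i) / (2 * r))| +
    2^-1 * F `|\sum_i (-1) ^+ g i * (imK (a i * z i) / (2 * r))|.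
  have -> : \sum_i (-1) ^+ g i * (reK (a i * z i) / (2 * r)) =
      reK (\sum_i (-1) ^+ g i * (a i * z i)) / (2 * r).
    by rewrite reK_sum mulr_suml; apply: eq_bigr => i _; rewrite reK_signM mulrA.
  have -> : \sum_i (-1) ^+ g i * (imK (a i * z i) / (2 * r)) =
      imK (\sum_i (-1) ^+ g i * (a i * z i)) / (2 * r).
    by rewrite imK_sum mulr_suml; apply: eq_bigr => i _; rewrite imK_signM mulrA.
  set S := \sum_i _.
  have h01 : 0 <= (2^-1 : R) <= 1 by rewrite invr_ge0 ler0n/= invf_le1// ler1n.
  have := orlicz_convex oF (normr_ge0 (reK S / (2 * r))) (normr_ge0 (imK S / (2 * r))) h01.
  have -> : 1 - 2^-1 = 2^-1 :> R by field.
  apply: le_trans; apply: orlicz_mono => //.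
    by rewrite divr_ge0 ?modulus_ge0// ltW// mulr_gt0.
  rewrite !normrM normfV (gtr0_norm r2).
  have -> : 2^-1 * (`|reK S| / (2 * r)) + 2^-1 * (`|imK S| / (2 * r)) =
      (`|reK S| + `|imK S|) / (4 * r) by field; rewrite gt_eqF.
  by rewrite ler_wpM2r ?invr_ge0 ?modulus_le_re_im// ltW// mulr_gt0.
apply: (le_trans (ler_sum _ (fun g _ => pt g))).
rewrite big_split/= -!mulr_sumr.
have h1 := HA n _ s s1 (bound (@reK R k) (@norm_reK R k)).
have h2 := HA n _ s s1 (bound (@imK R k) (@norm_imK R k)).
apply: (@le_trans _ _ (2 ^+ n * (A * F s))); first lra.
rewrite ler_pM2l ?exprn_gt0//.
have S0 : 0 <= \sum_i l i * F (u i).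
  by apply: sumr_ge0 => i _; rewrite mulr_ge0// (orlicz_ge0 oF).
rewrite -/l -/u [\sum_i _](_ : _ = \sum_i l i * F (u i))//.
rewrite -mulrA -mulrDr ler_pM2l//.
have := F1; have := mulr_ge0 (ltW F1) S0; move: Fs conv S0 (C0); nra.
Qed.

Lemma lincomb_fun (x : nat -> X) (a : nat -> K) n t :
  (lincomb x a n : R -> K) t = \sum_(i < n) a i * (x i : R -> K) t.
Proof. by rewrite /lincomb fct_sumE. Qed.

Lemma exists_le_average (I : finType) (i0 : I) (f : I -> \bar R) (c : R) :
  (\sum_i f i <= (#|I|%:R * c)%:E)%E -> exists i, (f i <= (c + 1)%:E)%E.
Proof.
move=> h; apply: contrapT => H.
have lef i : ((c + 1)%:E <= f i)%E.
  by rewrite leNgt; apply/negP => /ltW hi; apply: H; exists i.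
have : ((#|I|%:R * (c + 1))%:E <= (#|I|%:R * c)%:E)%E.
  apply: le_trans h; rewrite mulr_natl -sumr_const -sumEFin.
  by apply: lee_sum => i _.
rewrite lee_fin ler_pM2l; first lra.
by rewrite ltr0n; apply/card_gt0P; exists i0.
Qed.

(** Integrating [type2_pointwise] bounds the average over all signs of the modular,
    so some choice of signs has a modular below the average. *)
Lemma type2_signs : exists2 Q, 0 < Q &
  forall (x : nat -> X) n (a : nat -> K) r, (forall i, carrier X (x i)) -> 0 < r ->
    (forall i, nrm (x i) < r) -> \sum_(i < n) modulus (a i) ^+ 2 <= 1 ->
    exists s : nat -> bool, nrm (lincomb x (fun i => (-1) ^+ s i * a i) n) <= Q * r.
Proof.
have [Q Q0 HQ] := type2_pointwise.
exists (4 * (2 * Q + 1)); first by rewrite mulr_gt0// addr_gt0// mulr_gt0.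
move=> x n a r cx r0 xr a1.
(* Patterns of n signs, continued by + signs. *)
pose sg (g : {ffun 'I_n -> bool}) (i : nat) : bool :=
  if (insub i : option 'I_n) is Some o then g o else false.
have sgE g (o : 'I_n) : sg g o = g o by rewrite /sg valK.
pose W (g : {ffun 'I_n -> bool}) t : R :=
  modulus ((lincomb x (fun i => (-1) ^+ sg g i * a i) n : R -> K) t) / (4 * r).
have r4 : 0 < 4 * r by rewrite mulr_gt0.
have cl g : carrier X (lincomb x (fun i => (-1) ^+ sg g i * a i) n).
  exact: carrier_lincomb.
have W0 g t : 0 <= W g t by rewrite divr_ge0 ?modulus_ge0// ltW.
have mW g : measurable_fun D (W g).
  by apply: measurable_div; apply: measurable_modulus => //; have [] := cl g.
have MW g : measurable_fun D (fun t => (F (W g t))%:E).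
  exact: (measurable_modular_integrand oF).
pose G (i : nat) t : R := F (modulus ((x i : R -> K) t) / r).
have G0 i t : 0 <= G i t.
  by rewrite /G (orlicz_ge0 oF)// divr_ge0 ?modulus_ge0// ltW.
have MG i : measurable_fun D (fun t => (G i t)%:E).
  apply: (measurable_modular_integrand oF) => //.
    by move=> t; rewrite divr_ge0 ?modulus_ge0// ltW.
  by apply: measurable_div; apply: measurable_modulus => //; have [] := cx i.
have intG i : (\int[mu]_(t in D) (G i t)%:E <= 1)%E.
  have [mi _] := cx i.
  have := @LF_norm_lt _ _ _ oF (x i) r mi.
  rewrite -[LF_norm _ _]/(vnorm (x i)) (vnormE bX (cx i)) lte_fin xr.
  by move=> /(_ isT)[_].
pose c (i : 'I_n) := 2 ^+ n * Q * modulus (a i) ^+ 2.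
have Q2' : 0 <= 2 ^+ n * Q by apply: mulr_ge0; [exact: exprn_ge0|exact: ltW].
have c0 i : (0 <= (c i)%:E)%E.
  by rewrite lee_fin; apply: mulr_ge0 => //; exact: sqr_ge0.
have MZ (i : 'I_n) : measurable_fun D (fun t => (c i)%:E * (G i t)%:E)%E.
  by apply: emeasurableZ; apply/measurable_EFinP; exact: MG.
have sumI : (\sum_(g : {ffun 'I_n -> bool}) \int[mu]_(t in D) (F (W g t))%:E <=
    (#|{: {ffun 'I_n -> bool}}|%:R * (2 * Q))%:E)%E.
  rewrite -ge0_integral_sum//; last by move=> g t _; rewrite lee_fin (orlicz_ge0 oF).
  apply: (@le_trans _ _ (\int[mu]_(t in D)
      ((2 ^+ n * Q)%:E + \sum_(i < n) (c i)%:E * (G i t)%:E))%E).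
    apply: ge0_le_integral => //.
    - by move=> t _; apply: sume_ge0 => g _; rewrite lee_fin (orlicz_ge0 oF).
    - exact: emeasurable_sum.
    - apply: emeasurable_funD; first exact: measurable_cst.
      exact: emeasurable_sum.
    - move=> t _; rewrite sumEFin.
      have -> : (\sum_(i < n) (c i)%:E * (G i t)%:E)%E = (\sum_(i < n) c i * G i t)%:E.
        by rewrite -sumEFin.
      rewrite -EFinD lee_fin.
      have := HQ n (fun i => a i) (fun i => (x i : R -> K) t) r r0 a1.
      have -> : 2 ^+ n * (Q + Q * \sum_(i < n) modulus (a i) ^+ 2 *
            F (modulus ((x i : R -> K) t) / r)) =
          2 ^+ n * Q + \sum_(i < n) c i * G i t.
        rewrite mulrDr mulrA mulr_sumr; congr (_ + _).
        by apply: eq_bigr => i _; rewrite /c !mulrA.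
      apply: le_trans; rewrite le_eqVlt; apply/orP; left; apply/eqP.
      apply: eq_bigr => g _; rewrite /W lincomb_fun; congr (F (modulus _ / _)).
      by apply: eq_bigr => i _; rewrite sgE mulrA.
  have MS : measurable_fun D (fun t => \sum_(i < n) (c i)%:E * (G i t)%:E)%E.
    exact: emeasurable_sum.
  have S0 t : (0 <= \sum_(i < n) (c i)%:E * (G i t)%:E)%E.
    by apply: sume_ge0 => i _; rewrite mule_ge0// lee_fin.
  rewrite ge0_integralD// integral_cst_unitI ge0_integral_sum//; last first.
    by move=> i t _; rewrite mule_ge0// lee_fin.
  apply: (@le_trans _ _ ((2 ^+ n * Q)%:E + \sum_(i < n) (c i)%:E)%E).
    apply: leeD2l; apply: lee_sum => i _.
    rewrite ge0_integralZl//; last 2 first.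
    - exact: MG.
    - by move=> t _; rewrite lee_fin.
    by rewrite -[leRHS]mule1; apply: lee_wpmul2l; [exact: c0|exact: intG].
  rewrite sumEFin -EFinD lee_fin card_ffun card_bool card_ord natrX.
  rewrite /c -mulr_sumr -[X in X + _]mulr1 -mulrDr -mulrA ler_pM2l ?exprn_gt0//.
  by rewrite mulrC ler_pM2r//; lra.
have [g Hg] := exists_le_average [ffun=> false] sumI.
exists (sg g).
have Q1 : 1 <= 2 * Q + 1 by rewrite lerDr mulr_ge0// ltW.
have Qp : 0 < 2 * Q + 1 by exact: lt_le_trans Q1.
rewrite -lee_fin -(vnormE bX (cl g)); apply: LF_norm_le.
  by rewrite !mulr_gt0.
have -> : (fun t => modulus ((lincomb x (fun i => (-1) ^+ sg g i * a i) n : R -> K) t) /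
     (4 * (2 * Q + 1) * r)) = (fun t => (2 * Q + 1)^-1 * W g t).
  by apply/funext => t; rewrite /W; field; rewrite !gt_eqF.
have l01 : 0 <= (2 * Q + 1)^-1 <= 1 by rewrite invr_ge0 (ltW Qp)/= invf_le1.
apply: (le_trans (modular_scale oF l01 (W0 g) (mW g))).
apply: (@le_trans _ _ ((2 * Q + 1)^-1%:E * (2 * Q + 1)%:E)%E).
  by apply: lee_wpmul2l; [rewrite lee_fin invr_ge0 ltW|exact: Hg].
by rewrite -EFinM mulVf ?gt_eqF.
Qed.

(** Unconditionality carries the estimate from one choice of signs to all of
    them. *)
Lemma upper_2_estimate (x : nat -> X) (B : R) : basic x -> unconditional x ->
  (forall n, nrm (x n) <= B) ->
  exists2 C, 0 < C & forall a n,
    nrm (lincomb x a n) <= C * Num.sqrt (\sum_(i < n) modulus (a i) ^+ 2).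
Proof.
move=> bx ux xB; have [cx _] := bx.
have [U U0 HU] := sign_unconditional bX bx ux.
have [Q Q0 HQ] := type2_signs.
have B0 : 0 <= B by apply: le_trans (xB 0%N); exact: nrm_ge0.
have B1 : 0 < B + 1 by rewrite ltr_wpDl.
exists (U * (Q * (B + 1)) + 1).
  by rewrite ltr_wpDl// mulr_ge0// mulr_ge0// ltW.
move=> a n; set S := \sum_(i < n) _.
have S0 : 0 <= S by apply: sumr_ge0 => i _; rewrite sqr_ge0.
have [S00|S00] := eqVneq S 0.
  rewrite /lincomb big1 ?(nrm0 bX) ?mulr_ge0 ?sqrtr_ge0//.
    by rewrite addr_ge0// mulr_ge0// mulr_ge0// ltW.
  move=> i _; rewrite (@modulus_eq0 _ _ (a i)) ?scale0r//.
  apply/eqP; rewrite -sqrf_eq0; apply/eqP; apply: le_anti.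
  rewrite sqr_ge0 andbT -S00 /S (bigD1 i)//= lerDl.
  by apply: sumr_ge0 => j _; rewrite sqr_ge0.
have Sp : 0 < S by rewrite lt_neqAle eq_sym S00.
pose q := Num.sqrt S; have q0 : 0 < q by rewrite sqrtr_gt0.
have q2 : q ^+ 2 = S by rewrite sqr_sqrtr.
have mq : modulus (ofR k q^-1) = q^-1.
  by rewrite ofR_modulus gtr0_norm// invr_gt0.
have [||s Hs] := HQ x n (fun i => ofR k q^-1 * a i) (B + 1) cx B1.
- by move=> i; apply: (le_lt_trans (xB i)); rewrite ltrDl.
- have -> : \sum_(i < n) modulus (ofR k q^-1 * a i) ^+ 2 = q^-1 ^+ 2 * S.
    by rewrite mulr_sumr; apply: eq_bigr => i _; rewrite modulusM mq exprMn.
  by rewrite -q2 -exprMn mulVf ?gt_eqF// expr1n.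
have [_ h] := HU (fun i => ofR k q^-1 * a i) s n.
have := le_trans h (ler_wpM2l U0 Hs).
have -> : lincomb x (fun i => ofR k q^-1 * a i) n = ofR k q^-1 *: lincomb x a n.
  by rewrite /lincomb scaler_sumr; apply: eq_bigr => i _; rewrite scalerA.
rewrite (nrmZ bX) ?mq; last exact: carrier_lincomb.
rewrite ler_pdivrMl// => hh; apply: (le_trans hh).
by rewrite mulrC ler_pM2r// lerDl.
Qed.

(** This is [square_bound], integrated. *)
Lemma L2_le_LF : exists2 C, 0 < C & forall (f : X) r, carrier X f -> nrm f < r ->
  (\int[mu]_(t in D) (modulus ((f : R -> K) t) ^+ 2)%:E <= (r ^+ 2 * C)%:E)%E.
Proof.
have [C C0 HC] := square_bound oF F1 iF.
exists (1 + C); first by rewrite addr_gt0.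
move=> f r cf fr; have [mf _] := cf.
have r0 : 0 < r by apply: le_lt_trans fr; exact: nrm_ge0.
have := @LF_norm_lt _ _ _ oF f r mf.
rewrite -[LF_norm _ _]/(vnorm f) (vnormE bX cf) lte_fin fr => /(_ isT)[_ h].
have mm : measurable_fun D (fun t => modulus ((f : R -> K) t)) by exact: measurable_modulus.
pose G t : R := F (modulus ((f : R -> K) t) / r).
have G0 t : 0 <= G t.
  by rewrite /G (orlicz_ge0 oF)// divr_ge0 ?modulus_ge0// ltW.
have MG : measurable_fun D (fun t => (G t)%:E).
  apply: (measurable_modular_integrand oF) => //; last exact: measurable_div.
  by move=> t; rewrite divr_ge0 ?modulus_ge0// ltW.
have c0 : (0 <= (r ^+ 2 * C)%:E)%E by rewrite lee_fin mulr_ge0 ?sqr_ge0// ltW.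
have r20 : (0 <= (r ^+ 2)%:E)%E by rewrite lee_fin sqr_ge0.
have MZ : measurable_fun D (fun t => ((r ^+ 2 * C)%:E * (G t)%:E)%E).
  by apply: emeasurableZ; exact/measurable_EFinP.
apply: (@le_trans _ _ (\int[mu]_(t in D) ((r ^+ 2)%:E + (r ^+ 2 * C)%:E * (G t)%:E))%E).
  apply: ge0_le_integral => //.
  - by move=> t _; rewrite lee_fin sqr_ge0.
  - by apply/measurable_EFinP; exact: measurable_funX.
  - by apply: emeasurable_funD; first exact: measurable_cst.
  - move=> t _; rewrite -EFinM -EFinD lee_fin.
    apply: (le_trans (HC _ _ r0 (modulus_ge0 _))).
    by rewrite mulrDr mulr1 mulrA.
rewrite ge0_integralD//; last by move=> t _; rewrite mule_ge0// lee_fin.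
rewrite integral_cst_unitI ge0_integralZl//; last by move=> t _; rewrite lee_fin.
rewrite mulrDr mulr1 EFinD; apply: leeD2l; rewrite -[leRHS]mule1.
by apply: lee_wpmul2l; [exact: c0|exact: h].
Qed.

Lemma sqr_modulus_parallelogram (z w : K) :
  modulus (z + w) ^+ 2 + modulus (z - w) ^+ 2 =
  2 * modulus z ^+ 2 + 2 * modulus w ^+ 2.
Proof. by rewrite !sqr_modulus !reKD !imKD !reKN !imKN; ring. Qed.

(** Vectors are added one at a time. By the parallelogram law, the mean of the two
    squared norms for the two signs is the sum of the squared norms, hence the better
    sign loses nothing. *)
Lemma L2_signs (y : nat -> X) (a : nat -> K) (delta : R) n :
  (forall i, carrier X (y i)) -> 0 <= delta ->
  (forall i, (delta%:E <= \int[mu]_(t in D) (modulus ((y i : R -> K) t) ^+ 2)%:E)%E) ->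
  exists s : nat -> bool,
    ((delta * \sum_(i < n) modulus (a i) ^+ 2)%:E <=
     \int[mu]_(t in D) (modulus ((lincomb y (fun i => (-1) ^+ s i * a i) n : R -> K) t) ^+ 2)%:E)%E.
Proof.
move=> cy d0 Hy.
have sq (f : X) : carrier X f -> measurable_fun D (fun t => (modulus ((f : R -> K) t) ^+ 2)%:E).
  move=> [mf _]; apply/measurable_EFinP; apply: measurable_funX.
  exact: measurable_modulus.
have sq0 (f : X) t : (0 <= (modulus ((f : R -> K) t) ^+ 2)%:E)%E by rewrite lee_fin sqr_ge0.
elim: n => [|n [s Hs]].
  exists (fun=> false); rewrite big_ord0 mulr0.
  by apply: integral_ge0 => t _; exact: sq0.
pose S := lincomb y (fun i => (-1) ^+ s i * a i) n.
pose w := a n *: y n.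
have cS : carrier X S by exact: carrier_lincomb.
have cw : carrier X w by exact: carrierZ.
have cp : carrier X (S + w) by exact: carrierD.
have cm : carrier X (S - w) by exact: carrierB.
have Hw : ((delta * modulus (a n) ^+ 2)%:E <=
    \int[mu]_(t in D) (modulus ((w : R -> K) t) ^+ 2)%:E)%E.
  have -> : (fun t => (modulus ((w : R -> K) t) ^+ 2)%:E) =
      (fun t => (modulus (a n) ^+ 2)%:E * (modulus ((y n : R -> K) t) ^+ 2)%:E)%E.
    by apply/funext => t; rewrite -EFinM -exprMn -modulusM.
  have a2 : (0 <= (modulus (a n) ^+ 2)%:E)%E by rewrite lee_fin sqr_ge0.
  rewrite ge0_integralZl//; last exact: (sq _ (cy n)).
  rewrite mulrC EFinM; apply: lee_wpmul2l; last exact: Hy.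
  by rewrite lee_fin sqr_ge0.
have sumE : (\int[mu]_(t in D) (modulus ((S + w : R -> K) t) ^+ 2)%:E +
    \int[mu]_(t in D) (modulus ((S - w : R -> K) t) ^+ 2)%:E =
    2%:E * \int[mu]_(t in D) (modulus ((S : R -> K) t) ^+ 2)%:E +
    2%:E * \int[mu]_(t in D) (modulus ((w : R -> K) t) ^+ 2)%:E)%E.
  have mS := sq _ cS; have mw := sq _ cw; have mp := sq _ cp; have mm := sq _ cm.
  have dbl (f : X) : carrier X f ->
      measurable_fun D (fun t => (2%:E * (modulus ((f : R -> K) t) ^+ 2)%:E)%E) /\
      (2%:E * \int[mu]_(t in D) (modulus ((f : R -> K) t) ^+ 2)%:E =
       \int[mu]_(t in D) (2%:E * (modulus ((f : R -> K) t) ^+ 2)%:E))%E.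
    move=> cf; have mf := sq _ cf; split.
      by apply: emeasurableZ; exact/measurable_EFinP.
    by rewrite ge0_integralZl.
  have [dS ->] := dbl _ cS; have [dw ->] := dbl _ cw.
  have z2 (f : X) t : (0 <= 2%:E * (modulus ((f : R -> K) t) ^+ 2)%:E)%E.
    by rewrite mule_ge0// sq0.
  rewrite -ge0_integralD// -ge0_integralD//.
  apply: eq_integral => t _.
  by rewrite -!EFinM -!EFinD -sqr_modulus_parallelogram.
have [b Hb] : exists b : bool,
    ((delta * \sum_(i < n.+1) modulus (a i) ^+ 2)%:E <=
     \int[mu]_(t in D) (modulus ((S + (-1) ^+ b *: w : X) t : K) ^+ 2)%:E)%E.
  apply: contrapT => H.
  have lt_b (b : bool) : (\int[mu]_(t in D) (modulus ((S + (-1) ^+ b *: w : X) t : K) ^+ 2)%:E <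
      (delta * \sum_(i < n.+1) modulus (a i) ^+ 2)%:E)%E.
    by rewrite ltNge; apply/negP => h; apply: H; exists b.
  have := lteD (lt_b false) (lt_b true).
  rewrite expr0 expr1 scale1r scaleN1r sumE.
  rewrite ltNge => /negP; apply.
  apply: (@le_trans _ _ (2%:E * (delta * \sum_(i < n) modulus (a i) ^+ 2)%:E +
     2%:E * (delta * modulus (a n) ^+ 2)%:E)%E).
    rewrite -!EFinM -!EFinD lee_fin big_ord_recr/= mulrDr; lra.
  by apply: leeD; apply: lee_wpmul2l.
exists (fun i => if i == n then b else s i).
rewrite (_ : lincomb _ _ n.+1 = S + (-1) ^+ b *: w)//.
rewrite lincombS eqxx /w scalerA; congr (_ + _).
by apply: eq_lincomb => i ni; rewrite ltn_eqF.
Qed.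

(** The lower estimate is obtained for the tail x_N, x_(N+1), ... with suitable
    signs; spreading and unconditionality carry it over to x. *)
Lemma equivalent_l2 (x : nat -> X) (delta : R) (N : nat) :
  subsymmetric_basic x -> 0 < delta ->
  (forall n, (N <= n)%N ->
    (delta%:E <= \int[mu]_(t in D) (modulus ((x n : R -> K) t) ^+ 2)%:E)%E) ->
  equivalent x (@unit_vector R k : nat -> l2 R k).
Proof.
move=> [bx ux sx] d0 Hx; have [cx _] := bx.
have [m [M [B [m0 B0 xB _]]]] := subsymmetric_bounded bX bx sx.
have [C C0 HC] := upper_2_estimate bx ux xB.
have [U U0 HU] := sign_unconditional bX bx ux.
have hs : {homo (addn N) : i j / (i < j)%N} by move=> i j; rewrite ltn_add2l.
have [E E0 HE] := spreading_estimates bX cx sx hs.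
have [L L0 HL] := L2_le_LF.
pose c := Num.sqrt (delta / L).
have c0 : 0 < c by rewrite sqrtr_gt0 divr_gt0.
have lower (a : nat -> K) n : c * Num.sqrt (\sum_(i < n) modulus (a i) ^+ 2) <= E * (U * nrm (lincomb x a n)).
  have cy i : carrier X ((x \o addn N) i) by exact: cx.
  have Hy i : (delta%:E <= \int[mu]_(t in D) (modulus (((x \o addn N) i : R -> K) t) ^+ 2)%:E)%E.
    by apply: Hx; exact: leq_addr.
  have [s Hs] := L2_signs a n cy (ltW d0) Hy.
  have [h1 _] := HE (fun i => (-1) ^+ s i * a i) n.
  have [h2 _] := HU a s n.
  apply: (@le_trans _ _ (nrm (lincomb (x \o addn N) (fun i => (-1) ^+ s i * a i) n))); last first.
    by apply: (le_trans h1); rewrite ler_pM2l.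
  apply/ler_addgt0Pr => e e0.
  set y := lincomb _ _ _ in Hs *.
  have cl : carrier X y by exact: carrier_lincomb.
  have yr : nrm y < nrm y + e by rewrite ltrDl.
  have y0 : 0 <= nrm y + e by rewrite addr_ge0 ?nrm_ge0// ltW.
  have := le_trans Hs (HL y (nrm y + e) cl yr).
  rewrite lee_fin => h.
  rewrite -sqrtrM; last by rewrite divr_ge0// ltW.
  rewrite -[leRHS](ger0_norm y0) -sqrtr_sqr; apply: ler_wsqrtr.
  by rewrite mulrAC ler_pdivrMr.
have EU : 0 < C + E * U / c by rewrite ltr_wpDr// divr_ge0 ?mulr_ge0// ltW.
apply: (equivalent_unit_vector bX (C := C + E * U / c) (@l2_solid_fatou R k) bx EU).
- move=> a n; rewrite l2_norm_head lee_fin.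
  apply: (@le_trans _ _ (E * U / c * nrm (lincomb x a n))).
    by rewrite mulrAC ler_pdivlMr// mulrC -mulrA.
  by rewrite ler_wpM2r ?nrm_ge0// lerDr ltW.
- move=> a n; rewrite l2_norm_head -EFinM lee_fin; apply: (le_trans (HC a n)).
  by rewrite ler_wpM2r ?sqrtr_ge0// lerDl divr_ge0 ?mulr_ge0// ltW.
Qed.

End TypeTwo.

(** * Extraction of almost disjoint subsequences *)

Section Splitting.
Variables (R : realType) (k : scalars).
Local Notation K := (scalar_field R k).
Variables (F : R -> R) (oF : orlicz (EFin \o F)).
Variables (dF : doubling_near_infinity F).
Local Notation D := (unitI R).
Local Notation mu := (@lebesgue_measure R).
Local Notation X := (LF k (EFin \o F)).

Let F1 := doubling_F1 dF.
Let bX : banach X := LF_banach k oF F1.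

(** The band projection of a function to the set [E]. *)
Definition restr (E : set R) (f : R -> K) : R -> K :=
  fun t => if t \in E then f t else 0.

Definition above (f : R -> K) (V : R) : set R :=
  D `&` (fun t => modulus (f t)) @^-1` [set` `]V, +oo[].

Lemma in_above f V t : above f V t <-> D t /\ V < modulus (f t).
Proof.
split=> [[Dt]|[Dt h]]; first by rewrite /= in_itv/= andbT.
by split=> //; rewrite /= in_itv/= andbT.
Qed.

Lemma measurable_restr (E : set R) (f : R -> K) : measurable E ->
  scalar_measurable D f -> scalar_measurable D (restr E f).
Proof.
move=> mE /scalar_measurableE[mr mi]; apply/scalar_measurableE.
have aux (h : R -> R) : measurable_fun D h ->
    measurable_fun D (fun t => if t \in E then h t else 0).
  move=> mh; have -> : (fun t => if t \in E then h t else 0) = (fun t => \1_E t * h t).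
    by apply/funext => t; rewrite indicE; case: ifP => _; rewrite ?mul1r ?mul0r.
  apply: measurable_funM => //; exact: measurable_indic.
split.
- rewrite (_ : (fun x => _) = (fun t => if t \in E then reK (f t) else 0)).
    exact: aux.
  by apply/funext => t; rewrite /restr; case: ifP => // _; exact: reK0.
- rewrite (_ : (fun x => _) = (fun t => if t \in E then imK (f t) else 0)).
    exact: aux.
  by apply/funext => t; rewrite /restr; case: ifP => // _; exact: imK0.
Qed.

Lemma carrier_restr (E : set R) (f : X) : measurable E -> carrier X f ->
  carrier X (restr E f : X) /\ nrm (restr E f : X) <= nrm f.
Proof.
move=> mE [mf ff]; have mr := measurable_restr mE mf.
have le : (LF_norm (EFin \o F) (restr E f) <= LF_norm (EFin \o F) f)%E.
  apply: (LF_norm_mono oF) => // t _; rewrite /restr; case: ifP => // _.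
  by rewrite modulus0 modulus_ge0.
have cr : carrier X (restr E f : X) by split => //; exact: le_lt_trans ff.
split=> //; have cf : carrier X f by split.
by rewrite -lee_fin -(vnormE bX cr) -(vnormE bX cf).
Qed.

Lemma measurable_above (f : R -> K) V : scalar_measurable D f -> measurable (above f V).
Proof.
move=> mf; have mm := measurable_modulus (@measurable_unitI R) mf.
by apply: mm => //; exact: measurable_itv.
Qed.

Lemma measurable_sq (f : R -> K) : scalar_measurable D f ->
  measurable_fun D (fun t => (modulus (f t) ^+ 2)%:E).
Proof.
move=> mf; apply/measurable_EFinP; apply: measurable_funX.
exact: measurable_modulus.
Qed.

Lemma chebyshev_above (f : R -> K) (V : R) : 0 < V -> scalar_measurable D f ->
  ((V ^+ 2)%:E * mu (above f V) <= \int[mu]_(t in D) (modulus (f t) ^+ 2)%:E)%E.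
Proof.
move=> V0 mf; have mA := measurable_above V mf.
have -> : ((V ^+ 2)%:E * mu (above f V) = \int[mu]_(t in above f V) (V ^+ 2)%:E)%E.
  by rewrite integral_cst.
apply: (@le_trans _ _ (\int[mu]_(t in above f V) (modulus (f t) ^+ 2)%:E)%E).
  apply: ge0_le_integral => //.
  - by move=> t _; rewrite lee_fin sqr_ge0.
  - apply: measurable_funS (measurable_sq mf) => //.
    by move=> t /in_above[].
  - move=> t /in_above[_ h]; rewrite lee_fin lerXn2r ?nnegrE ?modulus_ge0// ltW//.
apply: ge0_subset_integral => //.
- exact: measurable_sq.
- by move=> t _; rewrite lee_fin sqr_ge0.
- by move=> t /in_above[].
Qed.

(** Where |f| <= M, convexity makes F(|f| / eta) at most c |f|, which is at most
    c (tau + |f|^2 / tau) for every tau. *)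
Lemma low_part_small (M eta : R) : 0 < M -> 0 < eta -> exists2 delta, 0 < delta &
  forall f : X, carrier X f ->
    (\int[mu]_(t in D) (modulus ((f : R -> K) t) ^+ 2)%:E <= delta%:E)%E ->
    (modular F (fun t => modulus (restr (~` above f M) f t) / eta)%R <= (2^-1)%:E)%E.
Proof.
move=> M0 eta0.
have FM : 0 <= F (M / eta) by rewrite (orlicz_ge0 oF)// divr_ge0// ltW.
have [c c0 Hc] : exists2 c, 0 < c & F (M / eta) / M <= c.
  exists (F (M / eta) / M + 1); last by rewrite lerDl.
  by rewrite ltr_wpDl// divr_ge0// ltW.
pose tau := (4 * c)^-1; have tau0 : 0 < tau by rewrite invr_gt0 mulr_gt0.
exists (tau / (4 * c)); first by rewrite divr_gt0// mulr_gt0.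
move=> f [mf _] f2.
have mA := measurable_above M mf.
have mr := measurable_restr (measurableC mA) mf.
have mm := measurable_modulus (@measurable_unitI R) mr.
have w0 t : 0 <= modulus (restr (~` above f M) f t) / eta.
  by rewrite divr_ge0 ?modulus_ge0// ltW.
have e1 : (0 <= (c / tau)%:E)%E by rewrite lee_fin divr_ge0// ltW.
have sq0 t : (0 <= (modulus ((f : R -> K) t) ^+ 2)%:E)%E by rewrite lee_fin sqr_ge0.
have e2 : (0 <= (c * tau)%:E)%E by rewrite lee_fin mulr_ge0// ltW.
have msq := measurable_sq mf.
have mZ : measurable_fun D (fun t => (c / tau)%:E * (modulus ((f : R -> K) t) ^+ 2)%:E)%E.
  by apply: emeasurableZ; exact/measurable_EFinP.
apply: (@le_trans _ _ (\int[mu]_(t in D)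
   ((c * tau)%:E + (c / tau)%:E * (modulus ((f : R -> K) t) ^+ 2)%:E))%E).
  apply: ge0_le_integral => //.
  - by move=> t _; rewrite lee_fin (orlicz_ge0 oF).
  - by apply: (measurable_modular_integrand oF) => //; exact: measurable_div.
  - by apply: emeasurable_funD => //; exact: measurable_cst.
  - move=> t Dt; rewrite -EFinM -EFinD lee_fin.
    have rhs0 : 0 <= c * tau + c / tau * modulus ((f : R -> K) t) ^+ 2.
      by rewrite addr_ge0// mulr_ge0 ?sqr_ge0// ?divr_ge0// ltW.
    rewrite {1}/restr; case: ifPn => [|_]; last by rewrite modulus0 mul0r (orlicz0 oF).
    rewrite in_setE => /in_above h.
    have {h} : modulus ((f : R -> K) t) <= M.
      by rewrite leNgt; apply/negP => h'; apply: h.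
    have := modulus_ge0 ((f : R -> K) t).
    move: (modulus _) => u u0 uM.
    have l01 : 0 <= u / M <= 1 by rewrite divr_ge0 ?(ltW M0)//= ler_pdivrMr// mul1r.
    have Me0 : 0 <= M / eta by rewrite divr_ge0// ltW.
    have := orlicz_scale oF l01 Me0.
    have -> : u / M * (M / eta) = u / eta by field; rewrite !gt_eqF.
    move=> h; apply: (le_trans h).
    have -> : u / M * F (M / eta) = F (M / eta) / M * u by ring.
    apply: (@le_trans _ _ (c * u)); first by rewrite ler_wpM2r.
    have -> : c * tau + c / tau * u ^+ 2 = c * (tau + u ^+ 2 / tau) by ring.
    rewrite ler_pM2l//.
    have [ut|/ltW tu] := leP u tau; first by rewrite ler_wpDr// divr_ge0 ?sqr_ge0// ltW.
    apply: ler_wpDl; first exact: ltW.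
    by rewrite ler_pdivlMr// expr2 ler_wpM2l.
rewrite ge0_integralD//; last by move=> t _; rewrite mule_ge0.
rewrite integral_cst_unitI ge0_integralZl//.
apply: (@le_trans _ _ ((c * tau)%:E + (c / tau)%:E * (tau / (4 * c))%:E)%E).
  by apply: leeD2l; apply: lee_wpmul2l.
rewrite -EFinM -EFinD lee_fin le_eqVlt; apply/orP; left; apply/eqP.
by rewrite /tau; field; rewrite gt_eqF.
Qed.

(** Doubling makes every dilate of an element of L_F have finite modular, which a
    finite norm asserts for one dilate only. *)
Lemma modular_dilate_fin (f : X) (eta : R) : carrier X f -> 0 < eta ->
  (modular F (fun t => modulus ((f : R -> K) t) / eta)%R < +oo)%E.
Proof.
move=> cf eta0; have [mf _] := cf.
have [E E1 HE] := doubling_growth oF dF.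
pose r := nrm f + 1.
have r0 : 0 < r by rewrite ltr_wpDl// nrm_ge0.
have := @LF_norm_lt _ _ _ oF f r mf.
rewrite -[LF_norm _ _]/(vnorm f) (vnormE bX cf) lte_fin ltrDl ltr01 => /(_ isT)[_ h].
have [j hj] : exists j, r / eta <= 2 ^+ j.
  have [j hj] := exists_nat_ge (r / eta); exists j; apply: (le_trans hj).
  by rewrite -natrX ler_nat ltnW// ltn_expl.
have mm := measurable_modulus (@measurable_unitI R) mf.
have w0 t : 0 <= modulus ((f : R -> K) t) / r by rewrite divr_ge0 ?modulus_ge0// ltW.
have mG : measurable_fun D (fun t => (F (modulus ((f : R -> K) t) / r))%:E).
  by apply: (measurable_modular_integrand oF) => //; exact: measurable_div.
have mZ : measurable_fun D (fun t => (E ^+ j)%:E * (F (modulus ((f : R -> K) t) / r))%:E)%E.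
  by apply: emeasurableZ; exact/measurable_EFinP.
have E0 : 0 <= E ^+ j by rewrite exprn_ge0// (le_trans _ E1).
have G0 t : (0 <= (F (modulus ((f : R -> K) t) / r))%:E)%E by rewrite lee_fin (orlicz_ge0 oF).
have F20 : 0 <= F (2 ^+ j) by rewrite (orlicz_ge0 oF)// exprn_ge0.
apply: (@le_lt_trans _ _ (\int[mu]_(t in D) ((F (2 ^+ j))%:E +
    (E ^+ j)%:E * (F (modulus ((f : R -> K) t) / r))%:E))%E).
  apply: ge0_le_integral => //.
  - by move=> t _; rewrite lee_fin (orlicz_ge0 oF)// divr_ge0 ?modulus_ge0// ltW.
  - apply: (measurable_modular_integrand oF); last exact: measurable_div.
    by move=> t; rewrite divr_ge0 ?modulus_ge0// ltW.
  - by apply: emeasurable_funD => //; exact: measurable_cst.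
  - move=> t _; rewrite -EFinM -EFinD lee_fin.
    have := w0 t; have := modulus_ge0 ((f : R -> K) t); move: (modulus _) => u u0 ur0.
    apply: (@le_trans _ _ (F (2 ^+ j * (u / r)))).
      apply: (orlicz_mono oF); first by rewrite divr_ge0// ltW.
      have -> : u / eta = r / eta * (u / r) by field; rewrite !gt_eqF.
      by rewrite ler_wpM2r.
    have [ur|/ltW ur] := leP (u / r) 1.
      apply: ler_wpDr; first by rewrite mulr_ge0// (orlicz_ge0 oF).
      apply: (orlicz_mono oF); first by rewrite mulr_ge0// exprn_ge0.
      by rewrite ler_piMr// exprn_ge0.
    by apply: ler_wpDl => //; exact: HE.
rewrite ge0_integralD//; last by move=> t _; rewrite mule_ge0// lee_fin.
rewrite integral_cst_unitI ge0_integralZl//.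
apply: (@le_lt_trans _ _ ((F (2 ^+ j))%:E + (E ^+ j)%:E * 1)%E).
  by apply: leeD2l; apply: lee_wpmul2l; [rewrite lee_fin|exact: h].
by rewrite mule1 -EFinD ltry.
Qed.

(** Absolute continuity of the integral of a dilate, finite by
    [modular_dilate_fin]. *)
Lemma small_set_part (f : X) (eta : R) : carrier X f -> 0 < eta ->
  exists2 delta, 0 < delta & forall Z : set R, measurable Z -> Z `<=` D ->
    (mu Z <= delta%:E)%E ->
    (modular F (fun t => modulus (restr Z f t) / eta)%R <= (2^-1)%:E)%E.
Proof.
move=> cf eta0; have [mf _] := cf.
have fin := modular_dilate_fin cf eta0.
have mm := measurable_modulus (@measurable_unitI R) mf.
have w0 t : 0 <= modulus ((f : R -> K) t) / eta by rewrite divr_ge0 ?modulus_ge0// ltW.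
pose h t : R := F (modulus ((f : R -> K) t) / eta).
have h0 t : 0 <= h t by rewrite /h (orlicz_ge0 oF).
have mh : measurable_fun D (fun t => (h t)%:E).
  by apply: (measurable_modular_integrand oF) => //; exact: measurable_div.
have iT : @integrable _ (measurableTypeR R) R mu setT (EFin \o (fun t => \1_D t * h t)).
  rewrite (_ : EFin \o _ = (EFin \o h) \_ D); last first.
    apply/funext => t; rewrite patchE /= indicE; case: ifP => _; by rewrite ?mul1r ?mul0r.

  apply: (@integrable_mkcond _ (measurableTypeR R) R
    (@lebesgue_measure R : {measure set (measurableTypeR R) -> \bar R})
    D (EFin \o h) (@measurable_unitI R)).1.
  apply/integrableP; split => //.
  apply: le_lt_trans fin; rewrite le_eqVlt; apply/orP; left; apply/eqP.
  by apply: eq_integral => t _; rewrite /= ger0_norm.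
have [|d [d0 Hd]] := integral_normr_continuous iT (e := 2^-1); first by rewrite invr_gt0.
exists (d / 2); first by rewrite divr_gt0.
move=> Z mZ ZD muZ.
have /(Hd Z mZ) : (mu Z < d%:E)%E.
  by apply: (le_lt_trans muZ); rewrite lte_fin; lra.
have -> : modular F (fun t => modulus (restr Z f t) / eta) = (\int[mu]_(t in Z) (h t)%:E)%E.
  rewrite /modular [RHS]integral_mkcond [LHS]integral_mkcond; apply: eq_integral => t _.
  rewrite !patchE /restr; case: ifPn => [tD|tD]; case: ifPn => [tZ|tZ] //.
  - by rewrite modulus0 mul0r (orlicz0 oF).
  - by exfalso; move: tD; rewrite notin_setE; apply; apply: ZD; rewrite -in_setE.
rewrite /Rintegral.
have -> : (\int[mu]_(x in Z) (`|\1_D x * h x|)%:E = \int[mu]_(t in Z) (h t)%:E)%E.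
  apply: eq_integral => t; rewrite in_setE => /ZD tD.
  by rewrite indicE mem_set// mul1r ger0_norm.
have finZ : (\int[mu]_(t in Z) (h t)%:E)%E \is a fin_num.
  rewrite ge0_fin_numE; last by apply: integral_ge0 => t _; rewrite lee_fin.
  apply: le_lt_trans fin; apply: ge0_subset_integral => //.
  by move=> t _; rewrite lee_fin.
by rewrite -{2}(fineK finZ) lee_fin => /ltW.
Qed.

End Splitting.

Section Disjointification.
Variables (R : realType) (k : scalars).
Local Notation K := (scalar_field R k).
Variables (F : R -> R) (oF : orlicz (EFin \o F)).
Variables (dF : doubling_near_infinity F).
Local Notation D := (unitI R).
Local Notation mu := (@lebesgue_measure R).
Local Notation X := (LF k (EFin \o F)).

Let F1 := doubling_F1 dF.
Let bX : banach X := LF_banach k oF F1.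

Lemma measure_bigcup_geometric (A : nat -> set R) (c : R) :
  (forall i, measurable (A i)) -> 0 <= c ->
  (forall i, (mu (A i) <= (c * 2^-1 ^+ i)%:E)%E) ->
  (mu (\bigcup_i A i) <= (2 * c)%:E)%E.
Proof.
move=> mA c0 HA.
apply: (@le_trans _ _ (\sum_(0 <= i <oo) mu (A i))%E).
  apply: (measure_sigma_subadditive (@lebesgue_measure R :
    {measure set (measurableTypeR R) -> \bar R})) => //.
  exact: bigcupT_measurable.
apply: lime_le; first exact: is_cvg_nneseries.
apply: nearW => n; apply: (@le_trans _ _ (\sum_(0 <= i < n) (c * 2^-1 ^+ i)%:E)%E).
  by apply: lee_sum => i _; exact: HA.
rewrite sumEFin lee_fin.
suff -> : \sum_(0 <= i < n) c * 2^-1 ^+ i = 2 * c - 2 * c * 2^-1 ^+ n.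
  by rewrite gerBl !mulr_ge0// exprn_ge0// invr_ge0.
elim: n => [|n IH]; first by rewrite big_nil expr0 mulr1 subrr.
by rewrite big_nat_recr//= IH exprS; field.
Qed.

(** Two modulars of at most 1/2 add up to one of at most 1: removed are the part of
    f below V and its part on Z. *)
Lemma nrm_restrC_le (f : X) (V eta : R) (Z : set R) : carrier X f -> 0 < eta ->
  measurable Z -> Z `<=` D ->
  (modular F (fun t => modulus (restr (~` above f V) f t) / eta)%R <= (2^-1)%:E)%E ->
  (modular F (fun t => modulus (restr Z f t) / eta)%R <= (2^-1)%:E)%E ->
  nrm (f - (restr (above f V `\` Z) f : X) : X) <= eta.
Proof.
move=> cf eta0 mZ ZD h1 h2; have [mf _] := cf.
have mA := measurable_above V mf.
have mB : measurable (above f V `\` Z) by exact: measurableD.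
have [cB _] := carrier_restr oF dF mB cf.
have cg : carrier X (f - (restr (above f V `\` Z) f : X)) by exact: carrierB.
rewrite -lee_fin -(vnormE bX cg); apply: LF_norm_le => //.
have m1 : measurable_fun D (fun t => modulus (restr (~` above f V) f t) / eta).
  apply: measurable_div; apply: measurable_modulus => //.
  by apply: measurable_restr => //; exact: measurableC.
have m2 : measurable_fun D (fun t => modulus (restr Z f t) / eta).
  by apply: measurable_div; apply: measurable_modulus => //; exact: measurable_restr.
have [mg _] := cg.
have m3 := measurable_div eta (measurable_modulus (@measurable_unitI R) mg).
have pos (z : K) : 0 <= modulus z / eta by rewrite divr_ge0 ?modulus_ge0// ltW.
have M1 := measurable_modular_integrand oF (fun t => pos _) m1.
have M2 := measurable_modular_integrand oF (fun t => pos _) m2.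
have M3 := measurable_modular_integrand oF (fun t => pos _) m3.
have Fpos (z : K) : 0 <= F (modulus z / eta) by rewrite (orlicz_ge0 oF).
apply: (@le_trans _ _ ((2^-1)%:E + (2^-1)%:E)%E); last first.
  by rewrite -EFinD lee_fin; lra.
apply: le_trans (leeD h1 h2).
rewrite /modular -ge0_integralD//; try by move=> t _; rewrite lee_fin Fpos.
apply: ge0_le_integral => //.
- by move=> t _; rewrite lee_fin Fpos.
- exact: emeasurable_funD.
move=> t Dt; rewrite -EFinD lee_fin.
have [tB|tB] := pselect ((above f V `\` Z) t).
  have -> : (f - (restr (above f V `\` Z) f : X) : R -> K) t = 0.
    have -> : (f - (restr (above f V `\` Z) f : X) : R -> K) t =
      (f : R -> K) t - restr (above f V `\` Z) f t by [].
    by rewrite {1}/restr mem_set// subrr.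
  by rewrite modulus0 mul0r (orlicz0 oF) addr_ge0.
have -> : (f - (restr (above f V `\` Z) f : X) : R -> K) t = (f : R -> K) t.
  have -> : (f - (restr (above f V `\` Z) f : X) : R -> K) t =
    (f : R -> K) t - restr (above f V `\` Z) f t by [].
  by rewrite {1}/restr memNset// subr0.
have [tZ|tZ] := pselect (Z t).
  by rewrite {2}/restr mem_set// lerDr.
rewrite {1}/restr mem_set ?lerDl// => tA; exact: tB.
Qed.

(** The Kadec-Pelczynski method. As the L_2 norm of x_(s j) is tiny, the part of
    x_(s j) below the level V0 + j is negligible, while the set A_j where the function
    exceeds that level has tiny measure. Hence the earlier functions are also
    negligible on A_j, and B_j is A_j with all later A_i removed, and with the set
    where the function exceeds a large integer W_j removed too. *)
Lemma disjointification (x : nat -> X) (N0 V0 : nat) (eta : nat -> R) :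
  (forall n, carrier X (x n)) -> (forall j, 0 < eta j) -> (0 < V0)%N ->
  (forall (delta : R) N, 0 < delta -> exists2 n, (N <= n)%N &
    (\int[mu]_(t in D) (modulus ((x n : R -> K) t) ^+ 2)%:E <= delta%:E)%E) ->
  exists (s W : nat -> nat) (B : nat -> set R),
  [/\ {homo s : i j / (i < j)%N} /\ (forall j, (N0 <= s j)%N),
    forall j, measurable (B j) /\ B j `<=` D,
    forall j t, B j t -> (V0 + j)%:R < modulus ((x (s j) : R -> K) t) <= (W j)%:R,
    forall i j t, (i < j)%N -> B i t -> B j t -> False &
    forall j, nrm (x (s j) - (restr (B j) (x (s j)) : X) : X) <= eta j].
Proof.
move=> cx eta0 V00 small.
have mx n : scalar_measurable D (x n) by have [] := cx n.
have V1 j : 1 <= (V0 + j)%:R :> R by rewrite ler1n addn_gt0 V00.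
have Vp j : 0 < (V0 + j)%:R :> R by exact: lt_le_trans (V1 j).
have : forall j : nat, exists d : R, 0 < d /\
    forall f : X, carrier X f ->
    (\int[mu]_(t in D) (modulus ((f : R -> K) t) ^+ 2)%:E <= d%:E)%E ->
    (modular F (fun t => modulus (restr (~` above f (V0 + j)%:R) f t) / eta j)%R
      <= (2^-1)%:E)%E.
  by move=> j; have [d d0 Hd] := low_part_small k oF (Vp j) (eta0 j); exists d.
move=> /choice[dA HdA].
have : forall nj : nat * nat, exists d : R, 0 < d /\
    forall Z : set R, measurable Z -> Z `<=` D -> (mu Z <= d%:E)%E ->
    (modular F (fun t => modulus (restr Z (x nj.1) t) / eta nj.2)%R <= (2^-1)%:E)%E.
  move=> [n j]; have [d d0 Hd] := small_set_part oF dF (cx n) (eta0 j).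
  by exists d.
move=> /choice[dB HdB].
pose e2 n := (\int[mu]_(t in D) (modulus ((x n : R -> K) t) ^+ 2)%:E)%E.
have : forall p : nat * (nat * R), exists n, 0 < p.2.2 ->
    [/\ (p.2.1 <= n)%N, (e2 n <= (dA p.1)%:E)%E, (e2 n <= (p.2.2 / 4)%:E)%E &
      (e2 n <= 1)%E].
  move=> [j [N th]] /=; have [th0|th0] := ltP 0 th; last first.
    by exists 0%N.
  pose d := Num.min (dA j) (Num.min (th / 4) 1).
  have d0 : 0 < d.
    by rewrite !lt_min ltr01 divr_gt0// (HdA j).1.
  have [n Nn Hn] := small d N d0; exists n => _; split => //.
  - by apply: (le_trans Hn); rewrite lee_fin ge_min lexx.
  - by apply: (le_trans Hn); rewrite lee_fin !ge_min lexx !orbT.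
  - by apply: (le_trans Hn); rewrite lee_fin !ge_min lexx !orbT.
move=> /choice[f Hf].
(* The state consists of the index [s j] and of a tolerance: sets of that measure
   are negligible for the function with index [s j]. Tolerances at least halve,
   so that the measures of all later sets add up to at most the tolerance. *)
pose g := fix g j : nat * R := if j is i.+1 then
    let n := f (j, ((g i).1.+1, (g i).2)) in (n, Num.min ((g i).2 / 2) (dB (n, j)))
  else let n := f (0%N, (N0, 1)) in (n, dB (n, 0%N)).
have g0 j : 0 < (g j).2.
  elim: j => [|j IH] /=; first by have [] := HdB (f (0%N, (N0, 1)), 0%N).
  by rewrite lt_min divr_gt0//=; have [] := HdB (f (j.+1, ((g j).1.+1, (g j).2)), j.+1).
have gS j : [/\ ((g j).1 < (g j.+1).1)%N, (e2 (g j.+1).1 <= (dA j.+1)%:E)%E,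
    (e2 (g j.+1).1 <= ((g j).2 / 4)%:E)%E & (e2 (g j.+1).1 <= 1)%E].
  exact: (Hf (j.+1, ((g j).1.+1, (g j).2)) (g0 j)).
have gA j : (e2 (g j).1 <= (dA j)%:E)%E.
  case: j => [|j]; last by have [] := gS j.
  by have [] := Hf (0%N, (N0, 1)) ltr01.
have g1 j : (e2 (g j).1 <= 1)%E.
  case: j => [|j]; last by have [] := gS j.
  by have [] := Hf (0%N, (N0, 1)) ltr01.
have ghalf j : (g j.+1).2 <= (g j).2 / 2 by rewrite /= ge_min lexx.
have gB j : (g j).2 <= dB ((g j).1, j).
  by case: j => [|j] //=; rewrite ge_min lexx orbT.
have gpow j i : (g (j + i)%N).2 <= (g j).2 * 2^-1 ^+ i.
  elim: i => [|i IH]; first by rewrite addn0 expr0 mulr1.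
  rewrite addnS; apply: (le_trans (ghalf _)); rewrite exprS.
  by have := IH; lra.
pose s j := (g j).1.
have hs : {homo s : i j / (i < j)%N}.
  by apply: homo_ltn => [? ? ?|j]; [exact: ltn_trans|have [] := gS j].
have sN j : (N0 <= s j)%N.
  have h0 : (N0 <= s 0%N)%N by have [] := Hf (0%N, (N0, 1)) ltr01.
  case: j => // j; apply: (leq_trans h0); apply: ltnW; exact: hs.
have : forall j, exists W : nat, 2 / (g j).2 <= W%:R /\ (0 < W)%N.
  move=> j; have [W HW] := exists_nat_ge (2 / (g j).2); exists W; split => //.
  rewrite -(ltr0n R); apply: lt_le_trans HW; by rewrite divr_gt0.
move=> /choice[W HW].
pose A j := above (x (s j)) (V0 + j)%:R.
have mA j : measurable (A j) by exact: measurable_above.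
pose Z j := (\bigcup_i A (j.+1 + i)%N) `|` above (x (s j)) (W j)%:R.
have mZ j : measurable (Z j).
  apply: measurableU; last exact: measurable_above.
  by apply: bigcupT_measurable => i; exact: mA.
have ZD j : Z j `<=` D.
  by move=> t [[i _ /in_above[]]|/in_above[]].
have muZ j : (mu (Z j) <= (g j).2%:E)%E.
  apply: (@le_trans _ _ (((g j).2 / 2)%:E + ((g j).2 / 2)%:E)%E); last first.
    by rewrite -EFinD lee_fin; lra.
  apply: (@le_trans _ _ (mu (\bigcup_i A (j.+1 + i)%N) + mu (above (x (s j)) (W j)%:R))%E).
    apply: (measureU2 (@lebesgue_measure R :
      {measure set (measurableTypeR R) -> \bar R})).
      by apply: bigcupT_measurable => i; exact: mA.
    exact: measurable_above.
  apply: leeD.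
    have -> : (g j).2 / 2 = 2 * ((g j).2 / 4) by field.
    apply: measure_bigcup_geometric => //; first by rewrite divr_ge0// ltW.
    move=> i; rewrite addSn.
    have := chebyshev_above (Vp (j + i).+1) (mx (s (j + i).+1)).
    have [_ _ h _] := gS (j + i)%N => /le_trans /(_ h) {}h.
    apply: (@le_trans _ _ (((V0 + (j + i).+1)%:R ^+ 2)%:E * mu (A (j + i).+1))%E).
      by rewrite -[leLHS]mul1e; apply: lee_wpmul2r; rewrite ?lee_fin ?exprn_ege1.
    apply: (le_trans h); rewrite lee_fin mulrAC ler_pM2r ?invr_gt0//.
  have [hW Wp] := HW j.
  have Wp' : 0 < (W j)%:R :> R by rewrite ltr0n.
  have := chebyshev_above Wp' (mx (s j)) => /le_trans /(_ (g1 j)).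
  rewrite -lee_pdivlMl ?exprn_gt0// mule1 => h; apply: (le_trans h).
  rewrite lee_fin; apply: (@le_trans _ _ (W j)%:R^-1).
    rewrite lef_pV2 ?posrE ?exprn_gt0// expr2 ler_peMl ?ler0n// ler1n//.
  rewrite -[leRHS]invrK lef_pV2 ?posrE ?invr_gt0 ?divr_gt0//.
  by rewrite invf_div.
exists s, W, (fun j => A j `\` Z j); split.
- by split.
- move=> j; split; first exact: measurableD.
  by move=> t [/in_above[]].
- move=> j t [/in_above[Dt ->] /= nZ] /=.
  rewrite leNgt; apply/negP => h; apply: nZ; right; exact/in_above.
- move=> i j t ij [_ nZ] [At _]; apply: nZ; left.
  by exists (j - i.+1)%N => //; rewrite subnKC.
- move=> j; apply: nrm_restrC_le => //.
    by apply: (HdA j).2 => //; exact: gA.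
  apply: (HdB (s j, j)).2 => //; apply: (le_trans (muZ j)).
  by rewrite lee_fin; exact: gB.
Qed.

End Disjointification.

(** * Compactness of families of Lipschitz functions *)

Section Compactness.
Variable R : realType.

(** Tychonoff gives a cluster point rather than a subsequence, since the index set
    is uncountable; approximation on finite sets is all that the extraction of a
    uniformly convergent subsequence needs. *)
Lemma pointwise_cluster (h : nat -> R -> R) :
  (forall j t, 0 <= h j t <= 1) ->
  exists g : R -> R, forall (T : seq R) (e : R) (N : nat), 0 < e ->
    exists2 j, (N <= j)%N & forall t, t \in T -> `|h j t - g t| < e.
Proof.
move=> h01.
pose A (_ : R) : set R := [set` `[0%R, 1%R]].
have cA := @tychonoff R (fun _ : R => R : topologicalType) A
  (fun i => @segment_compact R 0 1).
have [|g [_ clg]] := cA (fmap h \oo) _.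
  by exists 0%N => // j _ t; rewrite /A /= in_itv/=; exact: h01.
exists g => T e N e0.
pose P := prod_topology (fun _ : R => R : topologicalType).
have nb : @nbhs P P g [set f : P | forall t, t \in T -> `|f t - g t| < e].
  elim: T => [|t T IH].
    rewrite (_ : [set f : P | _] = setT); first exact: (@filterT _ (@nbhs P P g)).
    by apply/seteqP; split.
  have nt : @nbhs P P g [set f : P | `|f t - g t| < e].
    have nU : nbhs (g t : R) [set y : R | `|y - g t| < e].
      by apply: filterS (nbhsx_ballx (g t : R) e e0) => y; rewrite /ball/= distrC.
    exact: (@proj_continuous R (fun _ => R : topologicalType) t g _ nU).
  apply: (@filterS2 _ (@nbhs P P g) _ _ _ _ _ nt IH) => f ft fT u.
  by rewrite inE => /orP[/eqP ->//|/fT].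
have [|_ [[j /= Nj <-]]] := clg (h @` [set j | (N <= j)%N]) _ _ nb.
  by exists N => // j Nj; exists j.
by move=> H; exists j.
Qed.

Definition lipschitz2 (h : R -> R) :=
  forall s t, 0 <= s -> s <= t -> t <= 2^-1 -> `|h t - h s| <= 2 * (t - s).

(** The argument of Ascoli and Arzela, with the grid of mesh 1/M as finite net. The
    prescribed rate makes the errors summable over the sequence. *)
Lemma uniform_subsequence (h : nat -> R -> R) :
  (forall j t, 0 <= t <= 2^-1 -> 0 <= h j t <= 1) ->
  (forall j, lipschitz2 (h j)) ->
  exists (g : R -> R) (l : nat -> nat), [/\ {homo l : i j / (i < j)%N}, lipschitz2 g &
    forall j t, 0 <= t <= 2^-1 -> `|h (l j) t - g t| <= 2^-1 ^+ j.+1].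
Proof.
move=> h01 hl.
(* The bounds hold on [0, 1/2] only, whereas compactness is used for functions on
   R. *)
pose h' j t := if 0 <= t <= 2^-1 then h j t else 0.
have [|g Hg] := @pointwise_cluster h'.
  by move=> j t; rewrite /h'; case: ifP => [/h01 //|_]; rewrite lexx ler01.
exists g.
have gl : lipschitz2 g.
  move=> s t s0 st t2; apply/ler_addgt0Pr => e e0.
  have [j _ Hj] := Hg [:: s; t] (e / 2) 0%N (divr_gt0 e0 (ltr0Sn _ 1)).
  have := Hj s; have := Hj t; rewrite !inE !eqxx orbT => /(_ isT) h1 /(_ isT) h2.
  move: h1 h2; rewrite /h' s0 t2 (le_trans s0 st) (le_trans st t2)/= => h1 h2.
  have h3 := hl j _ _ s0 st t2.
  have -> : g t - g s = - (h j t - g t) + (h j s - g s) + (h j t - h j s) by ring.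
  apply: (le_trans (ler_normD _ _)).
  have := ler_normD (- (h j t - g t)) (h j s - g s).
  rewrite normrN; lra.
suff [l hl' Hl] : exists2 l : nat -> nat, {homo l : i j / (i < j)%N} &
    forall j t, 0 <= t <= 2^-1 -> `|h (l j) t - g t| <= 2^-1 ^+ j.+1 by exists l.
apply: (increasing_sub (P := fun j n => forall t, 0 <= t <= 2^-1 ->
  `|h n t - g t| <= 2^-1 ^+ j.+1)) => j N.
pose e : R := 2^-1 ^+ j.+1.
have e0 : 0 < e by rewrite exprn_gt0// invr_gt0.
have [M HM] := exists_nat_ge (8 / e).
have M0 : 0 < M%:R :> R by apply: lt_le_trans HM; rewrite divr_gt0.
have Me : 4 / M%:R <= e / 2.
  by rewrite ler_pdivrMr// mulrC -ler_pdivrMr ?divr_gt0//;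
     apply: le_trans HM; rewrite le_eqVlt; apply/orP; left; apply/eqP; field; rewrite gt_eqF.
have [n Nn Hn] := Hg [seq i%:R / M%:R | i <- iota 0 M] (e / 2) N (divr_gt0 e0 (ltr0Sn _ 1)).
exists n => // t /andP[t0 t2].
pose i := Num.truncn (t * M%:R).
have tM0 : 0 <= t * M%:R by rewrite mulr_ge0// ltW.
have /andP[it ti] : i%:R <= t * M%:R < i.+1%:R by exact: truncn_itv.
pose s : R := i%:R / M%:R.
have st : s <= t by rewrite ler_pdivrMr.
have s0 : 0 <= s by rewrite divr_ge0// ltW.
have ts : t - s <= M%:R^-1.
  have : t < i.+1%:R / M%:R by rewrite ltr_pdivlMr.
  rewrite -natr1 mulrDl mul1r -/s; lra.
have iM : (i < M)%N.
  rewrite -(ltr_nat R); apply: (le_lt_trans it).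
  by rewrite gtr_pMl//; lra.
have sT : s \in [seq i%:R / M%:R | i <- iota 0 M].
  by apply/mapP; exists i => //; rewrite mem_iota add0n.
have := Hn _ sT; rewrite /h' s0 (le_trans st t2)/= => h1.
have h2 := hl n _ _ s0 st t2; have h3 := gl _ _ s0 st t2.
have -> : h n t - g t = (h n t - h n s) + (h n s - g s) - (g t - g s) by ring.
apply: (le_trans (ler_normB _ _)).
have := ler_normD (h n t - h n s) (h n s - g s).
rewrite -/e; move: Me; have -> : 4 / M%:R = 4 * M%:R^-1 :> R by [].
lra.
Qed.

End Compactness.

(** * Averages of dilates *)

Section Averages.
Variables (R : realType) (F : R -> R) (oF : orlicz (EFin \o F)).

(** Induction from binary convex combinations; summands of weight 0 must be set
    apart as the total weight of the remaining ones may vanish. *)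
Lemma convex_set_average (M : lmodType R) (A : set M) (r : seq nat)
    (w : nat -> R) (f : nat -> M) :
  convex_set A -> (forall v, v \in r -> 0 <= w v) -> (forall v, v \in r -> A (f v)) ->
  0 < \sum_(v <- r) w v -> A ((\sum_(v <- r) w v)^-1 *: (\sum_(v <- r) w v *: f v)).
Proof.
move=> cA; elim: r => [|v r IH] w0 fA; first by rewrite big_nil ltxx.
have w0' u : u \in r -> 0 <= w u by move=> ur; apply: w0; rewrite inE ur orbT.
have fA' u : u \in r -> A (f u) by move=> ur; apply: fA; rewrite inE ur orbT.
have wv : 0 <= w v by apply: w0; rewrite inE eqxx.
have S0 : 0 <= \sum_(u <- r) w u by rewrite big_seq sumr_ge0.
rewrite !big_cons => W0.
have [S00|S00] := eqVneq (\sum_(u <- r) w u) 0.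
  rewrite S00 addr0 in W0 *.
  have -> : \sum_(u <- r) w u *: f u = 0.
    move: S00; rewrite big_seq => /eqP; rewrite psumr_eq0// => /allP h.
    rewrite big_seq big1// => u ur; have := h u ur; rewrite ur /= => /eqP ->.
    by rewrite scale0r.
  by rewrite addr0 scalerA mulVf ?gt_eqF// scale1r; apply: fA; rewrite inE eqxx.
have {}S0 : 0 < \sum_(u <- r) w u by rewrite lt_neqAle eq_sym S00.
have IHr := IH w0' fA' S0.
set S := \sum_(u <- r) w u in W0 S0 IHr *; set T := \sum_(u <- r) _ in IHr *.
have l0 : 0 <= w v / (w v + S) by rewrite divr_ge0// ltW.
have l1 : w v / (w v + S) <= 1 by rewrite ler_pdivrMr// mul1r lerDl ltW.
have := cA (f v) (S^-1 *: T) (Itv01 l0 l1); rewrite !inE => /(_ _ IHr).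
have fv : A (f v) by apply: fA; rewrite inE eqxx.
move=> /(_ fv).
suff <- : conv (Itv01 l0 l1) (f v : convex_lmodType M) (S^-1 *: T : convex_lmodType M) =
    (w v + S)^-1 *: (w v *: f v + T) by [].
rewrite -[LHS]/((w v / (w v + S)) *: f v + (1 - w v / (w v + S)) *: (S^-1 *: T)).
rewrite scalerDr !scalerA; congr (_ *: _ + _ *: _); first by rewrite mulrC.
by field; rewrite !gt_eqF.
Qed.

(** This is the modular of t h, when h takes the integer value v on a set of measure
    [p v] and vanishes elsewhere. *)
Definition wsum (p : nat -> R) (V W : nat) (t : R) : R :=
  \sum_(V <= v < W) p v * F (t * v%:R).

Variables (p : nat -> R) (V W : nat) (p0 : forall v, 0 <= p v).

Let S := wsum p V W.

Lemma wsum0 : S 0 = 0.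
Proof. by rewrite /S /wsum big1// => v _; rewrite mul0r (orlicz0 oF) mulr0. Qed.

Lemma wsum_ge0 t : 0 <= t -> 0 <= S t.
Proof.
by move=> t0; apply: sumr_ge0 => v _; rewrite mulr_ge0// (orlicz_ge0 oF)// mulr_ge0.
Qed.

Lemma wsum_mono s t : 0 <= s -> s <= t -> S s <= S t.
Proof.
move=> s0 st; apply: ler_sum => v _; rewrite ler_wpM2l// (orlicz_mono oF)//.
  by rewrite mulr_ge0.
by rewrite ler_wpM2r.
Qed.

Lemma wsum_convex s t l : 0 <= s -> 0 <= t -> 0 <= l <= 1 ->
  S (l * s + (1 - l) * t) <= l * S s + (1 - l) * S t.
Proof.
move=> s0 t0 l01; rewrite /S /wsum !mulr_sumr -big_split/=; apply: ler_sum => v _.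
have sv : 0 <= s * v%:R by rewrite mulr_ge0.
have tv : 0 <= t * v%:R by rewrite mulr_ge0.
have := ler_wpM2l (p0 v) (orlicz_convex oF sv tv l01).
have -> : l * (s * v%:R) + (1 - l) * (t * v%:R) = (l * s + (1 - l) * t) * v%:R by ring.
move=> h; apply: (le_trans h); rewrite le_eqVlt; apply/orP; left; apply/eqP.
by ring.
Qed.

Lemma wsum_scale t l : 0 <= t -> 0 <= l <= 1 -> S (l * t) <= l * S t.
Proof.
move=> t0 l01; have := wsum_convex t0 (lexx 0) l01.
by rewrite !mulr0 !addr0 wsum0 mulr0 addr0.
Qed.

Hypothesis S1 : 0 < S 1.

Definition average (t : R) : R := wsum p V W t / wsum p V W 1.

Lemma average_eq1 : average 1 = 1.
Proof. by rewrite /average divff// gt_eqF. Qed.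

Lemma average_ge0 t : 0 <= t -> 0 <= average t.
Proof. by move=> t0; rewrite divr_ge0 ?(ltW S1)// wsum_ge0. Qed.

Lemma average_le1 t : 0 <= t <= 1 -> average t <= 1.
Proof.
by move=> /andP[t0 t1]; rewrite ler_pdivrMr// mul1r wsum_mono.
Qed.

Lemma average_convex s t l : 0 <= s -> 0 <= t -> 0 <= l <= 1 ->
  average (l * s + (1 - l) * t) <= l * average s + (1 - l) * average t.
Proof.
move=> s0 t0 l01; rewrite /average !mulrA -mulrDl ler_pM2r ?invr_gt0//.
exact: wsum_convex.
Qed.

Lemma average_scale t l : 0 <= t -> 0 <= l <= 1 -> average (l * t) <= l * average t.
Proof.
by move=> t0 l01; rewrite /average mulrA ler_pM2r ?invr_gt0// wsum_scale.
Qed.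

Lemma average_mono s t : 0 <= s -> s <= t -> average s <= average t.
Proof. by move=> s0 st; rewrite /average ler_pM2r ?invr_gt0// wsum_mono. Qed.

Lemma average_ge t : 1 <= t -> t <= average t.
Proof.
move=> t1; have t0 : 0 < t by exact: lt_le_trans t1.
have := @average_scale t t^-1 (ltW t0).
rewrite invr_ge0 (ltW t0) invf_le1// t1 mulVf ?gt_eqF// average_eq1 => /(_ isT).
by rewrite ler_pdivlMl// mulr1.
Qed.

(** The slope at s of a nonnegative convex function with value 1 at 1 is at most
    1 / (1 - s), which is at most 2 on [0, 1/2]. *)
Lemma average_lipschitz : lipschitz2 average.
Proof.
move=> s t s0 st t2; have t0 : 0 <= t by exact: le_trans st.
rewrite ger0_norm ?subr_ge0 ?average_mono//.
have s1 : 0 < 1 - s by lra.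
pose l := (1 - t) / (1 - s).
have l01 : 0 <= l <= 1.
  by rewrite divr_ge0 ?(ltW s1)//=; [rewrite ler_pdivrMr// mul1r; lra|lra].
have := average_convex s0 ler01 l01.
have -> : l * s + (1 - l) * 1 = t by rewrite /l; field; rewrite gt_eqF.
rewrite average_eq1 mulr1 => h.
have as0 := average_ge0 s0.
have l1 : 1 - l = (t - s) / (1 - s) by rewrite /l; field; rewrite gt_eqF.
have l2 : 1 - l <= 2 * (t - s) by rewrite l1 ler_pdivrMr//; nra.
have : 0 <= (1 - l) * average s by rewrite mulr_ge0// subr_ge0; case/andP: l01.
lra.
Qed.

(** The weights of the convex combination of the dilates F_v are [p v * F v],
    normalised. *)
Lemma average_hull (b : R) : (forall v, (V <= v)%N -> b < v%:R /\ 0 < F v%:R) ->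
  convex_hull [set dilate F s | s in [set s | b < s /\ 0 < F s]] average.
Proof.
move=> HV B [cB HB].
have SE : S 1 = \sum_(V <= v < W) p v * F v%:R.
  by apply: eq_bigr => v _; rewrite mul1r.
have W0 : 0 < \sum_(v <- index_iota V W) p v * F v%:R by rewrite -SE.
have memV v : v \in index_iota V W -> (V <= v)%N by rewrite mem_index_iota => /andP[].
have := @convex_set_average (R -> R^o) B (index_iota V W) (fun v => p v * F v%:R)
  (fun v => dilate F v%:R) cB _ _ W0.
have -> : (\sum_(v <- index_iota V W) p v * F v%:R)^-1 *:
    (\sum_(v <- index_iota V W) (p v * F v%:R) *: (dilate F v%:R : R -> R^o)) = average.
  apply/funext => t; rewrite /average -/S SE /wsum.
  have -> : ((\sum_(v <- index_iota V W) p v * F v%:R)^-1 *: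
     (\sum_(v <- index_iota V W) (p v * F v%:R) *: (dilate F v%:R : R -> R^o))) t =
     (\sum_(v <- index_iota V W) p v * F v%:R)^-1 *
     (\sum_(v <- index_iota V W) (p v * F v%:R) *: (dilate F v%:R : R -> R^o)) t by [].
  rewrite fct_sumE mulrC; congr (_ / _); apply: eq_big_seq => v /memV Vv.
  have [_ Fv] := HV v Vv.
  rewrite -[LHS]/(p v * F v%:R * (F (v%:R * t) / F v%:R)) (mulrC t).
  by field; rewrite gt_eqF.
apply.
  by move=> v /memV /HV[_ /ltW Fv]; rewrite mulr_ge0.
by move=> v /memV /HV Hv; apply: HB; exists v%:R.
Qed.

End Averages.

Section ClosureMembership.
Variables (R : realType) (F : R -> R).

(** [g] is controlled on [0, 1/2] only. Precomposed with the retraction of R onto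
    this interval it becomes continuous. *)
Lemma CF_uniform_limit (g : R -> R) : lipschitz2 g ->
  (forall (b e : R), 0 < e -> exists2 h : R -> R,
    convex_hull [set dilate F s | s in [set s | b < s /\ 0 < F s]] h &
    forall t, 0 <= t <= 2^-1 -> `|h t - g t| < e) ->
  exists2 g' : R -> R, CF F g' & forall t, 0 <= t <= 2^-1 -> g' t = g t.
Proof.
move=> gl Hg; pose cl (t : R) : R := if t <= 0 then 0 else if t <= 2^-1 then t else 2^-1.
have cl0 t : 0 <= cl t by rewrite /cl; case: (leP t 0) => // ?; case: (leP t 2^-1) => ?; lra.
have cl2 t : cl t <= 2^-1 by rewrite /cl; case: (leP t 0) => ?; [lra|case: (leP t 2^-1) => ?; lra].
have cl_mono s t : s <= t -> cl s <= cl t /\ cl t - cl s <= t - s.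
  rewrite /cl => st; case: (leP s 0) => s0; case: (leP t 0) => t0 //;
    case: (leP s 2^-1) => s2; case: (leP t 2^-1) => t2; split => //; lra.
have gE t : 0 <= t <= 2^-1 -> g (cl t) = g t.
  move=> /andP[t0 t2]; congr g; rewrite /cl t2; case: (leP t 0) => // t0'.
  by apply/eqP; rewrite eq_le t0 t0'.
exists (fun t => g (cl t)) => // b /= b0; split.
  apply: continuous_subspaceT => t.
  apply/cvgrPdist_lt => e e0.
  apply: filterS (nbhsx_ballx t (e / 2) (divr_gt0 e0 (ltr0Sn _ 1))) => s.
  rewrite /ball/= => ts.
  have [st|/ltW st] := leP s t.
    have [h1 h2] := cl_mono _ _ st.
    apply: (le_lt_trans (gl _ _ (cl0 s) h1 (cl2 t))).
    move: ts; rewrite ger0_norm ?subr_ge0//; lra.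
  have [h1 h2] := cl_mono _ _ st.
  rewrite distrC; apply: (le_lt_trans (gl _ _ (cl0 t) h1 (cl2 s))).
  move: ts; rewrite distrC ger0_norm ?subr_ge0//; lra.
move=> B /uniform_nbhs[E [entE EB]].
move: entE; rewrite -entourage_ballE => -[e /= e0 He].
have [h hh Hh] := Hg b e e0.
exists h; split => //; apply: EB => y /= yI; apply: He => /=.
by rewrite /ball/= gE// distrC; exact: Hh.
Qed.

End ClosureMembership.

Section Cells.
Variables (R : realType) (k : scalars).
Local Notation K := (scalar_field R k).
Variables (F : R -> R) (oF : orlicz (EFin \o F)).
Local Notation D := (unitI R).
Local Notation mu := (@lebesgue_measure R).

Variables (f : R -> K) (B : set R) (V W : nat).
Hypotheses (mf : scalar_measurable D f) (mB : measurable B) (BD : B `<=` D).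
Hypothesis VW : forall t, B t -> V%:R < modulus (f t) <= W%:R.

(** The part of [B] where |f| is rounded up to v + 1, or down to v. *)
Definition cell (v : nat) : set R :=
  (B `&` above f v%:R) `\` above f v.+1%:R.

Definition cell_weight (v : nat) : R := fine (mu (cell v)).

Lemma in_cell v t : cell v t <-> B t /\ v%:R < modulus (f t) <= v.+1%:R.
Proof.
split.
- move=> [[Bt /in_above[Dt h1]] h2]; split => //; rewrite h1 leNgt.
  by apply/negP => h; apply: h2; apply/in_above.
- move=> [Bt /andP[h1 h2]]; have Dt := BD Bt; split.
    by split => //; apply/in_above.
  by move=> /in_above[_]; rewrite ltNge h2.
Qed.

Lemma measurable_cell v : measurable (cell v).
Proof.
apply: measurableD; last exact: measurable_above.
by apply: measurableI => //; exact: measurable_above.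
Qed.

Lemma cell_weight_ge0 v : 0 <= cell_weight v.
Proof. by rewrite /cell_weight fine_ge0. Qed.

Lemma cell_weightE v : mu (cell v) = (cell_weight v)%:E.
Proof.
rewrite /cell_weight fineK// ge0_fin_numE//.
apply: (@le_lt_trans _ _ (mu D)); last by rewrite measure_unitI ltry.
apply: le_measure; rewrite ?inE; [exact: measurable_cell|by []|].
by move=> t /in_cell[/BD].
Qed.

Lemma integral_cells (c : nat -> R) : (forall v, 0 <= c v) ->
  (\int[mu]_(t in D) (\sum_(V <= v < W) c v * \1_(cell v) t)%:E =
   (\sum_(V <= v < W) c v * cell_weight v)%:E)%E.
Proof.
move=> c0.
have mI v : measurable_fun D (fun t => (\1_(cell v) t : R)%:E).
  by apply/measurable_EFinP; apply: measurable_indic; exact: measurable_cell.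
have mZ v : measurable_fun D (fun t => (c v)%:E * (\1_(cell v) t)%:E)%E.
  by apply: emeasurableZ; apply: measurable_indic; exact: measurable_cell.
have E0 v : (0 <= (c v)%:E)%E by rewrite lee_fin.
transitivity (\int[mu]_(t in D) (\sum_(V <= v < W) (c v)%:E * (\1_(cell v) t)%:E))%E.
  by apply: eq_integral => t _; rewrite -sumEFin.
rewrite ge0_integral_sum//; last by move=> v t _; rewrite mule_ge0.
rewrite -sumEFin; apply: eq_bigr => v _.
rewrite ge0_integralZl//; last exact: mI.
rewrite EFinM; congr (_ * _)%E.
rewrite integral_indic//; last exact: measurable_cell.
rewrite -cell_weightE; congr (mu _).
by apply: setIidl => t /in_cell[/BD].
Qed.

(** By [VW], the cells of index from V up to W - 1 cover B, and they are
    disjoint. *)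
Lemma sum_cells (c : nat -> R) t : B t -> exists2 v, (V <= v)%N /\ cell v t &
  \sum_(V <= u < W) c u * \1_(cell u) t = c v.
Proof.
move=> Bt; have /andP[h1 h2] := VW Bt.
have ex : exists v, modulus (f t) <= v.+1%:R.
  by exists W; apply: (le_trans h2); rewrite ler_nat.
case: (ex_minnP ex) => v hv vmin.
have vV : (V <= v)%N.
  rewrite leqNgt; apply/negP => h; move: (lt_le_trans h1 hv).
  by rewrite ltr_nat ltnS leqNgt h.
have vt : v%:R < modulus (f t).
  rewrite ltNge; apply/negP; case: v hv vmin vV => [|v] hv vmin vV h.
    by move: (lt_le_trans h1 h); rewrite ltr_nat.
  by have := vmin _ h; rewrite ltnn.
have cv : cell v t by apply/in_cell; rewrite vt hv.
have vW : (v < W)%N by rewrite -(ltr_nat R); exact: lt_le_trans h2.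
exists v => //.
rewrite (bigD1_seq v) ?iota_uniq ?mem_index_iota ?vV//=.
rewrite indicE mem_set// mulr1 big1 ?addr0// => u uv.
rewrite indicE memNset ?mulr0// => /in_cell[_ /andP[u1 u2]].
move: uv; rewrite eqn_leq negb_and -!ltnNge => /orP[vu|uv].
  have := lt_le_trans u1 hv; rewrite ltr_nat ltnS leqNgt vu //.
have := lt_le_trans vt u2; rewrite ltr_nat ltnS leqNgt uv //.
Qed.

Let restr_ge0 b t : 0 <= b -> 0 <= b * modulus (restr B f t).
Proof. by move=> b0; rewrite mulr_ge0 ?modulus_ge0. Qed.

Let measurable_brestr b : measurable_fun D (fun t => b * modulus (restr B f t)).
Proof.
apply: measurable_funM; first exact: measurable_cst.
by apply: measurable_modulus => //; exact: measurable_restr.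
Qed.

Let measurable_cells (c : nat -> R) :
  measurable_fun D (fun t => (\sum_(V <= v < W) c v * \1_(cell v) t)%:E).
Proof.
apply/measurable_EFinP; apply: measurable_sum => v.
apply: measurable_funM; first exact: measurable_cst.
by apply: measurable_indic; exact: measurable_cell.
Qed.

Lemma wsum_le_modular (b : R) : 0 <= b ->
  ((wsum F cell_weight V W b)%:E <= modular F (fun t => b * modulus (restr B f t))%R)%E.
Proof.
move=> b0; have c0 v : 0 <= F (b * v%:R) by rewrite (orlicz_ge0 oF)// mulr_ge0.
have -> : wsum F cell_weight V W b = \sum_(V <= v < W) F (b * v%:R) * cell_weight v.
  by apply: eq_bigr => v _; rewrite mulrC.
rewrite -integral_cells//; apply: ge0_le_integral => //.
- move=> t _; rewrite lee_fin sumr_ge0// => v _.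
  by rewrite mulr_ge0// indicE.
- exact: measurable_cells.
- apply: (measurable_modular_integrand oF); last exact: measurable_brestr.
  by move=> t; exact: restr_ge0.
- move=> t _; rewrite lee_fin; have [Bt|nBt] := pselect (B t).
    have [v [_ /in_cell[_ /andP[h _]]] ->] := sum_cells (fun v => F (b * v%:R)) Bt.
    apply: (orlicz_mono oF); first by rewrite mulr_ge0.
    by rewrite /restr mem_set// ler_wpM2l// ltW.
  rewrite big1 ?(orlicz_ge0 oF) ?restr_ge0// => v _.
  by rewrite indicE memNset ?mulr0// => /in_cell[].
Qed.

(** On the cell of index v, |f| <= v + 1 <= 2 v as v >= V >= 1. *)
Lemma modular_le_wsum (b : R) : 0 <= b -> (0 < V)%N ->
  (modular F (fun t => b * modulus (restr B f t))%R <= (wsum F cell_weight V W (2 * b))%:E)%E.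
Proof.
move=> b0 V0.
have c0 v : 0 <= F (2 * b * v%:R) by rewrite (orlicz_ge0 oF)// !mulr_ge0.
have -> : wsum F cell_weight V W (2 * b) = \sum_(V <= v < W) F (2 * b * v%:R) * cell_weight v.
  by apply: eq_bigr => v _; rewrite mulrC.
rewrite -integral_cells//; apply: ge0_le_integral => //.
- by move=> t _; rewrite lee_fin (orlicz_ge0 oF)// restr_ge0.
- apply: (measurable_modular_integrand oF); last exact: measurable_brestr.
  by move=> t; exact: restr_ge0.
- exact: measurable_cells.
- move=> t _; rewrite lee_fin; have [Bt|nBt] := pselect (B t).
    have [v [Vv /in_cell[_ /andP[_ h]]] ->] := sum_cells (fun v => F (2 * b * v%:R)) Bt.
    apply: (orlicz_mono oF); first exact: restr_ge0.
    rewrite /restr mem_set// mulrAC (mulrC _ b) ler_wpM2l//.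
    apply: (le_trans h); rewrite -natrM ler_nat.
    by rewrite mul2n -addnn -addn1 leq_add2l (leq_trans V0).
  rewrite /restr memNset// modulus0 mulr0 (orlicz0 oF) sumr_ge0// => v _.
  by rewrite mulr_ge0// indicE.
Qed.

End Cells.

(** * From averages to their limit *)

Section LimitFunction.
Variables (R : realType) (g : R -> R).

(** What survives in a limit on [0, 1/2] of averages. The last field is what makes
    the affine continuation increasing, with slope at least 1. *)
Record half_orlicz : Prop := HalfOrlicz {
  half_orlicz0 : g 0 = 0;
  half_orlicz_mono : forall s t, 0 <= s -> s <= t -> t <= 2^-1 -> g s <= g t;
  half_orlicz_scale : forall l t, 0 <= l <= 1 -> 0 <= t <= 2^-1 -> g (l * t) <= l * g t;
  half_orlicz_le : g 2^-1 <= 2^-1 }.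

Hypothesis hg : half_orlicz.

Lemma affine_extension_le t : t <= 2^-1 -> affine_extension g t = g t.
Proof. by rewrite /affine_extension => ->. Qed.

Lemma affine_extension0 : affine_extension g 0 = 0.
Proof. by rewrite affine_extension_le ?half_orlicz0. Qed.

Lemma affine_extension_mono s t : 0 <= s -> s <= t ->
  affine_extension g s <= affine_extension g t.
Proof.
move=> s0 st; have g2 := half_orlicz_le hg; rewrite /affine_extension.
case: (leP s 2^-1) => s2; case: (leP t 2^-1) => t2.
- exact: half_orlicz_mono.
- apply: (@le_trans _ _ (g 2^-1)); first exact: half_orlicz_mono.
  by rewrite lerDl mulr_ge0//; lra.
- lra.
- rewrite lerD2l ler_wpM2l//; lra.
Qed.

Lemma affine_extension_le1 t : affine_extension g t <= 1 -> t <= 1.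
Proof.
have g2 := half_orlicz_le hg; rewrite /affine_extension.
case: (leP t 2^-1) => t2 h; first lra.
nra.
Qed.

(** Halving the argument brings it into the interval where g is a limit of
    averages. *)
Lemma half_le_affine_extension t : 0 <= t -> t <= 1 -> g (t / 2) <= affine_extension g t.
Proof.
move=> t0 t1; rewrite -affine_extension_le; last lra.
by apply: affine_extension_mono; lra.
Qed.

End LimitFunction.

Section LimitEstimates.
Variables (R : realType) (F : R -> R) (oF : orlicz (EFin \o F)).
Variables (p : nat -> nat -> R) (V W : nat -> nat).
Local Notation S i := (wsum F (p i) (V i) (W i)).
Local Notation G i := (average F (p i) (V i) (W i)).
Hypotheses (p0 : forall i v, 0 <= p i v) (S1 : forall i, 0 < S i 1).

Lemma half_orlicz_limit (g : R -> R) :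
  (forall e : R, 0 < e -> exists i, forall t, 0 <= t <= 2^-1 -> `|G i t - g t| < e) ->
  half_orlicz g.
Proof.
move=> Hg; have h0 : 0 <= 2^-1 :> R by rewrite invr_ge0.
have approx (e : R) : 0 < e -> exists i, forall t, 0 <= t <= 2^-1 ->
    G i t < g t + e /\ g t < G i t + e.
  move=> /Hg[i Hi]; exists i => t /Hi; rewrite ltr_norml => /andP[]; lra.
split.
- have G0 i : G i 0 = 0 by rewrite /average wsum0// mul0r.
  apply/eqP; rewrite eq_le; apply/andP; split; apply/ler_addgt0Pr => e /approx[i Hi];
    by have := Hi 0; rewrite lexx h0 G0 => /(_ isT); lra.
- move=> s t s0 st t2; apply/ler_addgt0Pr => e e0.
  have [i Hi] := approx (e / 2) (divr_gt0 e0 (ltr0Sn _ 1)).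
  have := Hi s; rewrite s0 (le_trans st t2) => /(_ isT)[_ h1].
  have := Hi t; rewrite t2 (le_trans s0 st) => /(_ isT)[h2 _].
  have := average_mono oF (p0 i) (S1 i) s0 st; lra.
- move=> l t l01 /andP[t0 t2]; apply/ler_addgt0Pr => e e0.
  have [i Hi] := approx (e / 2) (divr_gt0 e0 (ltr0Sn _ 1)).
  have /andP[l0 l1] := l01.
  have lt2 : l * t <= 2^-1 by apply: le_trans t2; rewrite ler_piMl.
  have := Hi (l * t); rewrite lt2 mulr_ge0// => /(_ isT)[_ h1].
  have := Hi t; rewrite t2 t0 => /(_ isT)[h2 _].
  have h3 := average_scale oF (p0 i) (S1 i) t0 l01.
  have h4 : l * G i t <= l * (g t + e / 2) by rewrite ler_wpM2l// ltW.
  have h5 : l * (e / 2) <= e / 2 by rewrite ler_piMl// divr_ge0// ltW.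
  lra.
- apply/ler_addgt0Pr => e /approx[i Hi].
  have := Hi 2^-1; rewrite h0 lexx => /(_ isT)[_ h].
  have h01 : 0 <= (2^-1 : R) <= 1 by rewrite h0/= invf_le1// ler1n.
  have := average_scale oF (p0 i) (S1 i) ler01 h01.
  rewrite mulr1 average_eq1//; lra.
Qed.

Variables (g : R -> R) (hg : half_orlicz g).
Hypothesis Gg : forall i t, 0 <= t <= 2^-1 -> `|G i t - g t| <= 2^-1 ^+ i.+1.

Lemma sum_half_pow n : \sum_(i < n) 2^-1 ^+ i.+1 <= 1 :> R.
Proof.
have -> : \sum_(i < n) 2^-1 ^+ i.+1 = 1 - 2^-1 ^+ n :> R.
  elim: n => [|n IH]; first by rewrite big_ord0 expr0 subrr.
  by rewrite big_ord_recr/= IH exprS; field.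
by rewrite gerBl exprn_ge0// invr_ge0.
Qed.

(** As b_i <= 1, b_i / 2 lies in [0, 1/2], where the i-th average exceeds g by at
    most 2^-(i+1). The errors add up to at most 1, and convexity absorbs the
    resulting bound 2, together with C, into the argument. *)
Lemma wsum_sum_le1 (C : R) n (b : nat -> R) : 1 <= C -> (forall i, S i 1 <= C) ->
  (forall i, 0 <= b i) ->
  \sum_(i < n) affine_extension g (b i) <= 1 ->
  \sum_(i < n) S i (2 * (b i / (8 * C))) <= 1.
Proof.
move=> C1 SC b0 gb; have C0 : 0 < C by exact: lt_le_trans C1.
have ge0 t : 0 <= t -> 0 <= affine_extension g t.
  by move=> t0; rewrite -(affine_extension0 hg) affine_extension_mono.
have b1 (i : 'I_n) : b i <= 1.
  apply: (affine_extension_le1 hg); apply: le_trans gb.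
  by rewrite (bigD1 i)//= lerDl sumr_ge0// => j _; rewrite ge0.
apply: (@le_trans _ _ (\sum_(i < n) 2^-1 * (affine_extension g (b i) + 2^-1 ^+ i.+1))).
  apply: ler_sum => i _.
  have -> : 2 * (b i / (8 * C)) = (2 * C)^-1 * (b i / 2) by field; rewrite gt_eqF.
  have bi2 : 0 <= b i / 2 by rewrite divr_ge0.
  have l01 : 0 <= (2 * C)^-1 <= 1.
    by rewrite invr_ge0 mulr_ge0 ?(ltW C0)//= invf_le1 ?mulr_gt0//; lra.
  apply: (le_trans (wsum_scale oF _ _ (p0 i) bi2 l01)).
  have -> : S i (b i / 2) = S i 1 * G i (b i / 2).
    by rewrite /average mulrCA divff ?mulr1// gt_eqF.
  have i2 : 0 <= b i / 2 <= 2^-1 by rewrite bi2/=; have := b1 i; lra.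
  have := Gg i i2; rewrite ler_norml => /andP[_ h].
  have h1 := half_le_affine_extension hg (b0 i) (b1 i).
  have G0 := average_ge0 oF (p0 i) (S1 i) bi2.
  apply: (@le_trans _ _ ((2 * C)^-1 * (C * G i (b i / 2)))).
    by rewrite ler_wpM2l ?ler_wpM2r//; case/andP: l01.
  have -> : (2 * C)^-1 * (C * G i (b i / 2)) = 2^-1 * G i (b i / 2).
    by field; rewrite gt_eqF.
  rewrite ler_pM2l//; lra.
rewrite -mulr_sumr big_split/=; have := sum_half_pow n; lra.
Qed.

(** The averages grow at least linearly beyond 1, so their sum being at most L forces
    b_i <= L; then b_i / (2 L) lies in [0, 1/2], where g is compared with the
    averages. The errors add up to at most 1, and convexity absorbs the bound
    L + 1. *)
Lemma affine_sum_le1 (L : R) n (b : nat -> R) : 1 <= L -> (forall i, 1 <= L * S i 1) ->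
  (forall i, 0 <= b i) ->
  \sum_(i < n) S i (b i) <= 1 ->
  \sum_(i < n) affine_extension g (b i / (2 * L * (L + 1))) <= 1.
Proof.
move=> L1 SL b0 Sb; have L0 : 0 < L by exact: lt_le_trans L1.
have L10 : 0 < L + 1 by rewrite addr_gt0.
have GS (i : nat) : G i (b i) <= L * S i (b i).
  rewrite /average ler_pdivrMr// mulrAC mulrC ler_peMr//.
  by rewrite wsum_ge0.
have SGb : \sum_(i < n) G i (b i) <= L.
  apply: (@le_trans _ _ (\sum_(i < n) L * S i (b i))); first exact: ler_sum.
  by rewrite -mulr_sumr ler_piMr// ltW.
have bL (i : 'I_n) : b i <= L.
  have [bi|/ltW bi] := leP (b i) 1; first exact: le_trans L1.
  apply: (le_trans (average_ge oF (p0 i) (S1 i) bi)); apply: le_trans SGb.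
  by rewrite (bigD1 i)//= lerDl sumr_ge0// => j _; exact: average_ge0.
have main (i : 'I_n) : affine_extension g (b i / (2 * L * (L + 1))) <=
    (L + 1)^-1 * (G i (b i) + 2^-1 ^+ i.+1).
  have l01 : 0 <= (L + 1)^-1 <= 1 by rewrite invr_ge0 (ltW L10)/= invf_le1// lerDr ltW.
  have m01 : 0 <= (2 * L)^-1 <= 1.
    by rewrite invr_ge0 mulr_ge0 ?(ltW L0)//= invf_le1 ?mulr_gt0//; lra.
  have bi0 : 0 <= b i / (2 * L) by rewrite divr_ge0// mulr_ge0// ltW.
  have bi2 : b i / (2 * L) <= 2^-1.
    rewrite ler_pdivrMr ?mulr_gt0//; have := bL i; lra.
  have -> : b i / (2 * L * (L + 1)) = (L + 1)^-1 * (b i / (2 * L)).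
    by field; rewrite !gt_eqF.
  have bi01 : 0 <= b i / (2 * L) <= 2^-1 by rewrite bi0.
  rewrite affine_extension_le; last first.
    by apply: le_trans bi2; rewrite ler_piMl//; case/andP: l01.
  apply: (le_trans (half_orlicz_scale hg l01 bi01)).
  rewrite ler_wpM2l ?invr_ge0 ?(ltW L10)//.
  have := Gg i bi01; rewrite ler_norml => /andP[h _].
  have h1 : G i (b i / (2 * L)) <= G i (b i).
    by apply: average_mono => //; rewrite ler_pdivrMr ?mulr_gt0// ler_peMr//; lra.
  lra.
apply: (le_trans (ler_sum _ (fun i _ => main i))).
rewrite -mulr_sumr big_split/= ler_pdivrMl// mulr1 lerD//.
exact: sum_half_pow.
Qed.

End LimitEstimates.

(** * Disjoint functions and the Orlicz sequence space *)

Section DisjointSums.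
Variables (R : realType) (k : scalars).
Local Notation K := (scalar_field R k).
Variables (F : R -> R) (oF : orlicz (EFin \o F)) (F1 : 0 < F 1).
Local Notation D := (unitI R).
Local Notation mu := (@lebesgue_measure R).
Local Notation X := (LF k (EFin \o F)).
Let bX : banach X := LF_banach k oF F1.

(** At most one summand differs from 0. *)
Lemma disjoint_sum (h : K -> R) (z : nat -> K) n : h 0 = 0 ->
  (forall i j, (i < j)%N -> z i = 0 \/ z j = 0) ->
  h (\sum_(i < n) z i) = \sum_(i < n) h (z i).
Proof.
move=> h0 zz; elim: n => [|n IH]; first by rewrite !big_ord0.
rewrite !big_ord_recr/= -IH; have [->|zn] := eqVneq (z n) 0.
  by rewrite h0 !addr0.
rewrite big1 ?add0r ?h0 ?add0r// => i _.
by have [//|] := zz i n (ltn_ord i) => /eqP; rewrite (negbTE zn).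
Qed.

Variables (y : nat -> X) (cy : forall i, carrier X (y i)).
Hypothesis disj : forall i j t, (i < j)%N ->
  (y i : R -> K) t = 0 \/ (y j : R -> K) t = 0.

Let disj_a (a : nat -> K) t i j : (i < j)%N ->
  a i * (y i : R -> K) t = 0 \/ a j * (y j : R -> K) t = 0.
Proof.
by move=> ij; case: (disj t ij) => ->; [left|right]; rewrite mulr0.
Qed.

Lemma modular_disjoint (a : nat -> K) n r : 0 < r ->
  (modular F (fun t => modulus ((lincomb y a n : R -> K) t) / r)%R =
   \sum_(i < n) modular F (fun t => modulus (a i) / r * modulus ((y i : R -> K) t))%R)%E.
Proof.
move=> r0; rewrite /modular -ge0_integral_sum//; last 2 first.
- move=> i; apply: (measurable_modular_integrand oF).
    by move=> t; rewrite !mulr_ge0 ?modulus_ge0// invr_ge0 ltW.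
  apply: measurable_funM; first exact: measurable_cst.
  by apply: measurable_modulus => //; have [] := cy i.
- by move=> i t _; rewrite lee_fin (orlicz_ge0 oF)// !mulr_ge0 ?modulus_ge0// invr_ge0 ltW.
apply: eq_integral => t _; rewrite sumEFin lincomb_fun.
rewrite (disjoint_sum (h := fun z => F (modulus z / r)) n _ (disj_a a t)); last first.
  by rewrite modulus0 mul0r (orlicz0 oF).
by congr (_%:E); apply: eq_bigr => i _; rewrite modulusM mulrAC.
Qed.

Lemma coordinate_disjoint (a : nat -> K) n (i : 'I_n) :
  modulus (a i) * nrm (y i) <= nrm (lincomb y a n).
Proof.
rewrite -(nrmZ bX)//.
have c1 : carrier X (a i *: y i) by exact: carrierZ.
have c2 : carrier X (lincomb y a n) by exact: carrier_lincomb.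
rewrite -lee_fin -(vnormE bX c1) -(vnormE bX c2).
have [m1 _] := c1; have [m2 _] := c2.
apply: (LF_norm_mono oF) => // t _; rewrite lincomb_fun.
rewrite (disjoint_sum (h := @modulus R k) n (modulus0 R k) (disj_a a t)).
rewrite [leLHS](_ : _ = modulus (a i * (y i : R -> K) t))//.
by rewrite (bigD1 i)//= lerDl sumr_ge0// => j _; exact: modulus_ge0.
Qed.

(** A coefficient in a disjoint sum is bounded by the norm of the sum divided by
    m / 2, and the errors m / 4 * 2^-(i+1) add up to at most m / 4. *)
Lemma perturbation (x : nat -> X) (m : R) (a : nat -> K) n :
  (forall i, carrier X (x i)) -> 0 < m ->
  (forall i, m / 2 <= nrm (y i)) ->
  (forall i, nrm (x i - y i) <= m / 4 * 2^-1 ^+ i.+1) ->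
  nrm (lincomb x a n - lincomb y a n) <= 2^-1 * nrm (lincomb y a n).
Proof.
move=> cx m0 ym xy.
have -> : lincomb x a n - lincomb y a n = \sum_(i < n) a i *: (x i - y i).
  by rewrite /lincomb -sumrB; apply: eq_bigr => i _; rewrite scalerBr.
have cxy i : carrier X (x i - y i) by exact: carrierB.
apply: (le_trans (nrm_sum bX _ _ _)); first by move=> i; exact: carrierZ.
apply: (@le_trans _ _ (\sum_(i < n) 2^-1 * nrm (lincomb y a n) * 2^-1 ^+ i.+1)).
  apply: ler_sum => i _; rewrite (nrmZ bX)//.
  have h1 := coordinate_disjoint a i.
  have ma : modulus (a i) * (m / 2) <= nrm (lincomb y a n).
    by apply: le_trans h1; rewrite ler_wpM2l ?modulus_ge0.
  apply: (le_trans (ler_wpM2l (modulus_ge0 _) (xy i))).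
  rewrite mulrA ler_wpM2r ?exprn_ge0 ?invr_ge0//; lra.
rewrite -mulr_sumr -[leRHS]mulr1 ler_wpM2l ?sum_half_pow//.
by rewrite mulr_ge0 ?invr_ge0 ?nrm_ge0.
Qed.

Lemma perturbation_equivalent (x : nat -> X) (m : R) (a : nat -> K) n :
  (forall i, carrier X (x i)) -> 0 < m ->
  (forall i, m / 2 <= nrm (y i)) ->
  (forall i, nrm (x i - y i) <= m / 4 * 2^-1 ^+ i.+1) ->
  nrm (lincomb y a n) <= 2 * nrm (lincomb x a n) /\
  nrm (lincomb x a n) <= 2 * nrm (lincomb y a n).
Proof.
move=> cx m0 ym xy; have h := perturbation a n cx m0 ym xy.
have cX : carrier X (lincomb x a n) by exact: carrier_lincomb.
have cY : carrier X (lincomb y a n) by exact: carrier_lincomb.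
have h1 := nrm_le_dist bX cX cY.
have h2 := nrm_le_dist bX cY cX.
have h3 := nrm_ge0 bX (lincomb y a n).
move: h2; rewrite (nrm_distC bX cY cX); move: h h1 h3.
move: (nrm _) (nrm _) (nrm _) => u v w *; split; lra.
Qed.

End DisjointSums.

Section OrliczCase.
Variables (R : realType) (k : scalars).
Local Notation K := (scalar_field R k).
Variables (F : R -> R) (oF : orlicz (EFin \o F)).
Variables (dF : doubling_near_infinity F).
Local Notation D := (unitI R).
Local Notation mu := (@lebesgue_measure R).
Local Notation X := (LF k (EFin \o F)).

Let F1 := doubling_F1 dF.
Let bX : banach X := LF_banach k oF F1.

(** Doubling is only available at arguments of at least 1, which is why the function
    is restricted to a set where it is large. *)
Lemma modular_dilate_restr (E : R) (j : nat) (c : R) (f : X) (B : set R) :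
  (forall s i, 1 <= s -> F (2 ^+ i * s) <= E ^+ i * F s) -> 0 <= E -> 0 <= c ->
  carrier X f -> measurable B ->
  (forall t, B t -> 1 <= c * modulus ((f : R -> K) t)) ->
  (modular F (fun t => 2 ^+ j * (c * modulus (restr B f t)))%R <=
   (E ^+ j)%:E * modular F (fun t => c * modulus (restr B f t))%R)%E.
Proof.
move=> HE E0 c0 [mf _] mB cB.
have Ej : (0 <= (E ^+ j)%:E)%E by rewrite lee_fin exprn_ge0.
have mr : measurable_fun D (fun t => c * modulus (restr B f t)).
  apply: measurable_funM; first exact: measurable_cst.
  by apply: measurable_modulus => //; exact: measurable_restr.
have r0 t : 0 <= c * modulus (restr B f t) by rewrite mulr_ge0 ?modulus_ge0.
have mG := measurable_modular_integrand oF r0 mr.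
have G0 t : (0 <= (F (c * modulus (restr B f t)))%:E)%E by rewrite lee_fin (orlicz_ge0 oF).
rewrite /modular -ge0_integralZl//; apply: ge0_le_integral => //.
- by move=> t _; rewrite lee_fin (orlicz_ge0 oF)// mulr_ge0// exprn_ge0.
- apply: (measurable_modular_integrand oF).
    by move=> t; rewrite mulr_ge0// exprn_ge0.
  by apply: measurable_funM => //; exact: measurable_cst.
- by apply: emeasurableZ; exact/measurable_EFinP.
- move=> t _; rewrite -EFinM lee_fin.
  have [Bt|nBt] := pselect (B t).
    by apply: HE; rewrite /restr mem_set//; exact: cB.
  by rewrite /restr memNset// modulus0 !mulr0 (orlicz0 oF) mulr0.
Qed.

(** Norms bounded above and below give modulars bounded above and below: by doubling,
    passing from the norm scale to the scale 1 costs a constant, provided the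
    function exceeds 2^J on its support. Another dilation by 2 pays for the
    rounding. *)
Lemma cell_weight_bounds (m b : R) : 0 < m -> exists (V0 : nat) (c C : R),
  [/\ (0 < V0)%N, 0 < c, 1 <= C & forall (f : X) (B : set R) (V W : nat),
    carrier X f -> nrm f < b -> measurable B -> B `<=` D -> (V0 <= V)%N ->
    (forall t, B t -> V%:R < modulus ((f : R -> K) t) <= W%:R) ->
    m < nrm (restr B f : X) ->
    c <= wsum F (cell_weight f B) V W 1 <= C].
Proof.
move=> m0; have [E E1 HE] := doubling_growth oF dF.
have E0 : 0 <= E by exact: le_trans E1.
have [J HJ] := exists_nat_ge (Num.max b m^-1).
have J2 : J%:R <= 2 ^+ J :> R by rewrite -natrX ler_nat ltnW// ltn_expl.
have bJ : b <= 2 ^+ J.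
  by apply: le_trans J2; apply: le_trans HJ; rewrite le_max lexx.
have mJ : m^-1 <= 2 ^+ J.
  by apply: le_trans J2; apply: le_trans HJ; rewrite le_max lexx orbT.
exists (2 ^ J)%N, (E ^+ J.+1)^-1, (E ^+ J); split.
- by rewrite expn_gt0.
- by rewrite invr_gt0 exprn_gt0// (lt_le_trans _ E1).
- exact: exprn_ege1.
move=> f B V W cf fb mB BD V0V VW mf.
have [smf _] := cf.
have V0 : (0 < V)%N by apply: leq_trans V0V; rewrite expn_gt0.
have V1 : 2 ^+ J <= V%:R :> R by rewrite -natrX ler_nat.
have [cr rle] := carrier_restr oF dF mB cf.
have [smr _] := cr.
have Bf t : B t -> 2 ^+ J <= modulus ((f : R -> K) t).
  by move=> /VW /andP[/ltW h _]; exact: le_trans h.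
have rm t : 0 <= modulus (restr B f t) by exact: modulus_ge0.
(* Since the norm is below 2^J, the modular at the scale 2^J is at most 1. *)
have upper : (modular F (fun t => 1 * modulus (restr B f t))%R <= (E ^+ J)%:E)%E.
  have -> : (fun t => 1 * modulus (restr B f t)) =
      (fun t => 2 ^+ J * ((2 ^+ J)^-1 * modulus (restr B f t))).
    by apply/funext => t; rewrite mulrA mulfV// gt_eqF.
  have cB t : B t -> 1 <= (2 ^+ J)^-1 * modulus ((f : R -> K) t).
    by move=> /Bf h; rewrite ler_pdivlMl// mulr1.
  have i0 : 0 <= (2 ^+ J)^-1 :> R by rewrite invr_ge0 ltW.
  apply: (le_trans (modular_dilate_restr J HE E0 i0 cf mB cB)).
  rewrite -[leRHS]mule1; apply: lee_wpmul2l; first by rewrite lee_fin exprn_ge0.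
  have := @LF_norm_lt _ _ _ oF (restr B f) (2 ^+ J) smr.
  rewrite -[LF_norm _ _]/(vnorm (restr B f : X)) (vnormE bX cr) lte_fin.
  rewrite (le_lt_trans rle (lt_le_trans fb bJ)) => /(_ isT)[_].
  rewrite (_ : (fun t => modulus (restr B f t) / 2 ^+ J) =
    (fun t => (2 ^+ J)^-1 * modulus (restr B f t)))//.
  by apply/funext => t; rewrite mulrC.
(* Since the norm exceeds m and 1 / m <= 2^J, the modular of the dilation by 2^J is
   at least 1. *)
have lower : (1 <= modular F (fun t => 2 ^+ J * (1 * modulus (restr B f t)))%R)%E.
  rewrite leNgt; apply/negP => h.
  have : (modular F (fun t => modulus (restr B f t) / m)%R <= 1)%E.
    apply: le_trans (ltW h); apply: (modular_le oF).
    - by move=> t; rewrite divr_ge0// ltW.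
    - by move=> t _; rewrite mul1r mulrC ler_wpM2r.
    - by move=> t; rewrite mul1r mulr_ge0// ltW.
    - by apply: measurable_div; exact: measurable_modulus.
    - apply: measurable_funM; first exact: measurable_cst.
      apply: measurable_funM; first exact: measurable_cst.
      exact: measurable_modulus.
  move=> /(LF_norm_le m0); rewrite -[LF_norm _ _]/(vnorm (restr B f : X)) (vnormE bX cr).
  by rewrite lee_fin leNgt mf.
have w0 := cell_weight_ge0 f B.
apply/andP; split; last first.
  by rewrite -lee_fin; apply: le_trans upper; exact: wsum_le_modular.
have cB1 t : B t -> 1 <= 1 * modulus ((f : R -> K) t).
  by move=> /Bf h; rewrite mul1r; apply: le_trans h; rewrite exprn_ege1// ler1n.
have := le_trans lower (modular_dilate_restr J HE E0 ler01 cf mB cB1).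
move=> /le_trans => /(_ ((E ^+ J)%:E * (wsum F (cell_weight f B) V W (2 * 1))%:E)%E).
have -> : ((E ^+ J)%:E * modular F (fun t => (1 * modulus (restr B f t))%R) <=
    (E ^+ J)%:E * (wsum F (cell_weight f B) V W (2 * 1))%:E)%E.
  apply: lee_wpmul2l; first by rewrite lee_fin exprn_ge0.
  exact: modular_le_wsum.
move=> /(_ isT); rewrite -EFinM lee_fin => h.
have S2 : wsum F (cell_weight f B) V W (2 * 1) <= E * wsum F (cell_weight f B) V W 1.
  rewrite /wsum mulr_sumr big_seq [leRHS]big_seq; apply: ler_sum => v.
  rewrite mem_index_iota => /andP[Vv _].
  have v1 : 1 <= v%:R :> R by rewrite ler1n (leq_trans V0).
  have := HE _ 1%N v1; rewrite !expr1 mul1r mulr1 => hh.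
  by have := ler_wpM2l (w0 v) hh; lra.
have Ep : 0 < E ^+ J.+1 by rewrite exprn_gt0// (lt_le_trans _ E1).
rewrite -[leLHS]mulr1 ler_pdivrMl//; apply: (le_trans h).
by rewrite exprSr -mulrA ler_wpM2l// exprn_ge0.
Qed.

(** The modulars of the disjoint functions y_j are compared with averages of dilates
    at a level V0 + j tending to infinity, and a further subsequence, of index l,
    makes these averages converge. What remains is to chain the constants: x to its
    subsequence by spreading, the subsequence to the y_j by perturbation, and these
    to the unit vectors of l_G. *)
Lemma equivalent_lG (x : nat -> X) : subsymmetric_basic x ->
  (forall (delta : R) N, 0 < delta -> exists2 n, (N <= n)%N &
    (\int[mu]_(t in D) (modulus ((x n : R -> K) t) ^+ 2)%:E <= delta%:E)%E) ->
  exists2 g : R -> R, CF F g &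
    equivalent x (@unit_vector R k : nat -> lG k (EFin \o affine_extension g)).
Proof.
move=> [bx ux sx] small; have [cx _] := bx.
have [m [N0 [b [m0 b0 xb xm]]]] := subsymmetric_bounded bX bx sx.
have m4 : 0 < m / 4 by rewrite divr_gt0.
have [V0 [c [C [V00 c0 C1 HcC]]]] := cell_weight_bounds (b + 1) m4.
have eta0 j : 0 < m / 4 * 2^-1 ^+ j.+1 by rewrite mulr_gt0// exprn_gt0// invr_gt0.
have [s [W [B [[hs sN] mBD VW disjB xy]]]] :=
  disjointification oF dF N0 cx eta0 V00 small.
pose f j : X := x (s j); pose y j : X := restr (B j) (f j).
have cf j : carrier X (f j) by exact: cx.
have mf j : scalar_measurable D (f j) by have [] := cf j.
have mB j : measurable (B j) by have [] := mBD j.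
have BD j : B j `<=` D by have [] := mBD j.
have cy j : carrier X (y j) by have [] := carrier_restr oF dF (mB j) (cf j).
have p1 j : 2^-1 ^+ j.+1 <= 1 :> R.
  by rewrite exprn_ile1// ?invr_ge0// invf_le1// ler1n.
have ym j : m / 2 <= nrm (y j).
  have h1 := xm _ (sN j); have h2 := xy j.
  have h3 : nrm (x (s j)) <= nrm (f j - y j) + nrm (y j).
    by apply: (nrm_le_dist bX) => //; exact: cy.
  have h4 : m / 4 * 2^-1 ^+ j.+1 <= m / 4 by rewrite ler_piMr// ltW.
  lra.
pose V j := (V0 + j)%N; pose p j := cell_weight (f j) (B j).
have p0 j v : 0 <= p j v by exact: cell_weight_ge0.
have ScC j : c <= wsum F (p j) (V j) (W j) 1 <= C.
  apply: HcC => //.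
  - by apply: (le_lt_trans (xb _)); rewrite ltrDl.
  - exact: leq_addr.
  - exact: VW.
  - by have := ym j; lra.
have S1 j : 0 < wsum F (p j) (V j) (W j) 1.
  by have /andP[h _] := ScC j; exact: lt_le_trans h.
have G01 j t : 0 <= t <= 2^-1 -> 0 <= average F (p j) (V j) (W j) t <= 1.
  move=> /andP[t0 t2]; rewrite average_ge0 ?average_le1// t0 (le_trans t2)//.
  by rewrite invf_le1// ler1n.
have [g [l [hl gl Gg]]] := uniform_subsequence G01
  (fun j => average_lipschitz oF (p0 j) (S1 j)).
have li i : (i <= l i)%N by exact: increasing_ge.
have approx (e : R) (N : nat) : 0 < e -> exists2 i, (N <= i)%N &
    forall t, 0 <= t <= 2^-1 -> `|average F (p (l i)) (V (l i)) (W (l i)) t - g t| < e.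
  move=> e0; have [J HJ] := half_pow_small 1 e0.
  exists (maxn N J); first exact: leq_maxl.
  move=> t /Gg h; apply: (le_lt_trans (h _)).
  by have := HJ (maxn N J).+1 (leqW (leq_maxr N J)); rewrite mul1r.
have [g' CFg g'E] : exists2 g' : R -> R, CF F g' & forall t, 0 <= t <= 2^-1 -> g' t = g t.
  apply: CF_uniform_limit => // b' e e0.
  have [N HN] := exists_nat_ge b'.
  have [i Ni Hi] := approx e N e0.
  exists (average F (p (l i)) (V (l i)) (W (l i))); last exact: Hi.
  apply: (average_hull (p0 (l i)) (S1 (l i))) => v vV.
  have v1 : (0 < v)%N by rewrite (leq_trans _ vV)// addn_gt0 V00.
  split; last first.
    apply: (lt_le_trans F1); apply: (orlicz_mono oF) => //.
    by rewrite ler1n.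
  apply: (le_lt_trans HN); rewrite ltr_nat (leq_trans _ vV)//.
  by rewrite (leq_ltn_trans Ni)// (leq_ltn_trans (li i))// -[X in (X < _)%N]add0n ltn_add2r.
have Gg' i t : 0 <= t <= 2^-1 ->
    `|average F (p (l i)) (V (l i)) (W (l i)) t - g' t| <= 2^-1 ^+ i.+1.
  by move=> t01; rewrite g'E//; exact: Gg.
have hg : half_orlicz g'.
  apply: (half_orlicz_limit oF (p := p \o l) (V := V \o l) (W := W \o l)) => [i v|i|e e0].
  - exact: p0.
  - exact: S1.
  - by have [i _ Hi] := approx e 0%N e0; exists i => t t01; rewrite g'E//; exact: Hi.
exists g' => //.
pose Y i := y (l i); pose Z i := f (l i).
have cY i : carrier X (Y i) by exact: cy.
have cZ i : carrier X (Z i) by exact: cf.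
have dY i j t : (i < j)%N -> (Y i : R -> K) t = 0 \/ (Y j : R -> K) t = 0.
  move=> /hl ij; rewrite /Y /y /restr.
  case: ifPn => [tB1|_]; last by left.
  case: ifPn => [tB2|_]; last by right.
  by exfalso; apply: (disjB _ _ t ij); rewrite -in_setE.
have YZ i : nrm (Z i - Y i) <= m / 4 * 2^-1 ^+ i.+1.
  apply: (le_trans (xy (l i))); rewrite ler_pM2l//.
  by apply: ler_wiXn2l; rewrite ?invr_ge0// ?invf_le1 ?ler1n// ltnS.
have pert a n := perturbation_equivalent oF F1 cY dY a n cZ m0 (fun i => ym (l i)) YZ.
have hk : {homo (s \o l) : i j / (i < j)%N} by move=> i j /hl /hs.
have [E E0 HE] := spreading_estimates bX cx sx hk.
have C0 : 0 < C by exact: lt_le_trans C1.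
have SC i : wsum F (p (l i)) (V (l i)) (W (l i)) 1 <= C by have /andP[] := ScC (l i).
have upper (a : nat -> K) n r : 0 < r ->
    \sum_(i < n) affine_extension g' (modulus (a i) / r) <= 1 ->
    nrm (lincomb Y a n) <= r * (8 * C).
  move=> r0 h; have bi0 i : 0 <= modulus (a i) / r by rewrite divr_ge0 ?modulus_ge0// ltW.
  have := wsum_sum_le1 oF (fun i => p0 (l i)) (fun i => S1 (l i)) hg Gg' C1 SC bi0 h.
  move=> {}h; have rC : 0 < r * (8 * C) by rewrite !mulr_gt0.
  have cl : carrier X (lincomb Y a n) by exact: carrier_lincomb.
  rewrite -lee_fin -(vnormE bX cl); apply: LF_norm_le => //.
  rewrite (modular_disjoint oF cY dY a n rC).
  apply: (@le_trans _ _ (\sum_(i < n) (wsum F (p (l i)) (V (l i)) (W (l i))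
      (2 * (modulus (a i) / r / (8 * C))))%:E)%E); last by rewrite sumEFin lee_fin.
  apply: lee_sum => i _.
  have -> : modulus (a i) / (r * (8 * C)) = modulus (a i) / r / (8 * C).
    by rewrite [in LHS]invfM mulrA.
  have Vl0 : (0 < V (l i))%N by rewrite addn_gt0 V00.
  have bC0 : 0 <= modulus (a i) / r / (8 * C) by rewrite divr_ge0// mulr_ge0// ltW.
  exact: (modular_le_wsum oF (mf (l i)) (mB (l i)) (@BD (l i)) (@VW (l i)) bC0 Vl0).
pose L := Num.max 1 c^-1.
have L1 : 1 <= L by rewrite le_max lexx.
have L0 : 0 < L by exact: lt_le_trans L1.
have SL i : 1 <= L * wsum F (p (l i)) (V (l i)) (W (l i)) 1.
  have /andP[h _] := ScC (l i).
  apply: (@le_trans _ _ (c^-1 * c)); first by rewrite mulVf// gt_eqF.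
  by apply: ler_pM => //; rewrite ?invr_ge0 ?(ltW c0)// le_max lexx orbT.
have lower (a : nat -> K) n r : nrm (lincomb Y a n) < r ->
    \sum_(i < n) affine_extension g' (modulus (a i) / (r * (2 * L * (L + 1)))) <= 1.
  move=> hr; have r0 : 0 < r by apply: le_lt_trans hr; exact: nrm_ge0.
  have cl : carrier X (lincomb Y a n) by exact: carrier_lincomb.
  have [ml _] := cl.
  have := @LF_norm_lt _ _ _ oF (lincomb Y a n) r ml.
  rewrite -[LF_norm _ _]/(vnorm (lincomb Y a n)) (vnormE bX cl) lte_fin hr => /(_ isT)[_].
  rewrite (modular_disjoint oF cY dY a n r0) => h.
  have bi0 i : 0 <= modulus (a i) / r by rewrite divr_ge0 ?modulus_ge0// ltW.
  have Sb : \sum_(i < n) wsum F (p (l i)) (V (l i)) (W (l i)) (modulus (a i) / r) <= 1.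
    rewrite -lee_fin -sumEFin; apply: le_trans h; apply: lee_sum => i _.
    exact: (wsum_le_modular oF (mf (l i)) (mB (l i)) (@BD (l i)) (@VW (l i))).
  have := affine_sum_le1 oF (fun i => p0 (l i)) (fun i => S1 (l i)) hg Gg' L1 SL bi0 Sb.
  apply: le_trans; apply: ler_sum => i _.
  have -> : modulus (a i) / (r * (2 * L * (L + 1))) =
      modulus (a i) / r / (2 * L * (L + 1)) by rewrite [in LHS]invfM mulrA.
  by [].
have Ga0 := affine_extension0 hg.
have Gam := affine_extension_mono hg.
have nYZ a n : nrm (lincomb Y a n) <= 2 * nrm (lincomb Z a n) by have [] := pert a n.
have nZY a n : nrm (lincomb Z a n) <= 2 * nrm (lincomb Y a n) by have [] := pert a n.
pose M1 := 2 * L * (L + 1); pose M2 := 8 * C.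
have M10 : 0 < M1 by rewrite !mulr_gt0// addr_gt0.
have M20 : 0 < M2 by rewrite mulr_gt0.
have A1 : 0 < M1 * (2 * E) by apply: mulr_gt0 => //; exact: mulr_gt0.
have A2 : 0 < E * (2 * M2) by apply: mulr_gt0 => //; exact: mulr_gt0.
have Q0 : 0 < M1 * (2 * E) + E * (2 * M2) by exact: addr_gt0.
have QM1 : M1 * (2 * E) <= M1 * (2 * E) + E * (2 * M2) by rewrite lerDl ltW.
have QM2 : E * (2 * M2) <= M1 * (2 * E) + E * (2 * M2) by rewrite lerDr ltW.
apply: (equivalent_unit_vector bX (lG_solid_fatou k Ga0 Gam) bx Q0) => a n.
  have [h1 _] := HE a n.
  have h2 := nYZ a n.
  apply: (@le_trans _ _ (M1 * nrm (lincomb Y a n))%:E); last first.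
    rewrite lee_fin; apply: (@le_trans _ _ (M1 * (2 * E) * nrm (lincomb x a n))).
      have h3 : nrm (lincomb Y a n) <= 2 * E * nrm (lincomb x a n).
        by apply: (le_trans h2); rewrite -mulrA ler_pM2l//; exact: h1.
      by have := ler_wpM2l (ltW M10) h3; rewrite [in X in _ <= X -> _]mulrA.
    by rewrite ler_wpM2r ?nrm_ge0.
  apply/lee_addgt0Pr => e e0; rewrite -EFinD.
  have -> : M1 * nrm (lincomb Y a n) + e = (nrm (lincomb Y a n) + e / M1) * M1.
    by rewrite mulrDl divfK ?gt_eqF// mulrC.
  have r0 : 0 < nrm (lincomb Y a n) + e / M1.
    by rewrite ltr_wpDl ?nrm_ge0// divr_gt0.
  apply: (lG_norm_head_le Ga0 Gam); first by rewrite mulr_gt0.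
  by apply: lower; rewrite ltrDl divr_gt0.
have [_ h1] := HE a n.
have h2 := nZY a n.
have N0' : (0 <= lG_norm (EFin \o affine_extension g') (head_part n a))%E.
  exact: luxemburg_ge0.
apply: (@le_trans _ _ ((E * (2 * M2))%:E * lG_norm (EFin \o affine_extension g') (head_part n a))%E); last first.
  by apply: lee_wpmul2r; [exact: N0'|rewrite lee_fin; exact: QM2].
case eN : (lG_norm (EFin \o affine_extension g') (head_part n a)) N0' => [v| |] // v0.
  rewrite -EFinM lee_fin.
  apply/ler_addgt0Pr => e e0.
  have := @lG_norm_head_lt _ _ _ Ga0 Gam a n (v + e / (E * (2 * M2))).
  rewrite eN lte_fin ltrDl (divr_gt0 e0 A2) => /(_ isT)[r0 hr].
  have h3 := upper a n _ r0 hr.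
  apply: (le_trans h1).
  apply: (@le_trans _ _ (E * (2 * ((v + e / (E * (2 * M2))) * M2)))).
    by rewrite ler_pM2l//; apply: (le_trans h2); rewrite ler_pM2l.
  rewrite le_eqVlt; apply/orP; left; apply/eqP; field.
  by rewrite !gt_eqF.
by rewrite gt0_muley ?lte_fin// leey.
Qed.

End OrliczCase.

(** * The dichotomy *)

Theorem theorem6p4 (R : realType) (k : scalars) (F : R -> R)
    (orliczF : orlicz (EFin \o F))
    (doublingF : doubling_near_infinity F)
    (incrF : essentially_increasing (fun t => F t * t ^- 2))
    (x : nat -> LF k (EFin \o F))
    (subsym_x : subsymmetric_basic x) :
  equivalent x (@unit_vector R k : nat -> l2 R k) \/
  (exists2 g : R -> R, CF F g &
     equivalent x (@unit_vector R k
                   : nat -> lG k (EFin \o affine_extension g))).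
Proof.
have [[delta [N [d0 H]]]|small] := pselect (exists (delta : R) (N : nat), 0 < delta /\
    forall n, (N <= n)%N -> (delta%:E <=
      \int[@lebesgue_measure R]_(t in unitI R) (modulus ((x n : R -> scalar_field R k) t) ^+ 2)%:E)%E).
  by left; exact: (equivalent_l2 orliczF doublingF incrF subsym_x d0 H).
right; apply: equivalent_lG => // delta N d0.
apply: contrapT => H; apply: small; exists delta, N; split => // n Nn.
by rewrite leNgt; apply/negP => /ltW h; apply: H; exists n.
Qed.
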